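(* Let $U$ be an almost-canonically seminormed ring and $R$ a ring. The following are equivalent: \begin{itemize} \item[(i)] $U$ is $R$-rational. \item[(ii)] The category $\mathsf{Mod}^{Gr}(U|{}_R)$ of positively-graded $(U|{}_R)$-bimodules is semisimple and, for every $n\in\mathbb N$, every simple $(\mathsf A_n|{}_R)$-bimodule is a finitely generated projective right $R$-module. \end{itemize} Furthermore, for $R=\mathsf A_0$ these conditions are equivalent to each of the following: \begin{itemize} \item[(iii)] $\mathsf{Mod}^{Gr}(U|{}_{\mathsf A_0})$ is semisimple. \item[(iv)] The category $\mathsf{Mod}^{Ex}(U|{}_{\mathsf A_0})$ of exhaustive $(U|{}_{\mathsf A_0})$-bimodules is semisimple. \end{itemize}
   Context: Conventions: $\Bbbk$ is a fixed commutative ring, rings are unital associative $\Bbbk$-algebras, $\mathbb N=\{0,1,2,\dots\}$; an $(S|T)$-bimodule has a left $S$- and a right $T$-action. Almost-canonically seminormed ring: a $\mathbb Z$-graded ring $U=\bigoplus_pU_p$ with a decreasing family of graded subspaces $\mathsf N_{\mathsf L}^nU$ ($n\in\mathbb Z$), $\mathsf N_{\mathsf L}^nU_p=\mathsf N_{\mathsf L}^nU\cap U_p$, such that $U\cdot U_{\le -n}\subset\mathsf N_{\mathsf L}^nU$ and $\mathsf N_{\mathsf L}^nU_p=(U\,U_{\le -n})_p+\mathsf N_{\mathsf L}^{m}U_p$ for all $m\ge n$ and $p$; and $(\mathsf N_{\mathsf L}^nU_p)U_q\subset\mathsf N_{\mathsf L}^{n-q}U_{p+q}$, $U_p(\mathsf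 N_{\mathsf L}^nU_q)\subset\mathsf N_{\mathsf L}^nU_{p+q}$. The $n$-th Zhu algebra is $\mathsf A_n=U_0/\mathsf N_{\mathsf L}^{n+1}U_0$. A positively-graded $(U|{}_R)$-bimodule is a $(U|R)$-bimodule $W=\bigoplus_{n\in\mathbb Z}W_n$ with $R$-submodules $W_n$, $U_pW_n\subset W_{p+n}$, and $W_n=0$ for $n\ll0$; morphisms preserve gradings. It is quasi-rigid if each $W_n$ is a finitely generated projective right $R$-module. $U$ is $R$-rational if every positively-graded $(U|{}_R)$-bimodule is a direct sum of quasi-rigid simple ones (simple as graded bimodules). A $(U|R)$-bimodule $W$ is exhaustive if $W=\bigcup_{n\in\mathbb N}\{w\in W:\mathsf N_{\mathsf L}^{n+1}U\cdot w=0\}$. A category is semisimple if every object is a direct sum of simple objects.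
   Formalization: Positively-graded bimodules are additionally required to be exhaustive (automatic if N_L^nU = U·U_{≤-n}); without this the claim fails, e.g. for k=R=K a field, U=U_0=K(x), N_L^nU=U for all n, where (ii) holds but (i) does not. *)

(* Defs.v *)
From HB Require Import structures.
From mathcomp Require Import all_boot all_order all_algebra.
From mathcomp Require Import generic_quotient.
From mathcomp Require Import boolp classical_sets.

Set Implicit Arguments.
Unset Strict Implicit.
Unset Printing Implicit Defensive.

Import Order.TTheory GRing.Theory Num.Theory.

Local Open Scope classical_set_scope.
Local Open Scope quotient_scope.
Local Open Scope ring_scope.

(* A unital associative k-algebra is a ring together with a ring morphism from *)
(* k to its centre.  The library's algType excludes the zero ring, which has   *)
(* to be allowed here (Zhu algebras may vanish), hence pzRingType.             *)
Record kalg (k : comPzRingType) := KAlg {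
  kalg_ring :> pzRingType;
  kstr : {rmorphism k -> kalg_ring};
  kstr_central : forall (a : k) (x : kalg_ring), kstr a * x = x * kstr a
}.
Arguments kstr {k} _.

Definition additive_subgroup (V : zmodType) (A : set V) : Prop :=
  A 0 /\ (forall x y, A x -> A y -> A (x - y)).

Definition ksubspace (k : comPzRingType) (S : kalg k) (A : set S) : Prop :=
  additive_subgroup A /\ (forall (a : k) x, A x -> A (kstr S a * x)).

(* Finite sums of elements of X; this is the additive subgroup generated by X  *)
(* as soon as X is stable under opposite, as it is wherever this is used.      *)
Definition finite_sums (V : zmodType) (X : set V) : set V :=
  [set v | exists (m : nat) (f : 'I_m -> V),
     (forall i, X (f i)) /\ v = \sum_(i < m) f i].

Definition sum_set (V : zmodType) (A B : set V) : set V :=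
  [set a + b | a in A & b in B].

Definition prod_set (S : pzRingType) (A B : set S) : set S :=
  finite_sums [set a * b | a in A & b in B].

Definition internal_direct_sum (V : zmodType) (I : eqType) (A : I -> set V)
  : Prop :=
  (forall v, exists (s : seq I) (f : I -> V),
     [/\ uniq s, forall i, A i (f i) & v = \sum_(i <- s) f i]) /\
  (forall (s : seq I) (f : I -> V),
     uniq s -> (forall i, A i (f i)) -> \sum_(i <- s) f i = 0 ->
     forall i, i \in s -> f i = 0).

(* A is the sum of its intersections with the pieces of the grading gr. *)
Definition graded_subset (V : zmodType) (gr : int -> set V) (A : set V)
  : Prop :=
  forall a, A a -> exists (s : seq int) (f : int -> V),
    [/\ uniq s, forall p, (gr p `&` A) (f p) & a = \sum_(p <- s) f p].

Record graded_ring (k : comPzRingType) := GradedRing {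
  gring :> kalg k;
  gr : int -> set gring;
  gr_ksubspace : forall p, ksubspace (gr p);
  gr_direct : internal_direct_sum gr;
  gr_1 : gr 0 1;
  gr_M : forall p q x y, gr p x -> gr q y -> gr (p + q) (x * y)
}.

Arguments gr {k} _ _ _.

(* U_{<= m}, the sum of the U_p for p <= m. *)
Definition gr_le (k : comPzRingType) (U : graded_ring k) (m : int) : set U :=
  finite_sums (\bigcup_(p in [set p : int | p <= m]) gr U p).

Arguments gr_le {k} U m _.

Record acs_ring (k : comPzRingType) := AcsRing {
  acs_graded :> graded_ring k;
  NL : int -> set acs_graded;
  NL_ksubspace : forall n, ksubspace (NL n);
  NL_graded : forall n, graded_subset (gr acs_graded) (NL n);
  NL_decr : forall n m, n <= m -> NL m `<=` NL n;
  NL_sub : forall n,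
    prod_set [set: acs_graded] (gr_le acs_graded (- n)) `<=` NL n;
  NL_almost : forall n m p, n <= m ->
    NL n `&` gr acs_graded p =
    sum_set (prod_set [set: acs_graded] (gr_le acs_graded (- n))
               `&` gr acs_graded p)
            (NL m `&` gr acs_graded p);
  NL_Mr : forall n p q x u, (NL n `&` gr acs_graded p) x -> gr acs_graded q u ->
    (NL (n - q) `&` gr acs_graded (p + q)) (x * u);
  NL_Ml : forall n p q u x, gr acs_graded p u -> (NL n `&` gr acs_graded q) x ->
    (NL n `&` gr acs_graded (p + q)) (u * x)
}.

Arguments NL {k} _ _ _.

Section ZhuAlgebra.
Variables (k : comPzRingType) (U : acs_ring k).

Definition deg0_pred : {pred U} := fun u => `[< gr U 0 u >].

Fact deg0_subring : subring_closed deg0_pred.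
Proof.
have [[g0 gB] _] := gr_ksubspace U 0.
split; first by apply/asboolP; exact: gr_1.
  by move=> x y /asboolP hx /asboolP hy; apply/asboolP; exact: gB.
move=> x y /asboolP hx /asboolP hy; apply/asboolP.
by have := gr_M hx hy; rewrite addr0.
Qed.

HB.instance Definition _ :=
  GRing.isSubringClosed.Build U deg0_pred deg0_subring.

Definition deg0 : Type := {u : U | deg0_pred u}.

HB.instance Definition _ := SubType.on deg0.
HB.instance Definition _ := [Choice of deg0 by <:].
HB.instance Definition _ :=
  GRing.SubChoice_isSubPzRing.Build U deg0_pred deg0 (GRing.subringClosedP _).

Variable n : nat.

Definition zhu_ideal : {pred deg0} := fun u => `[< NL U n.+1%:Z (val u) >].

Fact zhu_ideal_zmod : zmod_closed zhu_ideal.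
Proof.
have [[h0 hB] _] := NL_ksubspace U n.+1%:Z.
split; first by apply/asboolP; rewrite raddf0.
by move=> x y /asboolP hx /asboolP hy; apply/asboolP; rewrite raddfB; exact: hB.
Qed.

HB.instance Definition _ :=
  GRing.isZmodClosed.Build deg0 zhu_ideal zhu_ideal_zmod.

Fact zhu_idealMl (u x : deg0) : x \in zhu_ideal -> u * x \in zhu_ideal.
Proof.
move=> /asboolP hx; apply/asboolP; rewrite rmorphM.
by case: (NL_Ml (asboolW (valP u)) (conj hx (asboolW (valP x)))).
Qed.

Fact zhu_idealMr (x u : deg0) : x \in zhu_ideal -> x * u \in zhu_ideal.
Proof.
move=> /asboolP hx; apply/asboolP; rewrite rmorphM.
have [] := NL_Mr (conj hx (asboolW (valP x))) (asboolW (valP u)).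
by rewrite subr0.
Qed.

Definition zhu_ring : Type := {ideal_quot zhu_ideal}.

HB.instance Definition _ := GRing.Zmodule.on zhu_ring.

Definition zhu_pi (x : deg0) : zhu_ring := \pi_{ideal_quot zhu_ideal} x.

Fact zhu_piB x y : (x - y \in zhu_ideal) = (zhu_pi x == zhu_pi y).
Proof. exact: Quotient.idealrBE. Qed.

Fact zhu_piK (x : zhu_ring) : zhu_pi (repr x) = x.
Proof. exact: reprK. Qed.

Fact zhu_piD x y : zhu_pi (x + y) = zhu_pi x + zhu_pi y.
Proof. by rewrite /zhu_pi !piE. Qed.

Definition zhu_mul (x y : zhu_ring) : zhu_ring := zhu_pi (repr x * repr y).

Fact zhu_piM x y : zhu_mul (zhu_pi x) (zhu_pi y) = zhu_pi (x * y).
Proof.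
apply/eqP; rewrite -zhu_piB.
rewrite -[_ * _](addrNK (x * repr (zhu_pi y))) -mulrBl -addrA -mulrBr rpredD //.
  by apply: zhu_idealMr; rewrite zhu_piB zhu_piK.
by apply: zhu_idealMl; rewrite zhu_piB zhu_piK.
Qed.

Fact zhu_mulA : associative zhu_mul.
Proof.
by move=> x y z; rewrite -[x]zhu_piK -[y]zhu_piK -[z]zhu_piK !zhu_piM mulrA.
Qed.

Fact zhu_mul1x : left_id (zhu_pi 1) zhu_mul.
Proof. by move=> x; rewrite -[x]zhu_piK zhu_piM mul1r. Qed.

Fact zhu_mulx1 : right_id (zhu_pi 1) zhu_mul.
Proof. by move=> x; rewrite -[x]zhu_piK zhu_piM mulr1. Qed.

Fact zhu_mulDl : left_distributive zhu_mul +%R.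
Proof.
move=> x y z; rewrite -[x]zhu_piK -[y]zhu_piK -[z]zhu_piK -zhu_piD.
by rewrite !zhu_piM -zhu_piD mulrDl.
Qed.

Fact zhu_mulDr : right_distributive zhu_mul +%R.
Proof.
move=> x y z; rewrite -[x]zhu_piK -[y]zhu_piK -[z]zhu_piK -zhu_piD.
by rewrite !zhu_piM -zhu_piD mulrDr.
Qed.

HB.instance Definition _ := GRing.Zmodule_isPzRing.Build zhu_ring
  zhu_mulA zhu_mul1x zhu_mulx1 zhu_mulDl zhu_mulDr.

Fact kstr_deg0 (a : k) : deg0_pred (kstr U a).
Proof.
apply/asboolP; have [_ h] := gr_ksubspace U 0.
by rewrite -[kstr _ _]mulr1; apply: h; exact: gr_1.
Qed.

Definition zhu_kstr (a : k) : zhu_ring :=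
  zhu_pi (exist _ (kstr U a) (kstr_deg0 a)).

Fact zhu_kstrB : zmod_morphism zhu_kstr.
Proof.
move=> a b; apply: (canRL (addrK _)); rewrite /zhu_kstr -zhu_piD; congr zhu_pi.
by apply: val_inj; rewrite /= -rmorphD subrK.
Qed.

Fact zhu_kstrM : monoid_morphism zhu_kstr.
Proof.
split; first by congr zhu_pi; apply: val_inj; rewrite /= rmorph1.
move=> a b; rewrite /zhu_kstr [RHS]zhu_piM; congr zhu_pi.
by apply: val_inj; rewrite /= rmorphM.
Qed.

HB.instance Definition _ :=
  GRing.isZmodMorphism.Build k zhu_ring zhu_kstr zhu_kstrB.
HB.instance Definition _ :=
  GRing.isMonoidMorphism.Build k zhu_ring zhu_kstr zhu_kstrM.

Fact zhu_kstr_central (a : k) (x : zhu_ring) : zhu_kstr a * x = x * zhu_kstr a.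
Proof.
rewrite -[x]zhu_piK /zhu_kstr [LHS]zhu_piM [RHS]zhu_piM; congr zhu_pi.
by apply: val_inj; rewrite /= kstr_central.
Qed.

Definition zhu : kalg k := KAlg zhu_kstr_central.

End ZhuAlgebra.

Record bimod (k : comPzRingType) (S T : kalg k) := Bimod {
  bimod_left :> lmodType S;
  ract : bimod_left -> T -> bimod_left;
  ractDl : forall v w t, ract (v + w) t = ract v t + ract w t;
  ractDr : forall w s t, ract w (s + t) = ract w s + ract w t;
  ractM : forall w s t, ract w (s * t) = ract (ract w s) t;
  ract1 : forall w, ract w 1 = w;
  ract_scale : forall s w t, ract (s *: w) t = s *: ract w t;
  ract_kstr : forall (a : k) w, kstr S a *: w = ract w (kstr T a)
}.

Section RightModule.
Variables (k : comPzRingType) (S T : kalg k) (W : bimod S T).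

(* The right T-module underlying W, as a left module over the opposite ring. *)
Definition rmod : Type := W.

HB.instance Definition _ := GRing.Zmodule.on rmod.

Definition rmod_scale (t : T^c) (w : rmod) : rmod := @ract _ _ _ W w t.

Fact rmod_scaleA a b v :
  rmod_scale a (rmod_scale b v) = rmod_scale (a * b) v.
Proof. by rewrite /rmod_scale -ractM. Qed.

Fact rmod_scale1 : left_id 1 rmod_scale.
Proof. by move=> v; exact: ract1. Qed.

Fact rmod_scaleDr : right_distributive rmod_scale +%R.
Proof. by move=> a v w; exact: ractDl. Qed.

Fact rmod_scaleDl v : {morph rmod_scale^~ v : a b / a + b}.
Proof. by move=> a b; exact: ractDr. Qed.

HB.instance Definition _ := GRing.Zmodule_isLmodule.Build T^c rmod
  rmod_scaleA rmod_scale1 rmod_scaleDr rmod_scaleDl.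

End RightModule.

Definition fin_generated (S : pzRingType) (M : lmodType S) : Prop :=
  exists (m : nat) (g : 'I_m -> M),
    forall x, exists c : 'I_m -> S, x = \sum_(i < m) c i *: g i.

Definition projective (S : pzRingType) (P : lmodType S) : Prop :=
  forall (M N : lmodType S) (g : {linear M -> N}) (f : {linear P -> N}),
    (forall y, exists x, g x = y) ->
    exists h : {linear P -> M}, forall x, g (h x) = f x.

Definition fg_projective (S : pzRingType) (M : lmodType S) : Prop :=
  fin_generated M /\ projective M.

Definition subbimod (k : comPzRingType) (S T : kalg k) (W : bimod S T)
    (A : set W) : Prop :=
  [/\ additive_subgroup A,
      forall s w, A w -> A (s *: w) &
      forall w t, A w -> A (ract w t)].

Definition simple_bimod (k : comPzRingType) (S T : kalg k) (W : bimod S T)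
  : Prop :=
  (exists w : W, w != 0) /\
  (forall A : set W, subbimod A -> A = [set 0] \/ A = setT).

Record bimod_embedding (k : comPzRingType) (S T : kalg k) (V W : bimod S T) :=
  BimodEmbedding {
    bimod_emb :> {linear V -> W};
    bimod_emb_ract : forall v t, bimod_emb (ract v t) = ract (bimod_emb v) t;
    bimod_emb_inj : injective bimod_emb
  }.

Section GradedBimodules.
Variables (k : comPzRingType) (U : acs_ring k) (R : kalg k).

Definition exhaustive (W : bimod U R) : Prop :=
  forall w : W, exists n : nat, forall u, NL U n.+1%:Z u -> u *: w = 0.

(* Positively-graded bimodules.  They have to be exhaustive, which does not    *)
(* follow from the other fields: the elements of U lying in every NL U n need  *)
(* not act by 0.  For example, if U = U_0 = K(x) and NL U n = U for all n,     *)
(* then all Zhu algebras vanish although U has nonzero modules concentrated in *)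
(* one degree.  For the canonical seminorm, NL U n = U U_{<= -n}, the last     *)
(* field is automatic.                                                         *)
Record grbimod := GrBimod {
  grbimod_bimod :> bimod U R;
  gb : int -> set grbimod_bimod;
  gb_subgroup : forall n, additive_subgroup (gb n);
  gb_ract : forall n w r, gb n w -> gb n (ract w r);
  gb_direct : internal_direct_sum gb;
  gb_scale : forall p n u w, gr U p u -> gb n w -> gb (p + n) (u *: w);
  gb_bounded : exists m : int, forall n, n < m -> gb n = [set 0];
  gb_exhaustive : exhaustive grbimod_bimod
}.

Arguments gb g n _ : clear implicits.

Definition simple_grbimod (W : grbimod) : Prop :=
  (exists w : W, w != 0) /\
  (forall A : set W, subbimod A -> graded_subset (gb W) A ->
     A = [set 0] \/ A = setT).

Section Piece.
Variables (W : grbimod) (n : int).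

Definition piece_pred : {pred rmod W} := fun w => `[< gb W n w >].

Fact piece_submod : subsemimod_closed piece_pred.
Proof.
have [g0 gB] := gb_subgroup W n.
split; first split.
- by apply/asboolP.
- move=> x y /asboolP hx /asboolP hy; apply/asboolP.
  rewrite -[y]opprK; apply: (gB) => //.
  by rewrite -[- y]add0r; exact: gB.
- by move=> a x /asboolP hx; apply/asboolP; exact: gb_ract.
Qed.

HB.instance Definition _ :=
  GRing.isSubmodClosed.Build R^c (rmod W) piece_pred piece_submod.

(* W_n as a right R-module. *)
Definition piece : Type := {w : rmod W | piece_pred w}.

HB.instance Definition _ := SubType.on piece.
HB.instance Definition _ := [Choice of piece by <:].
HB.instance Definition _ := [SubChoice_isSubLmodule of piece by <:].

End Piece.

Definition quasi_rigid (W : grbimod) : Prop :=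
  forall n, fg_projective (piece W n).

(* W is the direct sum of the S_i, as a graded bimodule. *)
Definition gr_direct_sum (W : grbimod) (I : eqType) (S : I -> grbimod) : Prop :=
  exists iota : forall i, bimod_embedding (S i) W,
    (forall i n v, gb (S i) n v -> gb W n (iota i v)) /\
    internal_direct_sum (fun i => range (iota i)).

Definition rational : Prop :=
  forall W : grbimod, exists (I : eqType) (S : I -> grbimod),
    (forall i, simple_grbimod (S i) /\ quasi_rigid (S i)) /\ gr_direct_sum W S.

Definition semisimple_Gr : Prop :=
  forall W : grbimod, exists (I : eqType) (S : I -> grbimod),
    (forall i, simple_grbimod (S i)) /\ gr_direct_sum W S.

Definition bimod_direct_sum (W : bimod U R) (I : eqType) (S : I -> bimod U R)
  : Prop :=
  exists iota : forall i, bimod_embedding (S i) W,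
    internal_direct_sum (fun i => range (iota i)).

(* Sub-bimodules of exhaustive bimodules are exhaustive, so the simple objects *)
(* among exhaustive bimodules are the exhaustive simple bimodules.             *)
Definition semisimple_Ex : Prop :=
  forall W : bimod U R, exhaustive W ->
    exists (I : eqType) (S : I -> bimod U R),
      (forall i, exhaustive (S i) /\ simple_bimod (S i)) /\
      bimod_direct_sum W S.

End GradedBimodules.

(* Main.v *)
(* An (A_n|R)-bimodule M has an image L(M) of induction in coinduction, the     *)
(* span of the functions x |-> (x u)_0 m from U to M: it is a positively-graded *)
(* bimodule with degree 0 part M, each of whose nonzero elements is moved by U  *)
(* to a nonzero element of degree 0.  Hence L(M) is simple if M is.             *)
(* Conversely, the degree d part of a simple graded bimodule with lowest degree *)
(* d0 is 0 or a simple A_{d-d0}-bimodule.  This gives (i) <-> (ii).             *)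
(*                                                                              *)
(* Let R = A_0.  If the graded (or exhaustive) bimodules are semisimple then so *)
(* are the (A_n|A_0)-bimodules M (resp. those with n = 0), through L(M).        *)
(* Semisimplicity of all (A_0|A_0)-bimodules makes every right A_0-module       *)
(* projective: for Y inside N, the pairs (f, z) of a k-linear f : N -> Y and    *)
(* z in A_0 with f = z on Y form a bimodule, surjective onto A_0 since Y has    *)
(* complements over the centre of each block, and a central preimage of 1 is a  *)
(* right linear retraction.  An averaging argument shows that simple            *)
(* (A_0|A_0)-bimodules are finitely generated on the right.  For a simple       *)
(* graded S, decomposing id in the bimodule of all functions S_d -> S_d and     *)
(* using S_d = U_{d-d0} U_{d0-d} S_d puts S_d inside a finite sum of the        *)
(* u_i S_{d0}, so that S_d is finitely generated too.                           *)
(*                                                                              *)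
(* An exhaustive W is a quotient of its Rees bimodule, the sum over d of the    *)
(* W^d t^d with W^d = {w | U_{<-d} w = 0}, and simple graded bimodules are      *)
(* simple; this gives (iii) -> (iv).  For (iv) -> (iii), a graded W is the sum  *)
(* of the U T for T simple in {w in W_d | U_{<0} w = 0}, and each U T turns     *)
(* out to be simple as a graded bimodule.                                       *)

(* A positively-graded bimodule is controlled by its pieces. Each piece is a bimodule over some Zhu
   algebra, because operators of very negative degree leave the range of degrees ([u0killed_gb]). A
   piece of a simple graded bimodule is zero or simple over [zhu U n] ([simple_zbimod]), and a
   simple M is the degree 0 piece of the simple [lgrbimod M] ([lgrbimod_simple]). So asking finite
   projectivity of the pieces of simple graded bimodules amounts to asking it of simple Zhu
   bimodules, which is [rational_iff].

   When R is the zeroth Zhu algebra, this condition follows from semisimplicity. Through L(M) all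
   Zhu bimodules become semisimple in the sense of [ss] ([semisimple_Gr_zhu]). If all
   (T|T)-bimodules are semisimple, then T is projective as a bimodule: central elements lift along
   morphisms whose image contains them ([lift_central]). This makes right T-modules projective
   ([all_projective]) and, by averaging maps of finite rank, simple bimodules finitely generated on
   the right ([simple_rfin]). Finiteness then spreads from the lowest degree to every piece
   ([rfin_piece]), which gives [rational_zhu0_Gr].

   The comparison of graded with exhaustive bimodules works for any R. A simple graded bimodule
   stays simple without its grading ([simple_ungraded]) and an exhaustive bimodule is an image of a
   graded one ([rees_ev_surj]), hence a sum of simples. In the other direction, a graded bimodule is
   the sum of simple graded sub-bimodules generated by vectors killed by U_{<0} ([ugen_simple_gsub],
   [sumset_simple_gsub]). Sums of simples are made direct by [sum_to_direct]. *)
Require Import Defs.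
From HB Require Import structures.
From mathcomp Require Import all_boot all_order all_algebra.
From mathcomp Require Import generic_quotient zify.
From mathcomp Require Import boolp classical_sets functions.

Set Implicit Arguments.
Unset Strict Implicit.
Unset Printing Implicit Defensive.

Import Order.TTheory GRing.Theory Num.Theory.

Local Open Scope classical_set_scope.
Local Open Scope ring_scope.

(** * Direct sums of abelian groups *)

Section Additive.

(** Unbundled and phrased with subtraction alone, so that one computation checks it for bare
    functions, such as components obtained by choice. *)
Definition addm (V W : zmodType) (f : V -> W) := forall x y, f (x - y) = f x - f y.

Variables (V W : zmodType) (f : V -> W).
Hypothesis hf : addm f.

Lemma addm0 : f 0 = 0.
Proof. by rewrite -(subrr 0) hf subrr. Qed.

Lemma addmN x : f (- x) = - f x.
Proof. by rewrite -sub0r hf addm0 sub0r. Qed.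

Lemma addmD x y : f (x + y) = f x + f y.
Proof. by rewrite -{1}[y]opprK hf addmN opprK. Qed.

Lemma addm_sum (I : Type) (r : seq I) (P : pred I) (F : I -> V) :
  f (\sum_(i <- r | P i) F i) = \sum_(i <- r | P i) f (F i).
Proof. exact: (big_morph f addmD addm0). Qed.

End Additive.

Section Subgroup.
Variable (V : zmodType).
Implicit Type A : set V.

Lemma subg0 A : additive_subgroup A -> A 0. Proof. by case. Qed.
Lemma subgB A x y : additive_subgroup A -> A x -> A y -> A (x - y).
Proof. by case=> _; apply. Qed.
Lemma subgN A x : additive_subgroup A -> A x -> A (- x).
Proof. by move=> hA Ax; rewrite -sub0r; apply: subgB => //; apply: subg0. Qed.
Lemma subgD A x y : additive_subgroup A -> A x -> A y -> A (x + y).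
Proof. by move=> hA Ax Ay; rewrite -[y]opprK; apply: subgB => //; apply: subgN. Qed.
Lemma subg_sum A (I : Type) (r : seq I) (P : pred I) (F : I -> V) :
  additive_subgroup A -> (forall i, P i -> A (F i)) ->
  A (\sum_(i <- r | P i) F i).
Proof.
move=> hA hF; elim/big_rec: _ => [|i x Pi Ax]; first exact: subg0.
by apply: subgD => //; apply: hF.
Qed.

Lemma fsums_sub (X : set V) : X `<=` finite_sums X.
Proof.
move=> x Xx; exists 1, (fun=> x); split => //.
by rewrite big_ord_recl big_ord0 addr0.
Qed.

Lemma fsums_min (X A : set V) :
  additive_subgroup A -> X `<=` A -> finite_sums X `<=` A.
Proof.
by move=> hA XA _ [m [f [fX ->]]]; apply: subg_sum => // i _; apply: XA.
Qed.

Lemma fsums_subgroup (X : set V) :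
  (forall x, X x -> X (- x)) -> additive_subgroup (finite_sums X).
Proof.
move=> XN; split; first by exists 0, (fun=> 0); split => [[] //|]; rewrite big_ord0.
move=> _ _ [m [f [fX ->]]] [p [g [gX ->]]].
exists (m + p), (fun i => match fintype.split i with inl j => f j | inr j => - g j end).
split; first by move=> i; case: (fintype.split i) => j //; apply: XN.
rewrite big_split_ord -sumrN; congr (_ + _); apply: eq_bigr => i _.
  by rewrite (unsplitK (inl i)).
by rewrite (unsplitK (inr i)).
Qed.

End Subgroup.

Section DirectSum.
Variables (V : zmodType) (I : eqType) (A : I -> set V).
Hypothesis hA : forall i, additive_subgroup (A i).
Hypothesis hD : internal_direct_sum A.

Definition dsupp v : seq I := projT1 (cid (hD.1 v)).

(* The chosen support may be larger than needed, and is not additive in v.     *)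
Definition dcomp i v : V :=
  if i \in dsupp v then projT1 (cid (projT2 (cid (hD.1 v)))) i else 0.

Lemma dcompP i v : A i (dcomp i v).
Proof.
rewrite /dcomp; case: ifP => _; last exact: subg0.
by case: (cid (projT2 (cid (hD.1 v)))) => f [].
Qed.

Lemma dsupp_uniq v : uniq (dsupp v).
Proof. by rewrite /dsupp; case: (cid (hD.1 v)) => s [f []]. Qed.

Lemma dcomp_sum v : v = \sum_(i <- dsupp v) dcomp i v.
Proof.
rewrite {1}[v](_ : v =
  \sum_(i <- dsupp v) projT1 (cid (projT2 (cid (hD.1 v)))) i).
  by rewrite big_seq [RHS]big_seq; apply: eq_bigr => i hi; rewrite /dcomp hi.
by rewrite /dsupp; case: (cid (projT2 (cid (hD.1 v)))) => f [].
Qed.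

Lemma dcomp_supp v i : i \notin dsupp v -> dcomp i v = 0.
Proof. by rewrite /dcomp => /negbTE ->. Qed.

Lemma big_sub_seq (s t : seq I) (F : I -> V) : uniq s -> uniq t ->
  {subset s <= t} -> (forall i, i \notin s -> F i = 0) ->
  \sum_(i <- t) F i = \sum_(i <- s) F i.
Proof.
move=> us ut st F0; rewrite (bigID (mem s)) /= [X in _ + X]big1; last first.
  by move=> i; exact: F0.
rewrite addr0 -big_filter; apply: perm_big; apply: uniq_perm => //.
  exact: filter_uniq.
move=> i; rewrite mem_filter; case: (boolP (i \in s)) => //= /st //.
Qed.

(** Padding both decompositions with zeros to the union of their supports gives a vanishing sum of
    the [dcomp i v - f i], to which independence applies. *)
Lemma dcomp_unique v (s : seq I) (f : I -> V) : uniq s ->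
  (forall i, A i (f i)) -> (forall i, i \notin s -> f i = 0) ->
  v = \sum_(i <- s) f i -> forall i, dcomp i v = f i.
Proof.
move=> us fA f0 vE i.
set t := undup (s ++ dsupp v).
have ut : uniq t by apply: undup_uniq.
have vE1 : v = \sum_(i <- t) f i.
  rewrite vE; apply/esym/big_sub_seq => // j js.
  by rewrite mem_undup mem_cat js.
have vE2 : v = \sum_(i <- t) dcomp i v.
  rewrite [LHS]dcomp_sum; apply/esym/big_sub_seq => //; first exact: dsupp_uniq.
    by move=> j js; rewrite mem_undup mem_cat js orbT.
  exact: dcomp_supp.
case: (boolP (i \in t)) => it; last first.
  move: it; rewrite mem_undup mem_cat negb_or => /andP[/f0 -> /dcomp_supp ->] //.
have H : \sum_(i <- t) (dcomp i v - f i) = 0.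
  by rewrite big_split /= sumrN -vE1 -vE2 subrr.
apply/eqP; rewrite -subr_eq0; apply/eqP.
apply: (hD.2 _ _ ut _ H i it) => j; apply: subgB => //; exact: dcompP.
Qed.

Lemma dcompB i : addm (dcomp i).
Proof.
move=> v w; set t := undup (dsupp v ++ dsupp w).
apply: (@dcomp_unique _ t (fun i => dcomp i v - dcomp i w)).
- exact: undup_uniq.
- by move=> j; apply: subgB => //; apply: dcompP.
- move=> j; rewrite mem_undup mem_cat negb_or => /andP[jv jw].
  by rewrite !dcomp_supp // subrr.
- rewrite big_split /= sumrN; congr (_ - _); rewrite [LHS]dcomp_sum;
    apply/esym/big_sub_seq; rewrite ?dsupp_uniq ?undup_uniq //.
  + by move=> j js; rewrite mem_undup mem_cat js.
  + exact: dcomp_supp.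
  + by move=> j js; rewrite mem_undup mem_cat js orbT.
  + exact: dcomp_supp.
Qed.

Lemma dcomp_in i v j : A i v -> dcomp j v = if j == i then v else 0.
Proof.
move=> Av; apply: (@dcomp_unique v [:: i] (fun j => if j == i then v else 0)).
- by [].
- by move=> l; case: eqP => [->|] // _; apply: subg0.
- by move=> l; rewrite inE => /negbTE ->.
- by rewrite big_seq1 eqxx.
Qed.

Lemma dcomp_id i v : A i v -> dcomp i v = v.
Proof. by move=> Av; rewrite (dcomp_in i Av) eqxx. Qed.

Lemma dcomp_ext v w : (forall i, dcomp i v = dcomp i w) -> v = w.
Proof.
move=> h; apply/eqP; rewrite -subr_eq0 [X in X == _]dcomp_sum big1 // => i _.
by rewrite dcompB h subrr.
Qed.

Lemma dcomp_memP i v : A i v <-> (forall j, j != i -> dcomp j v = 0).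
Proof.
split=> [Av j ji|h]; first by rewrite (dcomp_in j Av) (negbTE ji).
suff -> : v = dcomp i v by apply: dcompP.
apply: dcomp_ext => j; rewrite (dcomp_in j (dcompP i v)); case: eqP => [->//|].
by move/eqP/h.
Qed.

End DirectSum.

(** Applying [g] to the decomposition of [v] puts its terms into the pieces indexed by [sg], and
    injectivity of [sg] keeps them apart. With the identity or a shift of degrees for [sg], this
    makes components compatible with the actions and with embeddings. *)
Lemma dcomp_map (V V' : zmodType) (I I' : eqType) (A : I -> set V)
  (A' : I' -> set V') (hA : forall i, additive_subgroup (A i))
  (hA' : forall i, additive_subgroup (A' i))
  (hD : internal_direct_sum A) (hD' : internal_direct_sum A')
  (sg : I -> I') (g : V -> V') : injective sg -> addm g ->
  (forall i v, A i v -> A' (sg i) (g v)) ->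
  forall i v, dcomp hD' (sg i) (g v) = g (dcomp hD i v).
Proof.
move=> isg gB gA i v.
rewrite {1}[v](dcomp_sum hD) (addm_sum gB) (addm_sum (dcompB hA' hD' _)).
case: (boolP (i \in dsupp hD v)) => iv; last first.
  rewrite (dcomp_supp iv) (addm0 gB) big_seq big1 // => j jv.
  rewrite (dcomp_in hA' hD' _ (gA _ _ (dcompP hA hD j v))).
  by rewrite inj_eq //; case: eqP => // ij; rewrite ij jv in iv.
rewrite (bigD1_seq i) ?dsupp_uniq //= (dcomp_id hA' hD' (gA _ _ (dcompP hA hD i v))).
rewrite big1 ?addr0 // => j ji.
rewrite (dcomp_in hA' hD' _ (gA _ _ (dcompP hA hD j v))) inj_eq //.
by rewrite eq_sym (negbTE ji).
Qed.

(** * Bimodules and semisimplicity *)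

Section Bimodules.
Variable (k : comPzRingType) (S T : kalg k).

Section Ract.
Variable W : bimod S T.

Lemma ractB (t : T) : addm (fun w : W => ract w t).
Proof.
move=> x y; apply/eqP; rewrite -(subr_eq _ _ (- _)) opprK -ractDl.
by rewrite subrK.
Qed.

Lemma ract_sum (I : Type) (r : seq I) (P : pred I) (F : I -> W) (t : T) :
  ract (\sum_(i <- r | P i) F i) t = \sum_(i <- r | P i) ract (F i) t.
Proof. exact: (addm_sum (ractB t)). Qed.

Lemma ract0 (t : T) : ract (0 : W) t = 0.
Proof. exact: (addm0 (ractB t)). Qed.

Lemma ractrB (w : W) : addm (fun t : T => ract w t).
Proof.
move=> x y; apply/eqP; rewrite -(subr_eq _ _ (- _)) opprK -ractDr.
by rewrite subrK.
Qed.

Lemma scalerB_addm (s : S) : addm (fun w : W => s *: w).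
Proof. by move=> x y; rewrite scalerBr. Qed.

Lemma scalelB_addm (w : W) : addm (fun s : S => s *: w).
Proof. by move=> x y; rewrite scalerBl. Qed.

End Ract.

(* A subset of an abelian group on which given operations satisfy the bimodule *)
(* axioms; they need not do so elsewhere.                                      *)
Record prebimod := Prebimod {
  pb_car : zmodType;
  pb_set : set pb_car;
  pb_l : S -> pb_car -> pb_car;
  pb_r : pb_car -> T -> pb_car;
  pb_sub : additive_subgroup pb_set;
  pb_setl : forall s v, pb_set v -> pb_set (pb_l s v);
  pb_setr : forall v t, pb_set v -> pb_set (pb_r v t);
  pb_lDr : forall s v w, pb_set v -> pb_set w ->
    pb_l s (v + w) = pb_l s v + pb_l s w;
  pb_lDl : forall s t v, pb_set v -> pb_l (s + t) v = pb_l s v + pb_l t v;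
  pb_lM : forall s t v, pb_set v -> pb_l s (pb_l t v) = pb_l (s * t) v;
  pb_l1 : forall v, pb_set v -> pb_l 1 v = v;
  pb_rDl : forall v w t, pb_set v -> pb_set w ->
    pb_r (v + w) t = pb_r v t + pb_r w t;
  pb_rDr : forall v s t, pb_set v -> pb_r v (s + t) = pb_r v s + pb_r v t;
  pb_rM : forall v s t, pb_set v -> pb_r v (s * t) = pb_r (pb_r v s) t;
  pb_r1 : forall v, pb_set v -> pb_r v 1 = v;
  pb_lr : forall s v t, pb_set v -> pb_r (pb_l s v) t = pb_l s (pb_r v t);
  pb_k : forall (a : k) v, pb_set v -> pb_l (kstr S a) v = pb_r v (kstr T a)
}.

Section PreToBimod.
Variable P : prebimod.

Definition pb_pred : {pred pb_car P} := fun v => `[< pb_set v >].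

Fact pb_pred_zmod : zmod_closed pb_pred.
Proof.
split; first by apply/asboolP; apply: subg0; exact: pb_sub.
by move=> x y /asboolP hx /asboolP hy; apply/asboolP; apply: subgB => //; exact: pb_sub.
Qed.

HB.instance Definition _ :=
  GRing.isZmodClosed.Build (pb_car P) pb_pred pb_pred_zmod.

Definition pbT : Type := {v : pb_car P | pb_pred v}.

HB.instance Definition _ := SubType.on pbT.
HB.instance Definition _ := [Choice of pbT by <:].
HB.instance Definition _ := [SubChoice_isSubZmodule of pbT by <:].

Lemma pbTP (x : pbT) : pb_set (val x).
Proof. exact: asboolW (valP x). Qed.

Definition pb_in (v : pb_car P) (h : pb_set v) : pbT := exist _ v (asboolT h).

Definition pb_scale (s : S) (x : pbT) : pbT := pb_in (pb_setl s (pbTP x)).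

Fact pb_scaleA a b v : pb_scale a (pb_scale b v) = pb_scale (a * b) v.
Proof. by apply: val_inj; apply: pb_lM; apply: pbTP. Qed.
Fact pb_scale1 : left_id 1 pb_scale.
Proof. by move=> v; apply: val_inj; apply: pb_l1; apply: pbTP. Qed.
Fact pb_scaleDr : right_distributive pb_scale +%R.
Proof. by move=> a v w; apply: val_inj; apply: pb_lDr; apply: pbTP. Qed.
Fact pb_scaleDl v : {morph pb_scale^~ v : a b / a + b}.
Proof. by move=> a b; apply: val_inj; apply: pb_lDl; apply: pbTP. Qed.

HB.instance Definition _ := GRing.Zmodule_isLmodule.Build S pbT
  pb_scaleA pb_scale1 pb_scaleDr pb_scaleDl.

Definition pb_ract (x : pbT) (t : T) : pbT := pb_in (pb_setr t (pbTP x)).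

Definition bimod_of : bimod S T.
Proof.
refine (@Bimod k S T pbT pb_ract _ _ _ _ _ _).
- by move=> v w t; apply: val_inj; apply: pb_rDl; apply: pbTP.
- by move=> w s t; apply: val_inj; apply: pb_rDr; apply: pbTP.
- by move=> w s t; apply: val_inj; apply: pb_rM; apply: pbTP.
- by move=> w; apply: val_inj; apply: pb_r1; apply: pbTP.
- by move=> s w t; apply: val_inj; apply: pb_lr; apply: pbTP.
- by move=> a w; apply: val_inj; apply: pb_k; apply: pbTP.
Defined.

Definition pbval (x : bimod_of) : pb_car P := val (x : pbT).

Definition pbmk (v : pb_car P) (h : pb_set v) : bimod_of := pb_in h.

Lemma pbvalP x : pb_set (pbval x). Proof. exact: pbTP. Qed.
Lemma pbval_inj : injective pbval. Proof. exact: val_inj. Qed.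

End PreToBimod.

End Bimodules.

Section SubBimod.
Variable (k : comPzRingType) (S T : kalg k).
Variables (W : bimod S T).

Lemma sbm_sub (A : set W) : subbimod A -> additive_subgroup A.
Proof. by case. Qed.
Lemma sbm_l (A : set W) s w : subbimod A -> A w -> A (s *: w).
Proof. by case=> _ h _; apply: h. Qed.
Lemma sbm_r (A : set W) w t : subbimod A -> A w -> A (ract w t).
Proof. by case=> _ _; apply. Qed.

Variables (A : set W) (hA : subbimod A).

Definition sub_prebimod : prebimod S T :=
  @Prebimod k S T W A (fun s w => s *: w) (fun w t => ract w t) (sbm_sub hA)
  (fun s w => sbm_l s hA) (fun w t => sbm_r t hA)
  (fun s v w _ _ => scalerDr s v w) (fun s t v _ => scalerDl v s t)
  (fun s t v _ => scalerA s t v) (fun v _ => scale1r v)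
  (fun v w t _ _ => ractDl v w t) (fun v s t _ => ractDr v s t)
  (fun v s t _ => ractM v s t) (fun v _ => ract1 v)
  (fun s v t _ => ract_scale s v t) (fun a v _ => ract_kstr a v).

Definition sub_bimod : bimod S T := bimod_of sub_prebimod.

Definition sbval : sub_bimod -> W := @pbval _ _ _ sub_prebimod.
Definition sbmk (w : W) (h : A w) : sub_bimod := @pbmk _ _ _ sub_prebimod w h.

Lemma sbvalP x : A (sbval x). Proof. exact: (@pbvalP _ _ _ sub_prebimod). Qed.
Lemma sbval_inj : injective sbval. Proof. exact: pbval_inj. Qed.
Lemma sbvalB : addm sbval. Proof. by []. Qed.
Lemma sbvalZ s x : sbval (s *: x) = s *: sbval x. Proof. by []. Qed.
Lemma sbmkK w (h : A w) : sbval (sbmk h) = w. Proof. by []. Qed.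

End SubBimod.

Section Morphisms.
Variable (k : comPzRingType) (S T : kalg k).
Implicit Types V W X : bimod S T.

Definition mor V W (f : V -> W) : Prop :=
  [/\ addm f, forall s x, f (s *: x) = s *: f x &
      forall x t, f (ract x t) = ract (f x) t].

Lemma morB V W (f : V -> W) : mor f -> addm f. Proof. by case. Qed.
Lemma morZ V W (f : V -> W) s x : mor f -> f (s *: x) = s *: f x.
Proof. by case=> _ h _; apply: h. Qed.
Lemma mor_ract V W (f : V -> W) x t : mor f -> f (ract x t) = ract (f x) t.
Proof. by case=> _ _; apply. Qed.
Lemma mor0 V W (f : V -> W) : mor f -> f 0 = 0.
Proof. by move/morB/addm0. Qed.
Lemma mor_sum V W (f : V -> W) (I : Type) (r : seq I) (P : pred I) (F : I -> V) :
  mor f -> f (\sum_(i <- r | P i) F i) = \sum_(i <- r | P i) f (F i).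
Proof. by move/morB/addm_sum. Qed.

Lemma mor_comp V W X (f : V -> W) (g : X -> V) : mor f -> mor g -> mor (f \o g).
Proof.
move=> hf hg; split=> [x y|s x|x t] /=.
- by rewrite (morB hg) (morB hf).
- by rewrite (morZ _ _ hg) (morZ _ _ hf).
- by rewrite (mor_ract _ _ hg) (mor_ract _ _ hf).
Qed.

Lemma subbimod_preim V W (f : V -> W) (A : set W) :
  mor f -> subbimod A -> subbimod (f @^-1` A).
Proof.
move=> hf hA; split; first split.
- by rewrite /= mor0 //; apply: subg0; exact: sbm_sub.
- move=> x y /= hx hy; rewrite (morB hf); apply: subgB => //; exact: sbm_sub.
- by move=> s w /= h; rewrite (morZ _ _ hf); apply: sbm_l.
- by move=> w t /= h; rewrite (mor_ract _ _ hf); apply: sbm_r.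
Qed.

Lemma subbimod_image V W (f : V -> W) (A : set V) :
  mor f -> subbimod A -> subbimod (f @` A).
Proof.
move=> hf hA; split; first split.
- by exists 0; [apply: subg0; exact: sbm_sub|exact: mor0].
- move=> _ _ [x Ax <-] [y Ay <-]; exists (x - y); last exact: morB.
  by apply: subgB => //; exact: sbm_sub.
- by move=> s _ [x Ax <-]; exists (s *: x); [exact: sbm_l|exact: morZ].
- by move=> _ t [x Ax <-]; exists (ract x t); [exact: sbm_r|exact: mor_ract].
Qed.

Lemma subbimod_setT W : subbimod [set: W].
Proof. by []. Qed.

Lemma subbimod_setI W (A B : set W) :
  subbimod A -> subbimod B -> subbimod (A `&` B).
Proof.
move=> hA hB; split; first split.
- by split; apply: subg0; exact: sbm_sub.
- by move=> x y [? ?] [? ?]; split; apply: subgB => //; exact: sbm_sub.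
- by move=> s w [? ?]; split; apply: sbm_l.
- by move=> w t [? ?]; split; apply: sbm_r.
Qed.

Lemma subbimod_set0 W : subbimod [set 0 : W].
Proof.
split; first split => //.
- by move=> x y -> ->; rewrite /= subrr.
- by move=> s w ->; rewrite /= scaler0.
- by move=> w t ->; rewrite /= ract0.
Qed.

Lemma mor_sbval W (A : set W) (hA : subbimod A) : mor (@sbval _ _ _ _ _ hA).
Proof. by []. Qed.

Lemma subbimod_range V W (f : V -> W) : mor f -> subbimod (range f).
Proof. by move=> hf; apply: subbimod_image => //; exact: subbimod_setT. Qed.

(* Zero is allowed. *)
Definition atom W (A : set W) : Prop :=
  subbimod A /\ forall B : set W, subbimod B -> B `<=` A ->
    (forall x, B x -> x = 0) \/ A `<=` B.

(** Semisimplicity seen one vector at a time: the summands that [y] meets are recorded by idempotent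
    endomorphisms, so that no index set for the whole of [W] is carried along. *)
Definition ss W : Prop :=
  forall y : W, exists (m : nat) (p : 'I_m -> W -> W),
    (forall j, [/\ mor (p j), forall x, p j (p j x) = p j x &
                   atom (range (p j))]) /\
    y = \sum_j p j y.

Lemma exists_neq0 (V : zmodType) (m : nat) (f : 'I_m -> V) :
  \sum_i f i != 0 -> exists i, f i != 0.
Proof.
move=> h; apply: contrapT => /forallNP h0; case/eqP: h; apply: big1 => i _.
by apply/eqP/negPn/negP/h0.
Qed.

(** Half of Schur's lemma: the kernel of [f] meets [A] in zero or in all of [A], and [x] excludes
    the latter. *)
Lemma atom_inj V W (f : V -> W) (A : set V) x : mor f -> atom A -> A x ->
  f x != 0 -> forall a b, A a -> A b -> f a = f b -> a = b.
Proof.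
move=> hf [hA hat] Ax fx a b Aa Ab fab.
have hK : subbimod (A `&` f @^-1` [set 0]).
  apply: subbimod_setI => //; apply: subbimod_preim => //; exact: subbimod_set0.
case: (hat _ hK) => [y []//|h0|hs].
  apply/eqP; rewrite -subr_eq0; apply/eqP/h0; split.
    by apply: subgB => //; exact: sbm_sub.
  by rewrite /= (morB hf) fab subrr.
by case: (hs _ Ax) => _ /eqP; rewrite (negbTE fx).
Qed.

(** The other half: the image of [A] in the atom [B] is zero or everything, and [f x] excludes
    zero. *)
Lemma atom_surj V W (f : V -> W) (A : set V) (B : set W) x : mor f ->
  subbimod A -> atom B -> f @` A `<=` B -> A x -> f x != 0 ->
  forall b, B b -> exists2 a, A a & f a = b.
Proof.
move=> hf hA [hB hat] fAB Ax fx b Bb.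
case: (hat _ (subbimod_image hf hA) fAB) => [h0|]; last by move/(_ _ Bb).
by case/eqP: fx; apply: h0; exists x.
Qed.

Lemma ss_direct W (I : eqType) (A : I -> set W) :
  (forall i, atom (A i)) -> internal_direct_sum A -> ss W.
Proof.
move=> hat hD y.
have hA i : additive_subgroup (A i) by case: (hat i) => /sbm_sub.
exists (size (dsupp hD y)), (fun j => dcomp hD (tnth (in_tuple (dsupp hD y)) j)).
split; last by rewrite {1}[y](dcomp_sum hD) big_tnth.
move=> j; move: (tnth _ j) => {j} i; split.
- split; first exact: dcompB.
  + move=> s x; apply: (@dcomp_map _ _ _ _ _ _ hA hA hD hD id) => //.
      exact: scalerB_addm.
    by move=> l v; apply: sbm_l; case: (hat l).
  + move=> x t.
    apply: (@dcomp_map _ _ _ _ _ _ hA hA hD hD id (fun x => ract x t)) => //.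
      exact: ractB.
    by move=> l v; apply: sbm_r; case: (hat l).
- by move=> x; apply: dcomp_id => //; apply: dcompP.
- suff -> : range (dcomp hD i) = A i by exact: hat.
  rewrite eqEsubset; split; first by move=> _ [x _ <-]; apply: dcompP.
  by move=> x Ax; exists x => //; apply: dcomp_id.
Qed.

(** Some projection [p j] of [W] onto an atom does not vanish at [x], hence not on some atom [A] of
    [B]. By Schur it maps [A] isomorphically onto its range; following [p j] by the inverse gives
    [ph], which is the identity on [A]. *)
Lemma ss_retract W (B : set W) (hB : subbimod B) (x : W) :
  ss W -> ss (sub_bimod hB) -> B x -> x != 0 ->
  exists ph : W -> W, [/\ mor ph, forall w, B (ph w) &
    exists2 s, B s /\ s != 0 & ph s = s].
Proof.
move=> sW sB Bx x0.
have [m [p [hp xE]]] := sW x.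
have [j pj0] : exists j, p j x != 0 by apply: exists_neq0; rewrite -xE.
have [mj _ aj] := hp j.
have [m' [p' [hp' xE']]] := sB (sbmk hB Bx).
pose f (v : sub_bimod hB) := p j (sbval v).
have mf : mor f by apply: (mor_comp mj); exact: mor_sbval.
have [i fi0] : exists i, f (p' i (sbmk hB Bx)) != 0.
  by apply: exists_neq0; rewrite -(mor_sum _ _ _ mf) -xE'.
have [mi _ ai] := hp' i.
set A := range (p' i) in ai; set x1 := p' i _ in fi0.
have Ax1 : A x1 by exists (sbmk hB Bx).
have fA : f @` A `<=` range (p j) by move=> _ [a _ <-]; exists (sbval a).
have [sA _] := ai.
have ch w : exists a, A a /\ f a = p j w.
  have [|a Aa <-] := atom_surj mf sA aj fA Ax1 fi0 (b := p j w); first by exists w.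
  by exists a.
have [g hg] := choice ch.
have inj := atom_inj mf ai Ax1 fi0.
have gA w : A (g w) by case: (hg w).
have gf w : f (g w) = p j w by case: (hg w).
exists (fun w => sbval (g w)); split; last 2 first.
- by move=> w; exact: sbvalP.
- exists (sbval x1); first split; first exact: sbvalP.
    by apply: contraNneq fi0 => x10; rewrite /f x10 (mor0 mj).
  by congr sbval; apply: inj => //; rewrite gf.
have -> : (fun w => sbval (g w)) = @sbval _ _ _ _ _ hB \o g by [].
apply: mor_comp; first exact: mor_sbval.
split=> [u v|s u|u t]; apply: inj => //.
- by apply: subgB => //; exact: sbm_sub.
- by rewrite gf (morB mf) !gf (morB mj).
- exact: sbm_l.
- by rewrite gf (morZ _ _ mf) gf (morZ _ _ mj).
- exact: sbm_r.
- by rewrite gf (mor_ract _ _ mf) gf (mor_ract _ _ mj).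
Qed.

Section FunBimod.
Variables (X : Type) (W : bimod S T).

Definition fun_prebimod : prebimod S T.
Proof.
refine (@Prebimod k S T (X -> W) setT (fun s f x => s *: f x)
  (fun f t x => ract (f x) t) _ _ _ _ _ _ _ _ _ _ _ _ _) => //.
- by move=> *; apply/funext => x; rewrite scalerDr.
- by move=> *; apply/funext => x; rewrite scalerDl.
- by move=> *; apply/funext => x; rewrite scalerA.
- by move=> *; apply/funext => x; rewrite scale1r.
- by move=> *; apply/funext => x; rewrite ractDl.
- by move=> *; apply/funext => x; rewrite ractDr.
- by move=> *; apply/funext => x; rewrite ractM.
- by move=> *; apply/funext => x; rewrite ract1.
- by move=> *; apply/funext => x; rewrite ract_scale.
- by move=> *; apply/funext => x; rewrite ract_kstr.
Defined.

Definition fun_bimod : bimod S T := bimod_of fun_prebimod.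

Definition fbval (f : fun_bimod) : X -> W := pbval f.
Definition fbmk (f : X -> W) : fun_bimod := @pbmk _ _ _ fun_prebimod f I.

Lemma mor_ev (x : X) : mor (fun f : fun_bimod => fbval f x).
Proof. by []. Qed.
End FunBimod.

End Morphisms.

(** * Lifting central elements along morphisms *)

Section Lift.
Variable (k : comPzRingType) (T : kalg k).
Hypothesis hss : forall W : bimod T T, ss W.

(** Such an x amounts to a bimodule morphism from [T] to [W], namely a |-> a x. *)
Definition central (W : bimod T T) (x : W) := forall a, a *: x = ract x a.

Lemma central_sum (W : bimod T T) (m : nat) (f : 'I_m -> W) :
  (forall i, central (f i)) -> central (\sum_i f i).
Proof.
move=> h a; rewrite ract_sum scaler_sumr; apply: eq_bigr => i _; exact: h.
Qed.

Lemma central_mor (V W : bimod T T) (f : V -> W) x :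
  mor f -> central x -> central (f x).
Proof. by move=> hf h a; rewrite -(morZ _ _ hf) h (mor_ract _ _ hf). Qed.

(** The preimage of [A] is semisimple, so one of its own atoms maps isomorphically onto [A]. The
    vector v above [y] in that atom is central because [a *: v] and [ract v a] have the same
    image. *)
Lemma lift_atom (X Y : bimod T T) (q : X -> Y) (A : set Y) y :
  mor q -> atom A -> A y -> central y -> range q y ->
  exists2 x, central x & q x = y.
Proof.
move=> hq aA Ay cy [x0 _ qx0].
have [->|y0] := eqVneq y 0.
  by exists 0; [move=> a; rewrite scaler0 ract0|rewrite (mor0 hq)].
have hX : subbimod (q @^-1` A) by apply: subbimod_preim => //; exact: (proj1 aA).
have Ax0 : (q @^-1` A) x0 by rewrite /= qx0.
have [m [p [hp xE]]] := hss (sbmk hX Ax0).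
pose f (v : sub_bimod hX) := q (sbval v).
have mf : mor f by apply: (mor_comp hq); exact: mor_sbval.
have [i fi0] : exists i, f (p i (sbmk hX Ax0)) != 0.
  by apply: exists_neq0; rewrite -(mor_sum _ _ _ mf) -xE /f sbmkK qx0.
have [mi _ ai] := hp i; have [sB _] := ai.
have Bx : range (p i) (p i (sbmk hX Ax0)) by exists (sbmk hX Ax0).
have fB : f @` range (p i) `<=` A by move=> _ [a _ <-]; exact: (sbvalP a).
have [v Bv fv] := atom_surj mf sB aA fB Bx fi0 Ay.
have inj := atom_inj mf ai Bx fi0.
exists (sbval v) => // a.
suff h : a *: v = ract v a.
  by rewrite -(morZ _ _ (mor_sbval hX)) h.
apply: inj; [exact: sbm_l|exact: sbm_r|].
by rewrite (morZ _ _ mf) (mor_ract _ _ mf) fv.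
Qed.

(** Inside the image of [q], the components of the central [y] in atoms are again central, and
    [lift_atom] lifts each of them. *)
Lemma lift_central (X Y : bimod T T) (q : X -> Y) y :
  mor q -> central y -> range q y -> exists2 x, central x & q x = y.
Proof.
move=> hq cy ry.
pose Y' := sub_bimod (subbimod_range hq).
pose q' (x : X) : Y' := sbmk (subbimod_range hq) (imageT q x).
have hq' : mor q'.
  split=> [u v|a u|u t]; apply: sbval_inj.
  - exact: (morB hq).
  - exact: (morZ _ _ hq).
  - exact: (mor_ract _ _ hq).
pose y' : Y' := sbmk (subbimod_range hq) ry.
have cy' : central y' by move=> a; apply: sbval_inj; exact: cy.
have [m [p [hp yE]]] := hss y'.
have h i : exists x, central x /\ q' x = p i y'.
  have [mi _ ai] := hp i.
  have [|||x cx qx] := @lift_atom X Y' q' _ (p i y') hq' ai.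
  - by exists y'.
  - exact: central_mor.
  - have [x _ qx] := sbvalP (p i y').
    by exists x => //; apply: sbval_inj.
  - by exists x.
have [x hx] := choice h.
exists (\sum_i x i); first by apply: central_sum => i; case: (hx i).
have -> : q (\sum_i x i) = sbval (q' (\sum_i x i)) by [].
rewrite (mor_sum _ _ _ hq') (eq_bigr (fun i => p i y')) -?yE //.
by move=> i _; case: (hx i).
Qed.

End Lift.

(** * Zhu algebras and their bimodules *)

Lemma graded_subset_dcomp (V : zmodType) (A : int -> set V)
  (hA : forall i, additive_subgroup (A i)) (hD : internal_direct_sum A)
  (B : set V) : additive_subgroup B ->
  (graded_subset A B <-> forall v p, B v -> B (dcomp hD p v)).
Proof.
move=> hB; split=> [h v p /h[s [f [us hf ->]]]|h v Bv].
  have fA i : A i (f i) by case: (hf i).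
  rewrite (addm_sum (dcompB hA hD p)); apply: subg_sum => // i _.
  rewrite (dcomp_in hA hD _ (fA i)).
  by case: ifP => _; [case: (hf i)|exact: subg0].
exists (dsupp hD v), (fun p => dcomp hD p v); split.
- exact: dsupp_uniq.
- by move=> p; split; [exact: dcompP|exact: h].
- exact: dcomp_sum.
Qed.

Section RingU.
Variables (k : comPzRingType) (U : acs_ring k).
Implicit Types (u v x y : U) (p q : int).

Lemma gr_sub p : additive_subgroup (gr U p).
Proof. by case: (gr_ksubspace U p). Qed.

Definition comp p u : U := dcomp (gr_direct U) p u.

Lemma comp_gr p u : gr U p (comp p u).
Proof. exact: (dcompP gr_sub). Qed.

Lemma compB p : addm (comp p).
Proof. exact: (dcompB gr_sub). Qed.

Lemma comp_id p u : gr U p u -> comp p u = u.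
Proof. exact: (dcomp_id gr_sub). Qed.

Lemma comp_in p q u : gr U p u -> comp q u = if q == p then u else 0.
Proof. exact: (dcomp_in gr_sub). Qed.

Lemma comp_sum u : u = \sum_(p <- dsupp (gr_direct U) u) comp p u.
Proof. exact: dcomp_sum. Qed.

Lemma gr_ind (P : U -> Prop) :
  (forall x y, P x -> P y -> P (x + y)) -> P 0 ->
  (forall p x, gr U p x -> P x) -> forall x, P x.
Proof.
move=> PD P0 Pgr x; rewrite [x]comp_sum; elim/big_rec: _ => // p y _.
by apply: PD; exact: Pgr (comp_gr _ _).
Qed.

Lemma mulrB_addm u : addm (fun x => x * u).
Proof. by move=> x y; rewrite mulrBl. Qed.
Lemma mullB_addm u : addm (fun x => u * x).
Proof. by move=> x y; rewrite mulrBr. Qed.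

Lemma comp_mulr p q x u : gr U q u -> comp (p + q) (x * u) = comp p x * u.
Proof.
move=> hu; apply: (@dcomp_map _ _ _ _ _ _ gr_sub gr_sub _ _ (fun p => p + q)
  (fun x => x * u)).
- exact: addIr.
- exact: mulrB_addm.
- by move=> i v hv; apply: gr_M.
Qed.

Lemma comp_mull p q x u : gr U q u -> comp (q + p) (u * x) = u * comp p x.
Proof.
move=> hu; apply: (@dcomp_map _ _ _ _ _ _ gr_sub gr_sub _ _ (fun p => q + p)
  (fun x => u * x)).
- exact: addrI.
- exact: mullB_addm.
- by move=> i v hv; apply: gr_M.
Qed.

Lemma comp_mulr0 q x u : gr U q u -> comp 0 (x * u) = comp (- q) x * u.
Proof. by move=> hu; rewrite -(comp_mulr _ _ hu) addNr. Qed.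

Lemma NL_subg n : additive_subgroup (NL U n).
Proof. by case: (NL_ksubspace U n). Qed.

Lemma NL_comp n p x : NL U n x -> NL U n (comp p x).
Proof.
have /(graded_subset_dcomp gr_sub (gr_direct U) (NL_subg n)) h := @NL_graded k U n.
exact: h.
Qed.

Lemma NL_l n u x : NL U n x -> NL U n (u * x).
Proof.
move=> hx; elim/gr_ind: u => [u v hu hv||p u hu].
- by rewrite mulrDl; apply: subgD => //; exact: NL_subg.
- by rewrite mul0r; apply: subg0; exact: NL_subg.
- rewrite [x]comp_sum mulr_sumr; apply: subg_sum; first exact: NL_subg.
  move=> q _; have [|//] := NL_Ml hu (q := q) (x := comp q x) (n := n).
  by split; [exact: NL_comp|exact: comp_gr].
Qed.

Lemma NL_r n q x u : NL U n x -> gr U q u -> NL U (n - q) (x * u).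
Proof.
move=> hx hu; rewrite [x]comp_sum mulr_suml; apply: subg_sum.
  exact: NL_subg.
move=> p _; have [|//] := NL_Mr (n := n) (p := p) (x := comp p x) _ hu.
by split; [exact: NL_comp|exact: comp_gr].
Qed.

Lemma gr_NL n p u : p <= - n -> gr U p u -> NL U n u.
Proof.
move=> pn hu; apply: NL_sub; apply: fsums_sub.
exists 1 => //; exists u; last by rewrite mul1r.
by apply: fsums_sub; exists p.
Qed.

Section Killed.
Variables (R : kalg k) (W : bimod U R).

(* NL^n = U U_{<= -n} + NL^m in each degree, for m large enough that NL^m      *)
(* kills w.                                                                    *)
Lemma killed n (w : W) : exhaustive W ->
  (forall p u, p <= - n -> gr U p u -> u *: w = 0) ->
  forall u, NL U n u -> u *: w = 0.
Proof.
move=> hW hw u hu; rewrite [u]comp_sum scaler_suml big1 // => p _.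
have [m0 hm0] := hW w.
pose m : int := Num.max n m0.+1%:Z.
have hm v : NL U m v -> v *: w = 0.
  by move=> hv; apply: hm0; apply: NL_decr hv; rewrite /m le_max lexx orbT.
have nm : n <= m by rewrite /m le_max lexx.
have : (NL U n `&` gr U p) (comp p u).
  by split; [exact: NL_comp|exact: comp_gr].
rewrite (NL_almost U p nm) => -[a [ha _] [b [/hm hb _] <-]].
rewrite scalerDl hb addr0 => {hb b}.
have hK : additive_subgroup [set a | a *: w = 0].
  split=> [|x y /= hx hy]; first by rewrite /= scale0r.
  by rewrite scalerBl hx hy subrr.
apply: (fsums_min hK _ ha) => _ [x _ [y hy <-]] /=.
have hKy : additive_subgroup [set y | x * y *: w = 0].
  split=> [|z t /= hz ht]; first by rewrite /= mulr0 scale0r.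
  by rewrite mulrBr scalerBl hz ht subrr.
apply: (fsums_min hKy _ hy) => z [q qn hz] /=.
by rewrite -scalerA (hw q) // scaler0.
Qed.
End Killed.

Section ZhuMaps.
Variable n : nat.

Definition d0 u : deg0 U := exist _ (comp 0 u) (asboolT (comp_gr 0 u)).

(** Made total on [U] by discarding the components of nonzero degree; multiplicativity is available
    when one factor has degree 0. *)
Definition zcl u : zhu U n := zhu_pi n (d0 u).

Definition zrep (a : zhu U n) : U := val (repr (a : zhu_ring U n)).

Lemma zrep_gr a : gr U 0 (zrep a).
Proof. exact: asboolW (valP (repr (a : zhu_ring U n))). Qed.

Lemma d0B : addm d0.
Proof. by move=> x y; apply: val_inj; rewrite raddfB /=; exact: compB. Qed.

Lemma d0_id (x : deg0 U) : d0 (val x) = x.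
Proof. by apply: val_inj => /=; apply: comp_id; exact: asboolW (valP x). Qed.

Lemma zpiB : addm (@zhu_pi _ U n).
Proof.
move=> x y; apply/eqP; rewrite -(subr_eq _ _ (- _)) opprK.
by rewrite -zhu_piD subrK.
Qed.

Lemma zclB : addm zcl.
Proof. by move=> x y; rewrite /zcl d0B zpiB. Qed.

Lemma zcl_eq0 u : zcl u = 0 <-> NL U n.+1%:Z (comp 0 u).
Proof.
have -> : (0 : zhu U n) = zhu_pi n 0.
  by apply/esym/(addm0 zpiB).
split=> [/eqP|h].
  by rewrite -zhu_piB subr0 => /asboolP.
by apply/eqP; rewrite -zhu_piB subr0; apply/asboolP.
Qed.

Lemma zcl_NL u : NL U n.+1%:Z u -> zcl u = 0.
Proof. by move=> h; apply/zcl_eq0; exact: NL_comp. Qed.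

Lemma zcl_comp u : zcl (comp 0 u) = zcl u.
Proof.
by rewrite /zcl; congr zhu_pi; apply: val_inj => /=; rewrite (comp_id (comp_gr _ _)).
Qed.

Lemma zcl_rep a : zcl (zrep a) = a.
Proof. by rewrite /zcl d0_id zhu_piK. Qed.

Lemma zclMl u v : gr U 0 u -> zcl (u * v) = zcl u * zcl v.
Proof.
move=> hu; rewrite [RHS]zhu_piM; congr zhu_pi; apply: val_inj => /=.
by rewrite -[0 in LHS]addr0 (comp_mull _ _ hu) (comp_id hu).
Qed.

Lemma zclMr u v : gr U 0 v -> zcl (u * v) = zcl u * zcl v.
Proof.
move=> hv; rewrite [RHS]zhu_piM; congr zhu_pi; apply: val_inj => /=.
by rewrite -[0 in LHS]addr0 (comp_mulr _ _ hv) (comp_id hv).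
Qed.

Lemma zcl1 : zcl 1 = 1.
Proof.
rewrite /zcl; congr zhu_pi; apply: val_inj => /=; apply: comp_id; exact: gr_1.
Qed.

Lemma zcl_kstr (a : k) : zcl (kstr U a) = kstr (zhu U n) a.
Proof.
rewrite /zcl; congr zhu_pi; apply: val_inj => /=; apply: comp_id.
exact: asboolW (kstr_deg0 U a).
Qed.

Lemma gr_kstr (a : k) : gr U 0 (kstr U a).
Proof. exact: asboolW (kstr_deg0 U a). Qed.

Lemma zrep_zcl u : gr U 0 u -> NL U n.+1%:Z (zrep (zcl u) - u).
Proof.
move=> hu.
have h : gr U 0 (zrep (zcl u) - u).
  by apply: subgB => //; [exact: gr_sub|exact: zrep_gr].
by rewrite -(comp_id h); apply/zcl_eq0; rewrite zclB zcl_rep subrr.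
Qed.

End ZhuMaps.
End RingU.

Section SpanDirect.
Variables (V : zmodType) (I : eqType) (A : I -> set V).
Hypothesis hA : forall i, additive_subgroup (A i).

(** The existence half of [internal_direct_sum] for a single vector. Being a subgroup, it can be
    tested on generators. *)
Definition splits_in (v : V) := exists (s : seq I) (f : I -> V),
  [/\ uniq s, forall i, A i (f i) & v = \sum_(i <- s) f i].

Lemma splits_in_subgroup : additive_subgroup splits_in.
Proof.
split; first by exists [::], (fun=> 0); split => // [i|];
  [exact: subg0|rewrite big_nil].
have aux (s t : seq I) (f : I -> V) : uniq s -> uniq t -> {subset s <= t} ->
    \sum_(i <- t) (if i \in s then f i else 0) = \sum_(i <- s) f i.
  move=> us ut st; rewrite (big_sub_seq us ut st) => [|i /negbTE -> //].
  by rewrite big_seq [RHS]big_seq; apply: eq_bigr => i ->.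
move=> _ _ [s [f [us fA ->]]] [t [g [ut gA ->]]].
exists (undup (s ++ t)), (fun i =>
  (if i \in s then f i else 0) - (if i \in t then g i else 0)); split.
- exact: undup_uniq.
- by move=> i; apply: subgB => //; case: ifP => // _; exact: subg0.
- rewrite big_split /= sumrN; congr (_ - _).
    by rewrite aux ?undup_uniq // => i h; rewrite mem_undup mem_cat h.
  by rewrite aux ?undup_uniq // => i h; rewrite mem_undup mem_cat h orbT.
Qed.

Lemma splits_in_piece i v : A i v -> splits_in v.
Proof.
move=> h; exists [:: i], (fun j => if j == i then v else 0); split => //.
  by move=> j; case: eqP => [->|_] //; exact: subg0.
by rewrite big_seq1 eqxx.
Qed.

End SpanDirect.

Section ZhuBimod.
Variables (k : comPzRingType) (U : acs_ring k) (R : kalg k).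
Variables (W : bimod U R).

Definition u0sub (A : set W) :=
  [/\ additive_subgroup A,
      forall u w, gr U 0 u -> A w -> A (u *: w) &
      forall w t, A w -> A (ract w t)].

Definition u0killed n (A : set W) :=
  forall u w, NL U n.+1%:Z u -> gr U 0 u -> A w -> u *: w = 0.

Variables (n : nat) (A : set W) (hA : u0sub A) (hK : u0killed n A).

Lemma u0s_sub : additive_subgroup A. Proof. by case: hA. Qed.

Lemma zrep_act u w : gr U 0 u -> A w -> zrep (zcl n u) *: w = u *: w.
Proof.
move=> hu Aw; apply/eqP; rewrite -subr_eq0 -scalerBl; apply/eqP/hK => //.
  exact: zrep_zcl.
by apply: subgB => //; [exact: gr_sub|exact: zrep_gr].
Qed.

Definition zprebimod : prebimod (zhu U n) R.
Proof.
refine (@Prebimod k (zhu U n) R W A (fun a w => zrep a *: w)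
  (fun w t => ract w t) u0s_sub _ _ _ _ _ _ _ _ _ _ _ _).
- by move=> a w; case: hA => _ hl _; apply: hl; exact: zrep_gr.
- by move=> w t; case: hA => _ _; apply.
- by move=> s v w _ _; rewrite scalerDr.
- move=> s t v Av.
  rewrite -scalerDl -(@zrep_act (zrep s + zrep t)) //; last first.
    by apply: subgD; [exact: gr_sub|exact: zrep_gr|exact: zrep_gr].
  by rewrite (addmD (@zclB _ _ n)) !zcl_rep.
- move=> s t v Av.
  rewrite scalerA -(@zrep_act (zrep s * zrep t)) //; last first.
    by rewrite -(addr0 (0 : int)); apply: gr_M; exact: zrep_gr.
  by rewrite zclMl ?zcl_rep //; exact: zrep_gr.
- by move=> v Av; rewrite -zcl1 zrep_act ?scale1r //; exact: gr_1.
- by move=> v w t _ _; rewrite ractDl.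
- by move=> v s t _; rewrite ractDr.
- by move=> v s t _; rewrite ractM.
- by move=> v _; rewrite ract1.
- by move=> s v t _; rewrite ract_scale.
- move=> a v Av; rewrite -zcl_kstr zrep_act ?ract_kstr //; exact: gr_kstr.
Defined.

Definition zbimod : bimod (zhu U n) R := bimod_of zprebimod.

Definition zbval (x : zbimod) : W := @pbval _ _ _ zprebimod x.
Definition zbmk (w : W) (h : A w) : zbimod := @pbmk _ _ _ zprebimod w h.
Lemma zbmkK w (h : A w) : zbval (zbmk h) = w. Proof. by []. Qed.
Lemma zbvalP x : A (zbval x). Proof. exact: (@pbvalP _ _ _ zprebimod). Qed.
Lemma zbval_inj : injective zbval. Proof. exact: pbval_inj. Qed.
Lemma zbvalB : addm zbval. Proof. by []. Qed.
Lemma zbval_ract x t : zbval (ract x t) = ract (zbval x) t. Proof. by []. Qed.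
Lemma zbval_scale a x : zbval (a *: x) = zrep a *: zbval x. Proof. by []. Qed.
Lemma zbval_zcl u x : gr U 0 u -> zbval (zcl n u *: x) = u *: zbval x.
Proof. by move=> hu; rewrite zbval_scale zrep_act //; exact: zbvalP. Qed.

Lemma subbimod_zbval (B : set W) : u0sub B -> subbimod (zbval @^-1` B).
Proof.
move=> [h0 hl hr]; split; first split.
- exact: (subg0 h0).
- by move=> x y /= hx hy; rewrite zbvalB; apply: subgB.
- by move=> a x /= hx; rewrite zbval_scale; apply: hl => //; exact: zrep_gr.
- by move=> x t /= hx; rewrite zbval_ract; exact: hr.
Qed.

Lemma u0sub_zbval (B : set zbimod) : subbimod B -> u0sub (zbval @` B).
Proof.
move=> hB; split; first split.
- by exists 0; [apply: subg0; exact: sbm_sub|exact: (addm0 zbvalB)].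
- move=> _ _ [x Bx <-] [y By <-]; exists (x - y) => //.
  by apply: subgB => //; exact: sbm_sub.
- move=> u _ hu [x Bx <-]; exists (zcl n u *: x); first exact: sbm_l.
  exact: zbval_zcl.
- by move=> _ t [x Bx <-]; exists (ract x t) => //; exact: sbm_r.
Qed.

End ZhuBimod.

(** * The graded bimodule of a Zhu bimodule *)

Section LModule.
Variables (k : comPzRingType) (U : acs_ring k) (R : kalg k) (n : nat).
Variable (M : bimod (zhu U n) R).

(** The image of the tensor of u and m under the map from induction to coinduction. [U] acts on such
    functions from the left by right translation of the argument. *)
Definition lgen (u : U) (m : M) : U -> M := fun x => zcl n (x * u) *: m.

Lemma lgenB m : addm (fun u => lgen u m).
Proof. by move=> u v; apply/funext => x; rewrite /lgen mulrBr zclB scalerBl. Qed.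

Lemma lgenN u m : - lgen u m = lgen u (- m).
Proof. by apply/funext => x; rewrite /lgen scalerN. Qed.

Definition lset : set (U -> M) :=
  finite_sums [set f | exists u m, f = lgen u m].

Definition lpiece (d : int) : set (U -> M) :=
  finite_sums [set f | exists2 u, gr U d u & exists m, f = lgen u m].

Lemma lset_sub : additive_subgroup lset.
Proof.
by apply: fsums_subgroup => _ [u [m ->]]; exists u, (- m); rewrite lgenN.
Qed.

Lemma lpiece_sub d : additive_subgroup (lpiece d).
Proof.
apply: fsums_subgroup => _ [u hu [m ->]]; exists u => //.
by exists (- m); rewrite lgenN.
Qed.

Lemma lgen_lset u m : lset (lgen u m).
Proof. by apply: fsums_sub; exists u, m. Qed.

Lemma lgen_lpiece d u m : gr U d u -> lpiece d (lgen u m).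
Proof. by move=> hu; apply: fsums_sub; exists u => //; exists m. Qed.

Lemma lpiece_lset d : lpiece d `<=` lset.
Proof.
by apply: fsums_min; [exact: lset_sub|move=> _ [u _ [m ->]]; exact: lgen_lset].
Qed.

Lemma lset_ind (P : set (U -> M)) : additive_subgroup P ->
  (forall p u m, gr U p u -> P (lgen u m)) -> lset `<=` P.
Proof.
move=> hP hg; apply: fsums_min => // _ [u [m ->]].
elim/gr_ind: u => [u v hu hv||p u hu].
- by rewrite (addmD (lgenB m)); apply: subgD.
- by rewrite (addm0 (lgenB m)); apply: subg0.
- exact: hg hu.
Qed.

Lemma lset_splits : lset `<=` splits_in lpiece.
Proof.
apply: lset_ind; first exact: (splits_in_subgroup lpiece_sub).
move=> p u m hu; apply: (splits_in_piece lpiece_sub); exact: lgen_lpiece hu.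
Qed.

(** For u of degree d, only the component of x in degree -d contributes to the degree 0 part of x
    u. *)
Lemma lpiece_comp d f x : lpiece d f -> f (comp (- d) x) = f x.
Proof.
have hP : additive_subgroup [set f : U -> M | f (comp (- d) x) = f x].
  split=> // f1 f2 /= h1 h2; rewrite -[LHS]/(f1 _ - f2 _) h1 h2 //.
apply: (fsums_min hP) => _ [u hu [m ->]] /=.
rewrite /lgen -[in LHS]zcl_comp -[in RHS]zcl_comp !(comp_mulr0 _ hu).
by rewrite (comp_id (comp_gr _ _)).
Qed.

Lemma lpiece_neq d d' f x : lpiece d f -> d != d' -> f (comp (- d') x) = 0.
Proof.
move=> hf dd; rewrite -(lpiece_comp _ hf) (comp_in _ (comp_gr _ _)).
rewrite eqr_opp (negbTE dd).
have hP : additive_subgroup [set f : U -> M | f 0 = 0].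
  by split=> // f1 f2 /= h1 h2; rewrite -[LHS]/(f1 _ - f2 _) h1 h2 subrr.
by apply: (fsums_min hP) hf => _ [u hu [m ->]] /=; rewrite /lgen mul0r
  (addm0 (@zclB _ _ n)) scale0r.
Qed.

Lemma lset_l u f : lset f -> lset (fun x => f (x * u)).
Proof.
have hP : additive_subgroup [set f | lset (fun x => f (x * u))].
  split=> [|f1 f2 h1 h2]; first exact: (subg0 lset_sub).
  exact: (subgB lset_sub h1 h2).
apply: (fsums_min hP) => _ [v [m ->]] /=.
rewrite (_ : (fun x => _) = lgen (u * v) m); first exact: lgen_lset.
by apply/funext => x; rewrite /lgen mulrA.
Qed.

Lemma lpiece_l p d u f : gr U p u -> lpiece d f ->
  lpiece (p + d) (fun x => f (x * u)).
Proof.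
move=> hu.
have hP : additive_subgroup [set f | lpiece (p + d) (fun x => f (x * u))].
  split=> [|f1 f2 h1 h2]; first exact: (subg0 (lpiece_sub _)).
  exact: (subgB (lpiece_sub _) h1 h2).
apply: (fsums_min hP) => _ [v hv [m ->]] /=.
rewrite (_ : (fun x => _) = lgen (u * v) m).
  by apply: lgen_lpiece; exact: gr_M.
by apply/funext => x; rewrite /lgen mulrA.
Qed.

Lemma lgen_ract u m t : (fun x => ract (lgen u m x) t) = lgen u (ract m t).
Proof. by apply/funext => x; rewrite /lgen ract_scale. Qed.

Lemma fun_ract_subgroup (A : set (U -> M)) t : additive_subgroup A ->
  additive_subgroup [set f : U -> M | A (fun x => ract (f x) t)].
Proof.
move=> hA; split => [|f g hf hg] /=.
  rewrite (_ : (fun=> _) = 0); first exact: subg0.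
  by apply/funext => x; rewrite ract0.
rewrite (_ : (fun=> _) = (fun x => ract (f x) t) - (fun x => ract (g x) t)).
  exact: (subgB hA hf hg).
by apply/funext => x; rewrite -[LHS]/(ract (f x - g x) t) ractB.
Qed.

Lemma lset_r f t : lset f -> lset (fun x => ract (f x) t).
Proof.
apply: (fsums_min (fun_ract_subgroup t lset_sub)) => _ [u [m ->]] /=.
by rewrite lgen_ract; exact: lgen_lset.
Qed.

Lemma lpiece_r d f t : lpiece d f -> lpiece d (fun x => ract (f x) t).
Proof.
apply: (fsums_min (fun_ract_subgroup t (lpiece_sub d))) => _ [u hu [m ->]] /=.
by rewrite lgen_ract; exact: lgen_lpiece.
Qed.

Lemma lset_add f : lset f -> addm f.
Proof.
have hP : additive_subgroup [set f : U -> M | addm f].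
  split=> [x y|f1 f2 h1 h2 x y]; first by rewrite -[LHS]/(0 : M) subrr.
  rewrite -[LHS]/(f1 (x - y) - f2 (x - y)) h1 h2.
  by rewrite -[RHS]/((f1 x - f2 x) - (f1 y - f2 y)) !opprD !opprK addrACA.
apply: (fsums_min hP) => _ [u [m ->]] x y /=.
by rewrite /lgen mulrBl zclB scalerBl.
Qed.

Lemma lset_k (a : k) f : lset f ->
  (fun x => f (x * kstr U a)) = (fun x => ract (f x) (kstr R a)).
Proof.
have hP : additive_subgroup [set f : U -> M |
    (fun x => f (x * kstr U a)) = (fun x => ract (f x) (kstr R a))].
  split => [|f1 f2 h1 h2] /=; first by apply/funext => x; rewrite ract0.
  apply/funext => x; rewrite -[RHS]/(ract (f1 x - f2 x) _) ractB.
  rewrite -[LHS]/(f1 (x * kstr U a) - f2 (x * kstr U a)).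
  by congr (_ - _); [exact: (congr1 (fun g => g x) h1)|
                     exact: (congr1 (fun g => g x) h2)].
apply: (fsums_min hP) => _ [u [m ->]] /=; apply/funext => x.
rewrite /lgen -mulrA kstr_central mulrA zclMr; last exact: gr_kstr.
by rewrite zcl_kstr -scalerA ract_kstr ract_scale.
Qed.

Definition lprebimod : prebimod U R.
Proof.
refine (@Prebimod k U R (U -> M) lset (fun u f x => f (x * u))
  (fun f t x => ract (f x) t) lset_sub lset_l (fun f t => @lset_r f t)
  _ _ _ _ _ _ _ _ _ _).
- by [].
- move=> s t f1 hf; apply/funext => x.
  by rewrite mulrDr (addmD (lset_add hf)).
- by move=> s t f1 hf; apply/funext => x; rewrite mulrA.
- by move=> f1 hf; apply/funext => x; rewrite mulr1.
- by move=> f1 g t hf hg; apply/funext => x; rewrite -[LHS]/(ract (f1 x + g x) t) ractDl.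
- by move=> f1 s t hf; apply/funext => x; rewrite ractDr.
- by move=> f1 s t hf; apply/funext => x; rewrite ractM.
- by move=> f1 hf; apply/funext => x; rewrite ract1.
- by [].
- by move=> a f1 hf; exact: lset_k.
Defined.

Definition lbimod : bimod U R := bimod_of lprebimod.

Definition lval (x : lbimod) : U -> M := @pbval _ _ _ lprebimod x.
Definition lmk f (h : lset f) : lbimod := @pbmk _ _ _ lprebimod f h.
Lemma lvalP x : lset (lval x). Proof. exact: (@pbvalP _ _ _ lprebimod). Qed.
Lemma lval_inj : injective lval. Proof. exact: pbval_inj. Qed.
Lemma lvalB : addm lval. Proof. by []. Qed.
Lemma lvalZ u x y : lval (u *: x) y = lval x (y * u). Proof. by []. Qed.

Definition lgb d : set lbimod := lval @^-1` lpiece d.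

Lemma lgb_sub d : additive_subgroup (lgb d).
Proof.
split; first exact: (subg0 (lpiece_sub d)).
by move=> x y hx hy; rewrite /lgb /= lvalB; exact: (subgB (lpiece_sub d) hx hy).
Qed.

Lemma lgb_direct : internal_direct_sum lgb.
Proof.
split=> [v|s f us hf f0 i si].
  have [s [f [us hf vE]]] := lset_splits (lvalP v).
  exists s, (fun i => lmk (lpiece_lset (hf i))); split => //.
  by apply: lval_inj; rewrite (addm_sum lvalB) vE.
apply: lval_inj; apply/funext => x.
rewrite -(lpiece_comp x (hf i)).
(* Arguments of degree -i are invisible to the pieces of degree other than i. *)
have /(congr1 (fun v => lval v (comp (- i) x))) := f0.
rewrite (addm_sum lvalB) fct_sumE (bigD1_seq i) //= big1 ?addr0 // => j ji.
exact: (lpiece_neq x (hf j) ji).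
Qed.

(** For u of degree below -n every x u lies in U U_{<= -n-1}, hence in [NL U n.+1], and vanishes in
    the Zhu algebra. *)
Lemma lgb_bounded d : d < - n%:Z -> lgb d = [set 0].
Proof.
move=> dn; rewrite eqEsubset; split; last by move=> _ ->; exact: (subg0 (lgb_sub d)).
move=> x hx; apply: lval_inj => /=.
have hP : additive_subgroup [set 0 : U -> M].
  by split=> // f g -> ->; rewrite /= subrr.
apply: (fsums_min hP) hx => _ [u hu [m ->]] /=.
apply/funext => y; rewrite /lgen zcl_NL ?scale0r //; apply: NL_l.
by apply: gr_NL hu; rewrite -addn1 PoszD opprD lerBrDr -ltzD1 ltrD2r.
Qed.

Lemma lbimod_exhaustive : exhaustive lbimod.
Proof.
move=> w.
suff : [set f : U -> M | exists j : nat, forall v, NL U j.+1%:Z v ->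
    (fun x => f (x * v)) = 0] (lval w).
  by case=> j hj; exists j => v hv; apply: lval_inj; exact: hj.
apply: lset_ind (lvalP w).
  split; first by exists 0.
  move=> f g [i hi] [j hj]; exists (maxn i j) => v hv.
  have vi : NL U i.+1%:Z v by apply: NL_decr hv; rewrite lez_nat ltnS leq_maxl.
  have vj : NL U j.+1%:Z v by apply: NL_decr hv; rewrite lez_nat ltnS leq_maxr.
  apply/funext => x; rewrite -[LHS]/(f (x * v) - g (x * v)).
  rewrite -[f (x * v)]/((fun x => f (x * v)) x) hi //.
  by rewrite -[g (x * v)]/((fun x => g (x * v)) x) hj //; exact: subrr.
(* Right multiplication by u of degree p lowers the seminorm index by p; with j >= n + 1 + p the
   product v u stays in [NL U n.+1]. *)
move=> p u m hu; exists (absz (n.+1%:Z + p)) => v hv; apply/funext => x.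
rewrite /lgen zcl_NL ?scale0r //.
rewrite -mulrA; apply: NL_l; apply: NL_decr (NL_r hv hu).
by rewrite lerBrDr; apply: le_trans (ler_norm _) _; rewrite -abszE lez_nat.
Qed.

Definition lgrbimod : grbimod U R.
Proof.
refine (@GrBimod k U R lbimod lgb lgb_sub _ lgb_direct _ _ lbimod_exhaustive).
- by move=> d w r; exact: lpiece_r.
- by move=> p d u w hu hw; exact: lpiece_l.
- by exists (- n%:Z) => d; exact: lgb_bounded.
Defined.

Definition lin (m : M) : lbimod := lmk (lgen_lset 1 m).

Lemma linB : addm lin.
Proof.
move=> x y; apply: lval_inj; apply/funext => z.
rewrite lvalB -[RHS]/(lgen 1 x z - lgen 1 y z) -[LHS]/(lgen 1 (x - y) z).
by rewrite /lgen scalerBr.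
Qed.

Lemma lin_ract m t : lin (ract m t) = ract (lin m) t.
Proof. by apply: lval_inj; exact: (esym (lgen_ract 1 m t)). Qed.

Lemma lval_lin1 m : lval (lin m) 1 = m.
Proof. by rewrite -[LHS]/(lgen 1 m 1) /lgen mulr1 zcl1 scale1r. Qed.

Lemma lin_inj : injective lin.
Proof. by move=> x y /(congr1 (fun f => lval f 1)); rewrite !lval_lin1. Qed.

Lemma lin_scale u m : lval (u *: lin m) = lgen u m.
Proof. by apply/funext => x; rewrite lvalZ -[LHS]/(lgen 1 m (x * u)) /lgen mulr1. Qed.

Lemma lin_zcl u m : gr U 0 u -> u *: lin m = lin (zcl n u *: m).
Proof.
move=> hu; apply: lval_inj; rewrite lin_scale; apply/funext => x.
by rewrite -[RHS]/(lgen 1 _ x) /lgen mulr1 zclMr // scalerA.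
Qed.

Lemma lin_gb m : lgb 0 (lin m).
Proof. by apply: lgen_lpiece; exact: gr_1. Qed.

Lemma lgb0P x : lgb 0 x -> exists m, x = lin m.
Proof.
move=> hx.
suff [m hm] : [set f | exists m, f = lval (lin m)] (lval x).
  by exists m; apply: lval_inj.
have hP : additive_subgroup [set f | exists m, f = lval (lin m)].
  split; first by exists 0; rewrite (addm0 linB).
  by move=> _ _ [x1 ->] [x2 ->]; exists (x1 - x2); rewrite linB.
apply: (fsums_min hP) hx => _ [u hu [m ->]] /=.
by exists (zcl n u *: m); rewrite -lin_zcl // lin_scale.
Qed.

Lemma lgen_ind (P : set lbimod) : additive_subgroup P ->
  (forall u m, P (u *: lin m)) -> forall x, P x.
Proof.
move=> hP hg x.
suff [y Py xy] : (lval @` P) (lval x) by rewrite -(lval_inj xy).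
have hQ : additive_subgroup (lval @` P).
  split; first by exists 0; [exact: subg0|].
  by move=> _ _ [y1 P1 <-] [y2 P2 <-]; exists (y1 - y2) => //; exact: subgB.
apply: lset_ind (lvalP x) => // p u m _.
by exists (u *: lin m) => //; rewrite lin_scale.
Qed.

(** The function x is nonzero at some argument, of which only the component u in degree -d counts;
    the value of [u *: x] at 1 is the value of x at u. *)
Lemma lgb_detect d x : lgb d x -> x != 0 ->
  exists2 u, gr U (- d) u & u *: x != 0.
Proof.
move=> hx x0.
have [y hy] : exists y, lval x y <> 0.
  apply: contrapT => /forallNP h; case/eqP: x0; apply: lval_inj.
  by apply/funext => y; apply: contrapT => /h.
exists (comp (- d) y); first exact: comp_gr.
apply/eqP => /(congr1 (fun f => lval f 1)); rewrite lvalZ mul1r.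
by rewrite (lpiece_comp _ hx).
Qed.

End LModule.

(** * Rational rings *)

Section FgProjective.
Variable S : pzRingType.

Lemma linear_pack (P Q : lmodType S) (f : P -> Q) : linear f ->
  exists g : {linear P -> Q}, forall x, g x = f x.
Proof.
move=> hf.
pose g : {linear P -> Q} := HB.pack f (GRing.isLinear.Build S P Q *:%R f hf).
by exists g.
Qed.

Lemma fg_projective_iso (P Q : lmodType S) (f : P -> Q) : linear f ->
  injective f -> (forall y, exists x, f x = y) ->
  fg_projective P -> fg_projective Q.
Proof.
move=> lf fi fs [[m [g hg]] hP].
have [F hF] := linear_pack lf.
have [h hh] := choice fs.
have lh : linear h.
  by move=> a u v; apply: fi; rewrite lf !hh.
have [H hH] := linear_pack lh.
split.
  exists m, (fun i => F (g i)) => y; have [c hc] := hg (h y).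
  exists c; rewrite -[LHS]hh -hF hc linear_sum; apply: eq_bigr => i _.
  by rewrite linearZ.
move=> M N q u qs.
pose u' : {linear P -> N} := u \o F.
have [w hw] := hP M N q u' qs.
pose w' : {linear Q -> M} := w \o H.
by exists w' => x; rewrite /= hw /= hF hH hh.
Qed.

Lemma fg_projective_0 (P : lmodType S) : (forall x : P, x = 0) ->
  fg_projective P.
Proof.
move=> P0; split.
  by exists 0, (fun=> 0) => x; exists (fun=> 0); rewrite [x]P0 big_ord0.
move=> M N g f _.
have lh : linear (fun=> 0 : M) by move=> T a u v; rewrite scaler0 addr0.
have [h hh] := linear_pack (lh P).
by exists h => x; rewrite hh !raddf0 [x]P0 raddf0.
Qed.

End FgProjective.

Section Generated.
Variables (k : comPzRingType) (U : acs_ring k) (R : kalg k).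

(** The sub-bimodule generated by [A] once [A] is stable under the right action; [ugenp p A] is the
    part produced by operators of degree p. *)
Definition ugen (W : bimod U R) (A : set W) : set W :=
  finite_sums [set w | exists u a, A a /\ w = u *: a].

Definition ugenp (W : bimod U R) p (A : set W) : set W :=
  finite_sums [set w | exists u a, [/\ gr U p u, A a & w = u *: a]].

Lemma ugen_sub (W : bimod U R) (A : set W) : additive_subgroup (ugen A).
Proof.
by apply: fsums_subgroup => _ [u [a [Aa ->]]]; exists (- u), a; rewrite scaleNr.
Qed.

Lemma ugenp_sub (W : bimod U R) p (A : set W) : additive_subgroup (ugenp p A).
Proof.
apply: fsums_subgroup => _ [u [a [hu Aa ->]]]; exists (- u), a; split => //.
  exact: (subgN (gr_sub U p)).
by rewrite scaleNr.
Qed.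

Lemma ugenp_ugen (W : bimod U R) p (A : set W) : ugenp p A `<=` ugen A.
Proof.
apply: fsums_min; first exact: ugen_sub.
by move=> _ [u [a [_ Aa ->]]]; apply: fsums_sub; exists u, a.
Qed.

Lemma ugen_in (W : bimod U R) (A : set W) : A `<=` ugen A.
Proof.
by move=> a Aa; apply: fsums_sub; exists 1, a; rewrite scale1r.
Qed.

Lemma ugen_min (W : bimod U R) (A B : set W) : subbimod B -> A `<=` B ->
  ugen A `<=` B.
Proof.
move=> hB AB; apply: fsums_min; first exact: sbm_sub.
by move=> _ [u [a [/AB Ba ->]]]; exact: sbm_l.
Qed.

Lemma ugen_subbimod (W : bimod U R) (A : set W) :
  (forall a t, A a -> A (ract a t)) -> subbimod (ugen A).
Proof.
move=> Ar; split; first exact: ugen_sub.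
- move=> s w hw.
  have hP : additive_subgroup [set w : W | ugen A (s *: w)].
    split=> [|x y /= hx hy]; first by rewrite /= scaler0; exact: subg0 (ugen_sub A).
    by rewrite scalerBr; apply: (subgB (ugen_sub A)).
  apply: (fsums_min hP) hw => _ [u [a [Aa ->]]] /=.
  by apply: fsums_sub; exists (s * u), a; rewrite scalerA.
- move=> w t hw.
  have hP : additive_subgroup [set w : W | ugen A (ract w t)].
    split=> [|x y /= hx hy]; first by rewrite /= ract0; exact: subg0 (ugen_sub A).
    by rewrite ractB; apply: (subgB (ugen_sub A)).
  apply: (fsums_min hP) hw => _ [u [a [Aa ->]]] /=.
  by apply: fsums_sub; exists u, (ract a t); split; [exact: Ar|rewrite ract_scale].
Qed.

Variable W : grbimod U R.

Definition wcomp n (w : W) : W := dcomp (gb_direct W) n w.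

Lemma gb_sub n : additive_subgroup (gb (g := W) n).
Proof. exact: gb_subgroup. Qed.

Lemma wcompP n w : gb (g := W) n (wcomp n w).
Proof. exact: (dcompP gb_sub). Qed.
Lemma wcompB n : addm (wcomp n).
Proof. exact: (dcompB gb_sub). Qed.
Lemma wcomp_id n w : gb n w -> wcomp n w = w.
Proof. exact: (dcomp_id gb_sub). Qed.
Lemma wcomp_in m n w : gb n w -> wcomp m w = if m == n then w else 0.
Proof. exact: (dcomp_in gb_sub). Qed.
Lemma wcomp_sum w : w = \sum_(n <- dsupp (gb_direct W) w) wcomp n w.
Proof. exact: dcomp_sum. Qed.
Lemma wcomp_ext v w : (forall n, wcomp n v = wcomp n w) -> v = w.
Proof. exact: (dcomp_ext gb_sub). Qed.

Lemma wcomp_neq0 w : w != 0 -> exists n, wcomp n w != 0.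
Proof.
move=> w0; apply: contrapT => /forallNP h; case/eqP: w0; apply: wcomp_ext => n.
by rewrite (addm0 (wcompB n)); apply/eqP/negPn/negP/h.
Qed.

Lemma wcomp_scale p n u w : gr U p u -> wcomp (p + n) (u *: w) = u *: wcomp n w.
Proof.
move=> hu; apply: (@dcomp_map _ _ _ _ _ _ gb_sub gb_sub _ _ (fun n => p + n)
  (fun w : W => u *: w)).
- exact: addrI.
- exact: scalerB_addm.
- by move=> i v hv; apply: gb_scale.
Qed.

Lemma wcomp_scaler p n u w : gb n w -> wcomp (p + n) (u *: w) = comp p u *: w.
Proof.
move=> hw; apply: (@dcomp_map _ _ _ _ _ _ (@gr_sub _ U) gb_sub _ _
  (fun p => p + n) (fun u : U => u *: w)).
- exact: addIr.
- exact: scalelB_addm.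
- by move=> i v hv; apply: gb_scale.
Qed.

Lemma wcomp_ract n w t : wcomp n (ract w t) = ract (wcomp n w) t.
Proof.
apply: (@dcomp_map _ _ _ _ _ _ gb_sub gb_sub _ _ id (fun w => ract w t)) => //.
  exact: ractB.
by move=> i v hv; apply: gb_ract.
Qed.

Lemma gb_u0sub n : u0sub (gb (g := W) n).
Proof.
split; first exact: gb_sub.
- by move=> u w hu hw; rewrite -[n]add0r; apply: gb_scale.
- by move=> w t; apply: gb_ract.
Qed.

Lemma graded_subsetP (B : set W) : additive_subgroup B ->
  (graded_subset (gb (g := W)) B <-> forall w n, B w -> B (wcomp n w)).
Proof. exact: (graded_subset_dcomp gb_sub (gb_direct W)). Qed.

Lemma ugen_wcomp (A : set W) d x p : A `<=` gb d -> ugen A x ->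
  ugenp p A (wcomp (p + d) x).
Proof.
move=> Ad hx.
have hP : additive_subgroup [set x | ugenp p A (wcomp (p + d) x)].
  split=> [|y z /= hy hz]; first by rewrite /= (addm0 (wcompB _)); exact: subg0 (ugenp_sub p A).
  by rewrite wcompB; apply: (subgB (ugenp_sub p A)).
apply: (fsums_min hP) hx => _ [u [a [Aa ->]]] /=.
rewrite wcomp_scaler; last exact: Ad.
by apply: fsums_sub; exists (comp p u), a; split => //; exact: comp_gr.
Qed.

Lemma ugen_graded d (A : set W) : A `<=` gb d ->
  graded_subset (gb (g := W)) (ugen A).
Proof.
move=> Ad; apply/(graded_subsetP (ugen_sub A)) => w n hw.
rewrite -[n](subrK d); apply: (@ugenp_ugen _ (n - d)); exact: ugen_wcomp.
Qed.

Lemma ugenp0 (A : set W) : u0sub A -> ugenp 0 A `<=` A.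
Proof.
move=> [h0 hl _]; apply: fsums_min => // _ [u [a [hu Aa ->]]]; exact: hl.
Qed.

(** The part of U A in degree d is U_0 A, which [A] already contains. *)
Lemma ugen_piece d (A : set W) : u0sub A -> A `<=` gb d ->
  ugen A `&` gb d `<=` A.
Proof.
move=> hA Ad x [hx xd]; rewrite -(wcomp_id xd) -[d]add0r.
by apply: ugenp0 => //; exact: ugen_wcomp.
Qed.

Lemma simple_ugen (A : set W) d a : simple_grbimod W -> u0sub A ->
  A `<=` gb d -> A a -> a != 0 -> forall x, ugen A x.
Proof.
move=> [_ hS] hA Ad Aa a0 x.
case: (hS (ugen A)) => [||h|->//].
- by apply: ugen_subbimod => b t; case: hA => _ _; apply.
- exact: ugen_graded Ad.
- by have := ugen_in Aa; rewrite h => /= e; rewrite e eqxx in a0.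
Qed.

(** A nonzero [A] generates [W], and generation adds nothing in its own degree. Nonzero pieces are
    therefore simple for the actions of U_0 and R. *)
Lemma simple_piece (A : set W) d a : simple_grbimod W -> u0sub A ->
  A `<=` gb d -> A a -> a != 0 -> gb d `<=` A.
Proof.
move=> hS hA Ad Aa a0 x xd; apply: (ugen_piece hA Ad); split=> //.
exact: simple_ugen hS hA Ad Aa a0 x.
Qed.

(** An operator of degree at most -n-1 sends W_d below d0, and [killed] passes from these operators
    to all of [NL U n.+1]. *)
Lemma u0killed_gb d0 (n : nat) d : (forall e, e < d0 -> gb (g := W) e = [set 0]) ->
  d <= d0 + n%:Z ->
  forall u w, NL U n.+1%:Z u -> gb (g := W) d w -> u *: w = 0.
Proof.
move=> hd0 hd u w hu hw; apply: (@killed _ _ _ W n.+1%:Z w (gb_exhaustive (g := W)) _ u hu) => p v hp hv.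
suff : gb (g := W) (p + d) (v *: w) by rewrite hd0 //; lia.
exact: gb_scale.
Qed.

Lemma bottom_degree (w : W) : w != 0 -> exists d0,
  (exists2 v : W, v != 0 & gb d0 v) /\
  forall e, e < d0 -> gb (g := W) e = [set 0].
Proof.
move=> w0; have [d1 hd1] := gb_bounded W.
have [n hn] := wcomp_neq0 w0.
pose P (i : nat) := `[< exists2 v : W, v != 0 & gb (d1 + i%:Z) v >].
have exP : exists i, P i.
  have dn : d1 <= n.
    rewrite leNgt; apply/negP => /hd1 h.
    by have := wcompP n w; rewrite h /= => e; rewrite e eqxx in hn.
  exists (absz (n - d1)); apply/asboolP; exists (wcomp n w) => //.
  have -> : d1 + (absz (n - d1))%:Z = n by lia.
  exact: wcompP.
case: (ex_minnP exP) => i /asboolP hi imin; exists (d1 + i%:Z); split=> // e he.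
rewrite eqEsubset; split=> [x hx|_ ->]; last exact: subg0 (gb_sub e).
have [ed|ed] := ltrP e d1; first by move: hx; rewrite hd1.
apply: contrapT => /eqP x0.
have : P (absz (e - d1)).
  apply/asboolP; exists x => //.
  by have -> : d1 + (absz (e - d1))%:Z = e by lia.
by move/imin; lia.
Qed.

End Generated.

Section RationalZhu.
Variables (k : comPzRingType) (U : acs_ring k) (R : kalg k).

(** A nonzero graded sub-bimodule contains a nonzero homogeneous vector, which [lgb_detect] moves to
    degree 0. Its degree 0 part is then a nonzero sub-bimodule of M, hence M, and M generates. *)
Lemma lgrbimod_simple n (M : bimod (zhu U n) R) :
  simple_bimod M -> simple_grbimod (lgrbimod M).
Proof.
move=> [[m0 m0n] hM]; split.
  exists (lin m0); apply: contraNneq m0n => h; apply/eqP; apply: (@lin_inj _ _ _ _ M).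
  by rewrite h (addm0 (@linB _ _ _ _ M)).
move=> A hA hg; have [h|/existsNP[x /not_implyP[Ax x0]]] :=
  pselect (forall x, A x -> x = 0).
  left; rewrite eqEsubset; split=> [x /h //|_ ->].
  exact: (subg0 (sbm_sub hA)).
right; rewrite eqEsubset; split=> // y _.
have /eqP x0' := x0; have [d hd] := @wcomp_neq0 _ _ _ (lgrbimod M) x x0'.
have {hg} hg := (@graded_subsetP _ _ _ (lgrbimod M) A (sbm_sub hA)).1 hg.
have [u hu ux] := lgb_detect (@wcompP _ _ _ (lgrbimod M) d x) hd.
have [m hm] : exists m, u *: wcomp (W := lgrbimod M) d x = lin m.
  apply: lgb0P; rewrite -(addNr d).
  exact: (@gb_scale _ _ _ (lgrbimod M)) hu (wcompP _ _).
have hB : subbimod (@lin _ _ _ _ M @^-1` A).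
  split; first split.
  - rewrite /= (addm0 (@linB _ _ _ _ M)); exact: (subg0 (sbm_sub hA)).
  - by move=> a b /= ha hb; rewrite linB; apply: (subgB (sbm_sub hA)).
  - move=> s a /= ha; rewrite -[s]zcl_rep -lin_zcl; last exact: zrep_gr.
    exact: sbm_l.
  - by move=> a t /= ha; rewrite lin_ract; apply: sbm_r.
have Bm : (@lin _ _ _ _ M @^-1` A) m.
  by rewrite /= -hm; apply: sbm_l => //; exact: hg.
case: (hM _ hB) => hh.
  by move: Bm hm; rewrite hh /= => -> h; case/eqP: ux; rewrite h (addm0 (@linB _ _ _ _ M)).
apply: lgen_ind y; first exact: sbm_sub.
move=> v a; apply: sbm_l => //.
by have : (@lin _ _ _ _ M @^-1` A) a by rewrite hh.
Qed.

Lemma iota_mor (V W : bimod U R) (f : bimod_embedding V W) : mor f.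
Proof.
split=> [x y|s x|x t]; first exact: raddfB.
- exact: linearZ.
- exact: bimod_emb_ract.
Qed.

Lemma range_graded (V W : grbimod U R) (f : bimod_embedding V W) :
  (forall n v, gb (g := V) n v -> gb (g := W) n (f v)) ->
  graded_subset (gb (g := W)) (range f).
Proof.
move=> hf.
apply/(graded_subsetP (sbm_sub (subbimod_range (iota_mor f)))) => _ n [v _ <-].
exists (wcomp n v) => //; apply/esym.
apply: (@dcomp_map _ _ _ _ _ _ (@gb_sub _ _ _ V) (@gb_sub _ _ _ W) _ _ id f) => //.
exact: morB (iota_mor f).
Qed.

Lemma iota_wcomp (V W : grbimod U R) (f : bimod_embedding V W) :
  (forall n v, gb (g := V) n v -> gb (g := W) n (f v)) ->
  forall n v, wcomp n (f v) = f (wcomp n v).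
Proof.
move=> hf n v.
apply: (@dcomp_map _ _ _ _ _ _ (@gb_sub _ _ _ V) (@gb_sub _ _ _ W) _ _ id f) => //.
exact: morB (iota_mor f).
Qed.

(** Since [lgrbimod M] is simple, one summand of its decomposition fills it; evaluation at 1
    identifies the degree 0 piece of that summand with M. *)
Lemma rational_zhu : rational U R -> forall n (M : bimod (zhu U n) R),
  simple_bimod M -> fg_projective (rmod M).
Proof.
move=> hrat n M sM.
have [I [S [hS [iota [ig hD]]]]] := hrat (lgrbimod M).
have sL := lgrbimod_simple sM; have [[w w0] hL] := sL.
have hA i : subbimod (range (iota i)) := subbimod_range (iota_mor _).
have [i [v vw]] : exists i v, iota i v != 0.
  apply: contrapT => h; case/eqP: w0; rewrite [w](dcomp_sum hD) big1 // => i _.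
  have [v _ <-] := dcompP (fun i => sbm_sub (hA i)) hD i w.
  by apply/eqP/negPn/negP => vi; apply: h; exists i, v.
have sT x : exists y, iota i y = x.
  case: (hL _ (hA i) (range_graded (ig i))) => h.
    have : range (iota i) (iota i v) by exists v.
    by rewrite h => /eqP; rewrite (negbTE vw).
  have : range (iota i) x by rewrite h.
  by case=> y _ <-; exists y.
have [_ /(_ 0) hq] := hS i.
have vlin (v' : piece (S i) 0) : exists m, iota i (val v') = lin m.
  by apply: lgb0P; apply: (ig i 0); exact: asboolW (valP v').
pose f (v : piece (S i) 0) : rmod M := lval (iota i (val v)) 1.
have hf v' : lin (f v') = iota i (val v').
  by have [m hm] := vlin v'; rewrite /f hm lval_lin1.
apply: (@fg_projective_iso _ _ _ f _ _ _ hq).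
- move=> a x y; rewrite /f.
  have -> : iota i (val (a *: x + y)) = ract (iota i (val x)) a + iota i (val y).
    by rewrite -(mor_ract _ _ (iota_mor (iota i))) -(addmD (morB (iota_mor (iota i)))).
  by rewrite -[LHS]/(lval (ract (iota i (val x)) a) 1 + lval (iota i (val y)) 1).
- move=> x y /(congr1 (@lin _ _ _ _ M)); rewrite !hf => h.
  by apply: val_inj; apply: (@bimod_emb_inj _ _ _ _ _ (iota i)).
- move=> m; have [y hy] := sT (lin m).
  have y0 : gb (g := S i) 0 y.
    suff -> : y = wcomp 0 y by exact: wcompP.
    apply: (@bimod_emb_inj _ _ _ _ _ (iota i)); rewrite -(iota_wcomp (ig i)) hy.
    by apply/esym/(@wcomp_id _ _ _ (lgrbimod M)); exact: lin_gb.
  exists (exist _ (y : rmod (S i)) (asboolT y0)).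
  by apply: lin_inj; rewrite hf.
Qed.

Lemma simple_zbimod (W : grbimod U R) n d (hK : u0killed n (gb (g := W) d)) :
  simple_grbimod W -> forall A : set (zbimod (gb_u0sub W d) hK), subbimod A ->
    (forall x, A x -> x = 0) \/ A = setT.
Proof.
move=> hS A hA; have [h|/existsNP[x /not_implyP[Ax x0]]] :=
  pselect (forall x, A x -> x = 0); first by left.
right; rewrite eqEsubset; split=> // y _.
have [|||z Az zy] := simple_piece hS (u0sub_zbval hA) _ (a := zbval x) _ _
  (zbvalP y).
- by move=> _ [z _ <-]; exact: zbvalP.
- by exists x.
- by apply/eqP => h; apply: x0; apply: zbval_inj; rewrite h (addm0 (@zbvalB _ _ _ _ _ _ _ _)).
- by rewrite -(zbval_inj zy).
Qed.

(** The piece in degree d is zero or a simple bimodule over the Zhu algebra of index d - d0, where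
    d0 is the lowest degree. *)
Lemma simple_quasi_rigid (W : grbimod U R) :
  (forall n (M : bimod (zhu U n) R), simple_bimod M -> fg_projective (rmod M)) ->
  simple_grbimod W -> quasi_rigid W.
Proof.
move=> hM hS d; have [[w w0] _] := hS.
have [d0 [_ hd0]] := bottom_degree w0.
have [dd|dd] := ltrP d d0.
  apply: fg_projective_0 => x; apply: val_inj.
  by have := asboolW (valP x); rewrite hd0.
pose n := absz (d - d0).
have hK : u0killed n (gb (g := W) d).
  move=> u v hu _; apply: (u0killed_gb hd0) hu; rewrite /n; lia.
pose M := zbimod (gb_u0sub W d) hK.
have [h|/existsNP[x0 /eqP x0n]] := pselect (forall x : M, x = 0).
  apply: fg_projective_0 => x; apply: val_inj.
  exact: (congr1 (@zbval _ _ _ _ _ _ _ _) (h (zbmk _ _ (asboolW (valP x))))).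
have sM : simple_bimod M.
  split; first by exists x0.
  move=> A hA; case: (simple_zbimod hS hA) => [h|]; [left|by right].
  rewrite eqEsubset; split=> [x /h //|_ ->]; exact: (subg0 (sbm_sub hA)).
pose f (x : rmod M) : piece W d := exist _ (zbval x : rmod W) (asboolT (zbvalP x)).
apply: (@fg_projective_iso _ _ _ f _ _ _ (hM _ _ sM)).
- by move=> a x y; apply: val_inj.
- by move=> x y /(congr1 val); exact: zbval_inj.
- move=> y; exists (zbmk _ _ (asboolW (valP y))); exact: val_inj.
Qed.

Lemma rational_iff : rational U R <->
  semisimple_Gr U R /\
  (forall n (M : bimod (zhu U n) R), simple_bimod M -> fg_projective (rmod M)).
Proof.
split=> [h|[h hM] W].
  split; last exact: rational_zhu.
  by move=> W; have [I [S [hS hW]]] := h W; exists I, S; split=> // i; case: (hS i).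
have [I [S [hS hW]]] := h W; exists I, S; split=> // i; split=> //.
exact: simple_quasi_rigid.
Qed.

End RationalZhu.

(** * Semisimplicity of Zhu bimodules *)

Section SemisimpleZhu.
Variables (k : comPzRingType) (U : acs_ring k) (R : kalg k).

(** A decomposition of [lbimod M], graded or not, that respects degree 0 induces one of M. Its
    components are atoms: a nonzero B in degree 0 generates its whole summand, and generation adds
    nothing in degree 0. *)
Lemma ss_zhu n (M : bimod (zhu U n) R) (I : eqType) (A : I -> set (lbimod M))
  (hA : forall i, subbimod (A i)) (hD : internal_direct_sum A) :
  (forall i m, lgb 0 (dcomp hD i (lin m))) ->
  (forall i (B : set (lbimod M)) b, u0sub B -> B `<=` lgb (M := M) 0 ->
     B `<=` A i -> B b -> b != 0 -> A i `<=` ugen B) ->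
  ss M.
Proof.
move=> h0 hS y.
have hA' i := sbm_sub (hA i).
pose p i (m : M) : M := lval (dcomp hD i (lin m)) 1.
have linp i m : lin (p i m) = dcomp hD i (lin m).
  by have [m' hm] := lgb0P (h0 i m); rewrite /p hm lval_lin1.
have lB := @linB _ _ _ _ M.
have dB i := dcompB hA' hD i.
have linz s (m : M) : lin (s *: m) = zrep s *: lin m.
  by rewrite lin_zcl ?zcl_rep //; exact: zrep_gr.
have mp i : mor (p i).
  split=> [a b|s a|a t]; apply: (@lin_inj _ _ _ _ M).
  - by rewrite linp !lB !linp dB.
  - rewrite linp !linz linp.
    apply: (@dcomp_map _ _ _ _ _ _ hA' hA' hD hD id) => //.
      exact: scalerB_addm.
    by move=> j v; exact: sbm_l.
  - rewrite linp !lin_ract linp.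
    apply: (@dcomp_map _ _ _ _ _ _ hA' hA' hD hD id (fun x => ract x t)) => //.
      exact: ractB.
    by move=> j v; exact: sbm_r.
exists (size (dsupp hD (lin y))),
  (fun j => p (tnth (in_tuple (dsupp hD (lin y))) j)); split; last first.
  apply: (@lin_inj _ _ _ _ M); rewrite [LHS](dcomp_sum hD) big_tnth (addm_sum lB).
  by apply: eq_bigr => j _; rewrite linp.
move=> j; move: (tnth _ j) => {j} i; split=> //.
  move=> x; apply: (@lin_inj _ _ _ _ M); rewrite !linp.
  by apply: dcomp_id => //; exact: dcompP.
split; first exact: subbimod_range.
move=> B hB Bp; have [h|/existsNP[b /not_implyP[Bb b0]]] :=
  pselect (forall x, B x -> x = 0); first by left.
right=> _ [m _ <-].
have hB' : u0sub (@lin _ _ _ _ M @` B).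
  split; first split.
  - by exists 0; [exact: (subg0 (sbm_sub hB))|exact: (addm0 lB)].
  - move=> _ _ [a Ba <-] [c Bc <-]; exists (a - c) => //.
    exact: (subgB (sbm_sub hB)).
  - move=> u _ hu [a Ba <-]; exists (zcl n u *: a); first exact: sbm_l.
    by rewrite lin_zcl.
  - by move=> _ t [a Ba <-]; exists (ract a t); [exact: sbm_r|exact: lin_ract].
have B0 : @lin _ _ _ _ M @` B `<=` lgb 0 by move=> _ [a _ <-]; exact: lin_gb.
have BA : @lin _ _ _ _ M @` B `<=` A i.
  by move=> _ [a /Bp[c _ <-] <-]; rewrite linp; exact: dcompP.
have : (@lin _ _ _ _ M @` B) (lin (p i m)).
  apply: (@ugen_piece _ _ _ (lgrbimod M) 0 _ hB' B0); split; last exact: lin_gb.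
  apply: (hS i _ (lin b) hB' B0 BA); first by exists b.
    apply/eqP => h; apply: b0; apply: (@lin_inj _ _ _ _ M).
    by rewrite h (addm0 lB).
  by rewrite linp; exact: dcompP.
by case=> a Ba /(@lin_inj _ _ _ _ M) <-.
Qed.

Lemma simple_range (S W : grbimod U R) (f : bimod_embedding S W)
  (C : set W) c : simple_grbimod S ->
  (forall n v, gb (g := S) n v -> gb (g := W) n (f v)) ->
  subbimod C -> graded_subset (gb (g := W)) C -> C c -> c != 0 -> range f c ->
  range f `<=` C.
Proof.
move=> [_ hS] hf hC gC Cc c0 [x _ fx].
have hP : subbimod (f @^-1` C) by apply: subbimod_preim => //; exact: iota_mor.
have gP : graded_subset (gb (g := S)) (f @^-1` C).
  apply/(graded_subsetP (sbm_sub hP)) => w n /= hw; rewrite -(iota_wcomp hf).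
  exact: (graded_subsetP (sbm_sub hC)).1.
case: (hS _ hP gP) => h.
  have : (f @^-1` C) x by rewrite /= fx.
  rewrite h /= => x0; case/eqP: c0; rewrite -fx x0; exact: (mor0 (iota_mor f)).
move=> _ [y _ <-]; have : (f @^-1` C) y by rewrite h.
by [].
Qed.

(** Components along graded summands commute with the projections to degrees, so degree 0 is
    respected; simplicity of the summands gives the generation condition of [ss_zhu]. *)
Lemma semisimple_Gr_zhu : semisimple_Gr U R ->
  forall n (M : bimod (zhu U n) R), ss M.
Proof.
move=> hgr n M; have [I [S [hS [iota [ig hD]]]]] := hgr (lgrbimod M).
have hA i : subbimod (range (iota i)) := subbimod_range (iota_mor _).
have gA i := range_graded (ig i).
apply: (ss_zhu hA (hD := hD)).
  move=> i m; apply/(dcomp_memP (@gb_sub _ _ _ (lgrbimod M)) (lgb_direct M)) => d d0.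
  have hr d' (v : lgrbimod M) : range (iota d') v -> range (iota d') (wcomp d v).
    exact: (graded_subsetP (sbm_sub (hA d'))).1.
  rewrite -[dcomp _ _ _]/(wcomp (W := lgrbimod M) d (dcomp hD i (lin m))).
  rewrite -(@dcomp_map _ _ _ _ _ _ (fun i => sbm_sub (hA i))
    (fun i => sbm_sub (hA i)) hD hD id (@wcomp _ _ _ (lgrbimod M) d)) //.
    rewrite /= (@wcomp_in _ _ _ (lgrbimod M) d _ _ (lin_gb m)) (negbTE d0).
    exact: (addm0 (dcompB (fun i => sbm_sub (hA i)) hD i)).
  exact: (@wcompB _ _ _ (lgrbimod M) d).
move=> i B b hB B0 BA Bb b0.
apply: (@simple_range (S i) (lgrbimod M) (iota i) _ b) => //.
- exact: ig.
- by apply: ugen_subbimod => a t; case: hB => _ _; apply.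
- exact: (@ugen_graded _ _ _ (lgrbimod M) 0).
- exact: ugen_in.
- exact: BA.
Qed.

(** A nonzero component of positive degree d would be moved to a nonzero vector by some u of degree
    -d, and for n = 0 there are no negative degrees. This recognizes degree 0 without the
    grading. *)
Lemma lgb0_annihilated (M : bimod (zhu U 0) R) (x : lbimod M) :
  (forall p u, p < 0 -> gr U p u -> u *: x = 0) -> lgb 0 x.
Proof.
move=> hx; apply/(dcomp_memP (@gb_sub _ _ _ (lgrbimod M)) (lgb_direct M)) => d d0.
rewrite -[dcomp _ _ _]/(wcomp (W := lgrbimod M) d x).
have hd := @wcompP _ _ _ (lgrbimod M) d x.
apply: contrapT => /eqP xd.
have [u hu] := lgb_detect hd xd; case/eqP.
have [dneg|dpos] := ltrP d 0.
  by move: hd; rewrite /= lgb_bounded // => ->; rewrite scaler0.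
rewrite -(wcomp_scale (W := lgrbimod M) _ _ hu) (hx (- d)) //; last by lia.
exact: (addm0 (@wcompB _ _ _ (lgrbimod M) _)).
Qed.

(** The summands carry no grading, but their components commute with U_{<0}; so they respect the
    vectors killed by U_{<0}, which have degree 0 by [lgb0_annihilated]. *)
Lemma semisimple_Ex_zhu : semisimple_Ex U R ->
  forall M : bimod (zhu U 0) R, ss M.
Proof.
move=> hex M; have [I [S [hS [iota hD]]]] := hex _ (@lbimod_exhaustive _ _ _ _ M).
have hA i : subbimod (range (iota i)) := subbimod_range (iota_mor _).
have hA' i := sbm_sub (hA i).
apply: (ss_zhu hA (hD := hD)).
  move=> i m; apply: lgb0_annihilated => p u p0 hu.
  rewrite -(@dcomp_map _ _ _ _ _ _ hA' hA' hD hD id (fun x => u *: x)) //.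
  - rewrite (_ : u *: lin m = 0); first exact: (addm0 (dcompB hA' hD i)).
    have := @gb_scale _ _ _ (lgrbimod M) p 0 u _ hu (lin_gb m).
    by rewrite /= lgb_bounded //; lia.
  - exact: scalerB_addm.
  - by move=> j v; exact: sbm_l.
move=> i B b hB B0 BA Bb b0 x [v _ <-].
have hC : subbimod (ugen B).
  by apply: ugen_subbimod => a t; case: hB => _ _; apply.
have [_ [_ sS]] := hS i.
case: (sS _ (subbimod_preim (iota_mor (iota i)) hC)) => h.
  have [w _ wb] := BA _ Bb.
  have : (iota i @^-1` ugen B) w by rewrite /= wb; exact: ugen_in.
  rewrite h /= => w0; case/eqP: b0; rewrite -wb w0; exact: (mor0 (iota_mor _)).
have : (iota i @^-1` ugen B) v by rewrite h.
by [].
Qed.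

End SemisimpleZhu.

(** * Finiteness over the zeroth Zhu algebra *)

Section RegularBimod.
Variables (k : comPzRingType) (T : kalg k).

Definition regular_prebimod : prebimod T T.
Proof.
refine (@Prebimod k T T T setT (fun s x => s * x) (fun x t => x * t)
  _ _ _ _ _ _ _ _ _ _ _ _ _) => //.
- by move=> *; rewrite mulrDr.
- by move=> *; rewrite mulrDl.
- by move=> *; rewrite mulrA.
- by move=> *; rewrite mul1r.
- by move=> *; rewrite mulrDl.
- by move=> *; rewrite mulrDr.
- by move=> *; rewrite mulrA.
- by move=> *; rewrite mulr1.
- by move=> *; rewrite mulrA.
- by move=> *; rewrite kstr_central.
Defined.

Definition regular := bimod_of regular_prebimod.
Definition rgval (x : regular) : T := @pbval _ _ _ regular_prebimod x.
Definition rgmk (x : T) : regular := @pbmk _ _ _ regular_prebimod x I.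
Lemma rgmkK x : rgval (rgmk x) = x. Proof. by []. Qed.
Lemma rgval_inj : injective rgval. Proof. exact: pbval_inj. Qed.
Lemma rgvalB : addm rgval. Proof. by []. Qed.
Lemma rgval_l t x : rgval (t *: x) = t * rgval x. Proof. by []. Qed.
Lemma rgval_r t x : rgval (ract x t) = rgval x * t. Proof. by []. Qed.

(* The last clause says that the centre of the block T b is a field.           *)
Definition central_block (b : T) :=
  [/\ forall a, a * b = b * a, b * b = b &
      forall z, (forall a, a * z = z * a) -> b * z != 0 ->
        exists t, (forall a, a * t = t * a) /\ t * (b * z) = b].

(** The components of 1 in the regular bimodule are central idempotents b, and each block T b is an
    atom. A central z with b z nonzero generates the block, which yields the inverse. *)
Lemma central_blocks : ss regular -> exists (m : nat) (b : 'I_m -> T),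
  (forall i, central_block (b i)) /\ 1 = \sum_i b i.
Proof.
move=> /(_ (rgmk 1)) [m [p [hp e]]].
exists m, (fun i => rgval (p i (rgmk 1))); split; last first.
  by rewrite -(addm_sum rgvalB) -e.
move=> i; have [mi ii [_ ai]] := hp i.
set b := rgval _.
have pl x : rgval (p i (rgmk x)) = x * b.
  rewrite /b -rgval_l -(morZ _ _ mi); congr (rgval (p i _)).
  by apply: rgval_inj; rewrite rgval_l rgmkK mulr1.
have pr x : rgval (p i (rgmk x)) = b * x.
  rewrite /b -rgval_r -(mor_ract _ _ mi); congr (rgval (p i _)).
  by apply: rgval_inj; rewrite rgval_r rgmkK mul1r.
have cb a : a * b = b * a by rewrite -pl pr.
have bb : b * b = b.
  by rewrite -pl /b -[X in _ = rgval X]ii; congr (rgval (p i _)); exact: rgval_inj.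
split=> // z cz bz0.
pose y := b * z.
have cy a : a * y = y * a by rewrite /y mulrA cb -!mulrA cz.
pose B : set regular := [set x | exists t, rgval x = t * y].
have hB : subbimod B.
  split; first split.
  - by exists 0; rewrite mul0r (addm0 rgvalB).
  - by move=> x w [t ht] [t' ht']; exists (t - t'); rewrite rgvalB ht ht' mulrBl.
  - by move=> s x [t ht]; exists (s * t); rewrite rgval_l ht mulrA.
  - by move=> x s [t ht]; exists (t * s); rewrite rgval_r ht -mulrA -(cy s) mulrA.
have Bp : B `<=` range (p i).
  move=> x [t ht]; exists (rgmk (t * z)) => //.
  by apply: rgval_inj; rewrite pl ht -mulrA /y -cz.
case: (ai _ hB Bp) => [h|h].
  have By : B (rgmk y) by exists 1; rewrite mul1r.
  by case/eqP: bz0; rewrite -/y -(rgmkK y) (h _ By) (addm0 rgvalB).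
have [t ht] : B (p i (rgmk 1)) by apply: h; exists (rgmk 1).
rewrite -/b in ht.
exists (t * b); split; last by rewrite -/y -mulrA (cy b) mulrA -ht bb.
(* The witness t need not be central, but t b is: b = t y with y central, so (a t - t a) b = (a t -
   t a) y t = 0. *)
have aux a : (a * t - t * a) * y = 0.
  by rewrite mulrBl -!mulrA -ht (cy a) mulrA -ht cb subrr.
move=> a; apply/eqP; rewrite -mulrA -(cb a) !mulrA -subr_eq0 -mulrBl.
by rewrite {1}ht (cy t) mulrA aux mul0r.
Qed.

End RegularBimod.

(** * Right linear retractions from semisimplicity of bimodules *)

Section RightComplement.
Variables (k : comPzRingType) (T : kalg k).
Variables (N : lmodType T^c) (Y : set N).
Hypothesis hY : additive_subgroup Y.

Definition rm (n : N) (a : T) : N := (a : T^c) *: n.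

Hypothesis rY : forall y a, Y y -> Y (rm y a).

Lemma rmM n a b : rm (rm n a) b = rm n (a * b).
Proof. by rewrite /rm scalerA. Qed.
Lemma rm1 n : rm n 1 = n. Proof. exact: scale1r. Qed.
Lemma rmB a : addm (fun n => rm n a). Proof. by move=> x y; exact: scalerBr. Qed.
Lemma rmrB n : addm (rm n). Proof. by move=> x y; exact: scalerBl. Qed.

Definition center_elt (z : T) := forall a, a * z = z * a.

Lemma center_kstr (a : k) : center_elt (kstr T a).
Proof. by move=> x; rewrite kstr_central. Qed.

(* N b is a vector space over a field, and Y b has a complement in it.         *)
Lemma block_complement (b : T) : central_block b -> exists X : set N,
  [/\ additive_subgroup X, forall x z, X x -> center_elt z -> X (rm x z),
      forall y, Y y -> X (rm y b) -> rm y b = 0 &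
      forall n, exists2 y, Y y & X (rm n b - rm y b)].
Proof.
move=> [cb bb hb].
(* Membership of 0 is left out because [Zorn_bigcup] also tests the empty chain, whose union is
   empty; [X] below puts 0 back. *)
pose P (X : set N) := [/\ forall x y, X x -> X y -> X (x - y),
  forall x z, X x -> center_elt z -> X (rm x z) &
  forall y, Y y -> X (rm y b) -> rm y b = 0].
have [F FP tot|X0 [[PB PZ PY] Xmax]] := @Zorn_bigcup N P.
  split.
  - move=> x y [A FA Ax] [B FB By].
    have [AB|BA] := tot _ _ FA FB.
      by exists B => //; case: (FP _ FB) => h _ _; apply: h => //; exact: AB.
    by exists A => //; case: (FP _ FA) => h _ _; apply: h => //; exact: BA.
  - by move=> x z [A FA Ax] hz; exists A => //; case: (FP _ FA) => _ h _; apply: h.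
  - by move=> y Yy [A FA Ay]; case: (FP _ FA) => _ _ h; apply: h.
pose X : set N := [set x | x = 0 \/ X0 x].
have hX : additive_subgroup X.
  split; first by left.
  have XN y : X0 y -> X0 (- y).
    by move=> h; rewrite -sub0r -(subrr y); apply: (PB) => //; apply: (PB).
  move=> x y [->|hx] [->|hy].
  - by left; rewrite subrr.
  - by right; rewrite sub0r; exact: XN.
  - by right; rewrite subr0.
  - by right; exact: PB.
have XZ x z : X x -> center_elt z -> X (rm x z).
  by move=> [->|hx] hz; [left; exact: scaler0|right; exact: PZ].
have XY y : Y y -> X (rm y b) -> rm y b = 0.
  by move=> Yy [//|]; exact: PY.
exists X; split=> // n; apply: contrapT => hn.
have hn' y : Y y -> ~ X (rm n b - rm y b) by move=> Yy h; apply: hn; exists y.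
set m := rm n b in hn hn'.
have c1 : center_elt 1 by move=> a; rewrite mulr1 mul1r.
(* If m = n b had no part in Y b, adding its multiples by the centre would enlarge [X0] and keep
   [P]. *)
pose X' : set N := [set w | exists p z, [/\ X p, center_elt z & w = p + rm m z]].
have XX' : X0 `<=` X'.
  move=> x hx; exists x, 0; split; first by right.
    by move=> a; rewrite mulr0 mul0r.
  by rewrite (addm0 (rmrB m)) addr0.
have X'm : X' m.
  by exists 0, 1; split; [left| |rewrite rm1 add0r].
apply: (Xmax X').
  split=> // h; apply: (hn' 0); first exact: subg0.
  by rewrite (addm0 (rmB b)) subr0; right; exact: h.
split.
- move=> _ _ [p [z [hp hz ->]]] [p' [z' [hp' hz' ->]]].
  exists (p - p'), (z - z'); split; first exact: subgB.
    by move=> a; rewrite mulrBl mulrBr hz hz'.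
  by rewrite rmrB opprD addrACA.
- move=> _ z [p [z' [hp hz' ->]]] hz; exists (rm p z), (z' * z); split.
  + exact: XZ.
  + by move=> a; rewrite mulrA hz' -mulrA hz mulrA.
  + by rewrite (addmD (rmB z)) rmM.
- move=> y Yy [p [z [hp hz e]]].
  have [bz0|bz] := eqVneq (b * z) 0.
    apply: XY => //; rewrite e /m rmM bz0 (addm0 (rmrB n)) addr0 //.
  (* Dividing by b z, a unit in the centre of the block, turns y b = p + m z into (y t) b = p t + m,
     so that y t is a part of n after all. *)
  have [t [ct ht]] := hb _ hz bz.
  exfalso; apply: (hn' (rm y t)); first exact: rY.
  have -> : rm (rm y t) b = rm p t + m.
    rewrite rmM -(ct b) -rmM e (addmD (rmB t)) /m !rmM; congr (_ + rm n _).
    by rewrite mulrA ct.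
  rewrite opprD addrCA subrr addr0; apply: (subgN hX); exact: XZ.
Qed.

Definition rc_set : set ((N -> N) * T)%type := [set fz |
  [/\ addm fz.1,
      forall a n, fz.1 (rm n (kstr T a)) = rm (fz.1 n) (kstr T a),
      forall n, Y (fz.1 n) &
      forall y, Y y -> fz.1 y = rm y fz.2]].

(** Send n to y b for a y in Y with n b - y b in the complement X. The vector y is chosen but y b is
    determined, which makes the map additive and k-linear. *)
Lemma block_retraction (b : T) : central_block b ->
  exists f, rc_set (f, b).
Proof.
move=> hb; have [X [hX XZ XY Xn]] := block_complement hb.
have [cb _ _] := hb.
have [g hg] := choice (fun n => let: ex_intro2 y hy hx := Xn n in
  ex_intro _ y (conj hy hx)).
have gY n : Y (g n) by case: (hg n).
have gX n : X (rm n b - rm (g n) b) by case: (hg n).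
have uniq n y : Y y -> X (rm n b - rm y b) -> rm (g n) b = rm y b.
  move=> Yy h; apply/eqP; rewrite -subr_eq0 -(rmB b); apply/eqP/XY.
    exact: subgB.
  have -> : rm (g n - y) b = (rm n b - rm y b) - (rm n b - rm (g n) b).
    by rewrite rmB opprB [RHS]addrC addrA subrK.
  exact: subgB.
exists (fun n => rm (g n) b); split => /=.
- move=> x y; rewrite -(rmB b); apply: uniq; first exact: subgB.
  have := subgB hX (gX x) (gX y).
  by rewrite !(rmB b) !opprD !opprK addrACA.
- move=> a n; rewrite rmM (center_kstr a b) -rmM.
  rewrite (uniq _ (rm (g n) (kstr T a))) //; first exact: rY.
  rewrite !rmM -!(center_kstr a b) -!rmM -(rmB (kstr T a)).
  by apply: XZ => //; exact: center_kstr.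
- by move=> n; exact: rY.
- by move=> y Yy; apply: uniq => //; rewrite subrr; exact: subg0.
Qed.

Definition rc_prebimod : prebimod T T.
Proof.
refine (@Prebimod k T T ((N -> N) * T)%type rc_set
  (fun a fz => (fun n => fz.1 (rm n a), a * fz.2))
  (fun fz a => (fun n => rm (fz.1 n) a, fz.2 * a))
  _ _ _ _ _ _ _ _ _ _ _ _ _).
- split.
    split => //=; first by move=> x y; rewrite -[LHS]/(0 : N) subrr.
    + by move=> a n; rewrite -[LHS]/(0 : N) (addm0 (rmB _)).
    + by move=> n; exact: subg0.
    + by move=> y Yy; rewrite (addm0 (rmrB _)).
  move=> [f z] [g w] [/= f1 f2 f3 f4] [/= g1 g2 g3 g4]; split => /=.
  + move=> x y; rewrite -[LHS]/(f (x - y) - g (x - y)) f1 g1.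
    by rewrite -[RHS]/((f x - g x) - (f y - g y)) !opprD !opprK addrACA.
  + move=> a n; rewrite -[LHS]/(f (rm n (kstr T a)) - g (rm n (kstr T a))).
    by rewrite f2 g2 -(rmB (kstr T a)).
  + by move=> n; apply: subgB.
  + move=> y Yy; rewrite -[LHS]/(f y - g y) f4 // g4 //.
    by rewrite -(rmrB y).
- move=> a [f z] [/= f1 f2 f3 f4]; split=> /=.
  + by move=> x y; rewrite (rmB a) f1.
  + by move=> c n; rewrite rmM -(center_kstr c a) -rmM f2.
  + by move=> n; exact: f3.
  + by move=> y Yy; rewrite f4 ?rmM //; exact: rY.
- move=> [f z] a [/= f1 f2 f3 f4]; split=> /=.
  + by move=> x y; rewrite f1 (rmB a).
  + by move=> c n; rewrite f2 rmM -(center_kstr c a) -rmM.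
  + by move=> n; apply: rY.
  + by move=> y Yy; rewrite f4 ?rmM.
- by move=> s [f z] [g w] _ _ /=; congr (_, _); rewrite mulrDr.
- move=> s t [f z] [/= f1 _ _ _]; congr (_, _); last by rewrite mulrDl.
  by apply/funext => n; rewrite (addmD (rmrB n)) (addmD f1).
- move=> s t [f z] _ /=; congr (_, _); last by rewrite mulrA.
  by apply/funext => n; rewrite rmM.
- move=> [f z] _ /=; congr (_, _); last by rewrite mul1r.
  by apply/funext => n; rewrite rm1.
- move=> [f z] [g w] t _ _ /=; congr (_, _); last by rewrite mulrDl.
  by apply/funext => n; rewrite -[LHS]/(rm (f n + g n) t) (addmD (rmB t)).
- move=> [f z] s t _ /=; congr (_, _); last by rewrite mulrDr.
  by apply/funext => n; rewrite (addmD (rmrB _)).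
- move=> [f z] s t _ /=; congr (_, _); last by rewrite mulrA.
  by apply/funext => n; rewrite rmM.
- move=> [f z] _ /=; congr (_, _); last by rewrite mulr1.
  by apply/funext => n; rewrite rm1.
- by move=> s [f z] t _ /=; congr (_, _); rewrite mulrA.
- move=> a [f z] [/= _ f2 _ _]; congr (_, _); last by rewrite kstr_central.
  by apply/funext => n; rewrite f2.
Defined.

(* A central preimage of 1 under (f, z) |-> z is a right linear retraction.    *)
Lemma right_complement : (forall W : bimod T T, ss W) ->
  exists p : N -> N, [/\ addm p, forall n a, p (rm n a) = rm (p n) a,
    forall n, Y (p n) & forall y, Y y -> p y = y].
Proof.
move=> hss; pose E := bimod_of rc_prebimod.
pose q (x : E) : regular T := rgmk (@pbval _ _ _ rc_prebimod x).2.
have mq : mor q by split=> [x y|s x|x t]; apply: rgval_inj.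
have c1 : central (rgmk (1 : T)).
  by move=> a; apply: rgval_inj; rewrite rgval_l rgval_r !rgmkK mulr1 mul1r.
have [m [b [hb e]]] := central_blocks (hss (regular T)).
have [|x cx qx] := lift_central hss mq c1.
  have ch i := block_retraction (hb i).
  have [f hf] := choice ch.
  exists (\sum_i (@pbmk _ _ _ rc_prebimod _ (hf i) : E)) => //.
  rewrite (mor_sum _ _ _ mq); apply: rgval_inj.
  by rewrite (addm_sum (@rgvalB _ T)) rgmkK e; apply: eq_bigr.
have := @pbvalP _ _ _ rc_prebimod x.
have x2 : (@pbval _ _ _ rc_prebimod x).2 = 1 by have := congr1 (@rgval _ T) qx.
case=> h1 _ h3 h4; exists (@pbval _ _ _ rc_prebimod x).1; split => //.
- move=> n a.
  by have /(congr1 (fun y => (@pbval _ _ _ rc_prebimod y).1 n)) := cx a.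
- by move=> y Yy; rewrite h4 // x2 rm1.
Qed.

End RightComplement.

(** The kernel of [g] has a right linear retraction p, and w - p w depends only on [g w]; hence w
    |-> w - p w descends to a section of [g]. *)
Lemma all_projective (k : comPzRingType) (T : kalg k) :
  (forall W : bimod T T, ss W) -> forall P : lmodType T^c, projective P.
Proof.
move=> hss P M N g f gs.
have gB x y : g (x - y) = g x - g y by exact: raddfB.
have gL a x y : g (a *: x + y) = a *: g x + g y by exact: linearP.
have fL a x y : f (a *: x + y) = a *: f x + f y by exact: linearP.
pose K : set M := [set x | g x = 0].
have [|y a|p [pB pl pK pid]] := @right_complement _ T M K _ _ hss.
- split=> [|x y hx hy]; first exact: raddf0.
  by rewrite /K /= gB hx hy subrr.
- move=> hy; rewrite /K /=.
  have -> : g (rm y a) = (a : T^c) *: g y by exact: linearZ.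
  by rewrite hy scaler0.
have [s hs] := choice gs.
pose h (x : P) : M := s (f x) - p (s (f x)).
have hE x w : g w = f x -> h x = w - p w.
  move=> gw; apply/eqP; rewrite -subr_eq0 /h; apply/eqP.
  have -> : s (f x) - p (s (f x)) - (w - p w) = (s (f x) - w) - p (s (f x) - w).
    by rewrite pB !opprD !opprK addrACA.
  by rewrite pid ?subrr // /K /= gB hs gw subrr.
have [|H hH] := @linear_pack _ P M h.
  move=> a x y.
  rewrite (hE _ (a *: s (f x) + s (f y))); last by rewrite gL fL !hs.
  rewrite /h (addmD pB) -[a *: s _]/(rm (s (f x)) a) pl.
  by rewrite /rm scalerBr opprD addrACA.
exists H => x; rewrite hH /h gB hs.
by have := pK (s (f x)); rewrite /K /= => ->; rewrite subr0.
Qed.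

Section RightSpan.
Variables (k : comPzRingType) (S T : kalg k) (W : bimod S T).

Definition rspan (g : seq W) : set W :=
  [set w | exists c : nat -> T, w = \sum_(i < size g) ract g`_i (c i)].

Lemma rspan_sub g : additive_subgroup (rspan g).
Proof.
split; first by exists (fun=> 0); rewrite big1 // => i _; exact: (addm0 (ractrB _)).
move=> _ _ [c ->] [d ->]; exists (fun i => c i - d i).
by rewrite -sumrB; apply: eq_bigr => i _; rewrite -ractrB.
Qed.

Lemma rspan_r g w t : rspan g w -> rspan g (ract w t).
Proof.
move=> [c ->]; exists (fun i => c i * t); rewrite ract_sum.
by apply: eq_bigr => i _; rewrite ractM.
Qed.

Lemma rspan_mem g w : w \in g -> rspan g w.
Proof.
move=> wg; exists (fun i => if i == index w g then 1 else 0).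
have hi : (index w g < size g)%N by rewrite index_mem.
rewrite (bigD1 (Ordinal hi)) //= eqxx nth_index // ract1 big1 ?addr0 // => i ii.
rewrite ifN; first exact: (addm0 (ractrB _)).
by apply: contraNneq ii => h; apply/eqP/val_inj.
Qed.

Lemma rspan_min g (B : set W) : additive_subgroup B ->
  (forall w t, B w -> B (ract w t)) -> (forall w, w \in g -> B w) ->
  rspan g `<=` B.
Proof.
move=> hB hr hg _ [c ->]; apply: subg_sum => // i _; apply: hr; apply: hg.
exact: mem_nth.
Qed.

Lemma rspan_mono g h : {subset g <= h} -> rspan g `<=` rspan h.
Proof.
move=> gh; apply: rspan_min; [exact: rspan_sub|exact: rspan_r|].
by move=> w /gh; exact: rspan_mem.
Qed.

Definition rfin (A : set W) := exists g, A `<=` rspan g.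

Lemma rfin_sum (m : nat) (A : 'I_m -> set W) : (forall i, rfin (A i)) ->
  rfin [set w | exists2 f, forall i, A i (f i) & w = \sum_i f i].
Proof.
move=> h; have [g hg] := choice h.
exists (flatten [seq g i | i <- enum 'I_m]) => _ [f fA ->].
apply: subg_sum => [|i _]; first exact: rspan_sub.
apply: rspan_mono (hg i _ (fA i)) => w wg; apply/flattenP; exists (g i) => //.
by apply: map_f; rewrite mem_enum.
Qed.

Lemma rfinB (A B : set W) : rfin A -> rfin B ->
  rfin [set w | exists a b, [/\ A a, B b & w = a - b]].
Proof.
move=> [g hg] [h hh]; exists (g ++ h) => _ [a [b [/hg ga /hh hb ->]]].
apply: (subgB (rspan_sub _)).
  by apply: rspan_mono ga => w wg; rewrite mem_cat wg.
by apply: rspan_mono hb => w wg; rewrite mem_cat wg orbT.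
Qed.

Lemma rspan_scale s g w : rspan g w -> rspan (map (fun x => s *: x) g) (s *: w).
Proof.
apply: (@rspan_min g [set w | rspan (map (fun x => s *: x) g) (s *: w)]).
- split=> [|x y /= hx hy]; first by rewrite /= scaler0; exact: (subg0 (rspan_sub _)).
  by rewrite scalerBr; exact: (subgB (rspan_sub _)).
- by move=> x t /= hx; rewrite -ract_scale; exact: rspan_r.
- by move=> x xg /=; apply: rspan_mem; apply: map_f.
Qed.

Lemma rfin_scale s (A : set W) : rfin A -> rfin [set s *: a | a in A].
Proof.
by move=> [g hg]; exists (map (fun x => s *: x) g) => _ [a /hg ga <-]; exact: rspan_scale.
Qed.

End RightSpan.

(** * Simple bimodules are finitely generated on the right *)

Section SimpleFg.
Variables (k : comPzRingType) (T : kalg k).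
Hypothesis hss : forall W : bimod T T, ss W.
Variable N : bimod T T.

Definition rlin (f : N -> N) := addm f /\ forall n t, f (ract n t) = ract (f n) t.

Definition rend_prebimod : prebimod T T.
Proof.
refine (@Prebimod k T T (N -> N) [set f | rlin f] (fun a f n => a *: f n)
  (fun f b n => f (b *: n)) _ _ _ _ _ _ _ _ _ _ _ _ _).
- split; first split; first by move=> x y; rewrite -[LHS]/(0 : N) subrr.
    by move=> n t; rewrite -[LHS]/(0 : N) ract0.
  move=> f g [f1 f2] [g1 g2]; split.
    move=> x y; rewrite -[LHS]/(f (x - y) - g (x - y)) f1 g1.
    by rewrite -[RHS]/((f x - g x) - (f y - g y)) !opprD !opprK addrACA.
  move=> n t; rewrite -[LHS]/(f (ract n t) - g (ract n t)) f2 g2.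
  by rewrite -ractB.
- move=> s f [f1 f2]; split; first by move=> x y; rewrite f1 scalerBr.
  by move=> n t; rewrite f2 ract_scale.
- move=> f s [f1 f2]; split; first by move=> x y; rewrite scalerBr f1.
  by move=> n t; rewrite -ract_scale f2.
- by move=> s f g _ _; apply/funext => n; rewrite -scalerDr.
- by move=> s t f _; apply/funext => n; rewrite scalerDl.
- by move=> s t f _; apply/funext => n; rewrite scalerA.
- by move=> f _; apply/funext => n; rewrite scale1r.
- by move=> f g t _ _.
- by move=> f s t [f1 _]; apply/funext => n; rewrite scalerDl (addmD f1).
- by move=> f s t _; apply/funext => n; rewrite scalerA.
- by move=> f _; apply/funext => n; rewrite scale1r.
- by [].
- by move=> a f [_ f2]; apply/funext => n; rewrite !ract_kstr f2.
Defined.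

Definition rend := {f : N -> N | rlin f}.

(** The tensor of x and y, acting on right linear maps. The span [tset] is the image of T tensor T
    under this action and replaces it, so that no tensor product is constructed. *)
Definition tgen (x y : T) : rend -> N -> N := fun f n => x *: sval f (y *: n).

Definition tset : set (rend -> N -> N) :=
  finite_sums [set F | exists x y, F = tgen x y].

Lemma tset_ind (P : set (rend -> N -> N)) : additive_subgroup P ->
  (forall x y, P (tgen x y)) -> tset `<=` P.
Proof. by move=> hP hg; apply: fsums_min => // _ [x [y ->]]; exact: hg. Qed.

Lemma tset_sub : additive_subgroup tset.
Proof.
apply: fsums_subgroup => _ [x [y ->]]; exists (- x), y.
by apply/funext => f; apply/funext => n; rewrite /tgen scaleNr.
Qed.

Lemma tset_rlin F f : tset F -> rlin (F f).
Proof.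
apply: (@tset_ind [set F | rlin (F f)]).
  split; first exact: (subg0 (pb_sub rend_prebimod)).
  move=> F1 F2; exact: (subgB (pb_sub rend_prebimod)).
case: f => f [f1 f2] x y; split; rewrite /tgen /=.
  by move=> u v; rewrite -scalerBr -f1 -scalerBr.
by move=> n t; rewrite -ract_scale f2 ract_scale.
Qed.

Definition tprebimod : prebimod T T.
Proof.
refine (@Prebimod k T T (rend -> N -> N) tset (fun a F f n => a *: F f n)
  (fun F b f n => F f (b *: n)) tset_sub _ _ _ _ _ _ _ _ _ _ _ _).
- move=> s; apply: (@tset_ind [set F | tset (fun f n => s *: F f n)]).
    split => [|F G hF hG] /=.
      rewrite (_ : (fun f => _) = 0); first exact: (subg0 tset_sub).
      by apply/funext => f; apply/funext => n; rewrite scaler0.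
    rewrite (_ : (fun f => _) = (fun f n => s *: F f n) - (fun f n => s *: G f n)).
      exact: (subgB tset_sub).
    by apply/funext => f; apply/funext => n; rewrite -[RHS]scalerBr.
  move=> x y /=; apply: fsums_sub; exists (s * x), y.
  by apply/funext => f; apply/funext => n; rewrite /tgen scalerA.
- move=> F b; move: F.
  apply: (@tset_ind [set F | tset (fun f n => F f (b *: n))]).
    split => [|F G hF hG] /=; first exact: (subg0 tset_sub).
    exact: (subgB tset_sub hF hG).
  move=> x y /=; apply: fsums_sub; exists x, (y * b).
  by apply/funext => f; apply/funext => n; rewrite /tgen scalerA.
- by move=> s F G _ _; apply/funext => f; apply/funext => n; rewrite -scalerDr.
- by move=> s t F _; apply/funext => f; apply/funext => n; rewrite scalerDl.
- by move=> s t F _; apply/funext => f; apply/funext => n; rewrite scalerA.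
- by move=> F _; apply/funext => f; apply/funext => n; rewrite scale1r.
- by [].
- move=> F s t hF; apply/funext => f; apply/funext => n.
  by have [f1 _] := tset_rlin f hF; rewrite scalerDl (addmD f1).
- by move=> F s t _; apply/funext => f; apply/funext => n; rewrite scalerA.
- by move=> F _; apply/funext => f; apply/funext => n; rewrite scale1r.
- by [].
- move=> a F hF; apply/funext => f; apply/funext => n.
  by have [_ f2] := tset_rlin f hF; rewrite !ract_kstr f2.
Defined.

(* A central element F = sum_l x_l (x) y_l of T (x) T with sum_l x_l y_l = 1   *)
(* averages every right linear f to a bimodule endomorphism                    *)
(* n |-> sum_l x_l f (y_l n).  Applied to an f of finite rank fixing the       *)
(* vectors y_l s, this gives an endomorphism of finite rank that is nonzero at *)
(* s.                                                                          *)
Lemma simple_rfin : simple_bimod N -> rfin [set: N].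
Proof.
move=> [[s s0] hN].
pose Q := bimod_of tprebimod; pose H := bimod_of rend_prebimod.
pose qv (F : Q) := @pbval _ _ _ tprebimod F.
pose hv (f : H) := @pbval _ _ _ rend_prebimod f.
have qvP F : tset (qv F) by exact: (@pbvalP _ _ _ tprebimod).
have rid : rlin id by [].
pose q (F : Q) : H := @pbmk _ _ _ rend_prebimod (qv F (exist _ id rid))
  (tset_rlin (exist _ id rid) (qvP F)).
have hv_inj : injective hv by exact: pbval_inj.
have mq : mor q by split=> [x y|a x|x t]; apply: hv_inj.
have t1 : tset (tgen 1 1) by apply: fsums_sub; exists 1, 1.
pose idH : H := @pbmk _ _ _ rend_prebimod id rid.
have cid : central idH by move=> a; apply: hv_inj; apply/funext.
have [|F cF qF] := lift_central hss mq cid.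
  exists (@pbmk _ _ _ tprebimod _ t1) => //; apply: hv_inj.
  by apply/funext => n; rewrite -[LHS]/(tgen 1 1 _ n) /tgen /= !scale1r.
have [m [G [hG FE]]] := qvP F.
have [x hx] := choice hG.
have [y hy] := choice hx.
have FvE f n : qv F f n = \sum_(i < m) x i *: sval f (y i *: n).
  rewrite FE fct_sumE fct_sumE; apply: eq_bigr => i _; by rewrite hy.
pose ys := [seq y i *: s | i <- enum 'I_m].
have [||p [pB pl pY pid]] := @right_complement _ T (rmod N) (rspan ys) _ _ hss.
- exact: rspan_sub.
- by move=> w a; exact: rspan_r.
have rp : rlin p by split.
pose E := qv F (exist _ (p : N -> N) rp).
have [EB Er] : rlin E by apply: tset_rlin.
(* Centrality of F makes its value at every right linear map left linear as well. *)
have EZ a n : E (a *: n) = a *: E n.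
  by have /(congr1 (fun G => qv G (exist _ (p : N -> N) rp) n)) := cF a.
have mE : mor E by [].
(* F takes the identity to the identity, and p agrees with the identity on the vectors y_i s. *)
have Es : E s = s.
  rewrite /E FvE /=.
  have /(congr1 (fun f => hv f s)) := qF.
  rewrite -[LHS]/(qv F (exist _ id rid) s) FvE /= => e; rewrite -[RHS]e.
  apply: eq_bigr => i _; rewrite pid //; apply: rspan_mem.
  by apply: map_f; rewrite mem_enum.
have rE : range E = setT.
  case: (hN _ (subbimod_range mE)) => // h.
  have : range E s by exists s.
  by rewrite h => /= e; rewrite e eqxx in s0.
exists (flatten [seq map (fun w => x i *: w) ys | i <- enum 'I_m]) => w _.
have : range E w by rewrite rE.
case=> n _ <-; rewrite /E FvE; apply: subg_sum => [|i _]; first exact: rspan_sub.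
apply: rspan_mono (rspan_scale (x i) (pY (y i *: n))) => v hv'.
apply/flattenP; exists (map (fun w => x i *: w) ys) => //.
by apply: map_f; rewrite mem_enum.
Qed.

End SimpleFg.

(** * Rationality over the zeroth Zhu algebra *)

Section RationalZhu0.
Variables (k : comPzRingType) (U : acs_ring k).
Let A : kalg k := zhu U 0.
Hypothesis hss : forall n (M : bimod (zhu U n) A), ss M.
Variable W : grbimod U A.
Hypothesis hS : simple_grbimod W.

Lemma rfin_zbval n (B : set W) (hB : u0sub B) (hK : u0killed n B) :
  rfin [set: zbimod hB hK] -> rfin B.
Proof.
move=> [g hg]; exists (map (@zbval _ _ _ _ _ _ hB hK) g) => w hw.
have [c e] : rspan g (zbmk hB hK hw) by exact: hg.
exists c; rewrite -(zbmkK hB hK hw) e (addm_sum (@zbvalB _ _ _ _ _ _ hB hK)) size_map.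
by apply: eq_bigr => i _; rewrite (nth_map 0) // zbval_ract.
Qed.

Lemma zbimod_simple n d (hK : u0killed n (gb (g := W) d)) w :
  gb (g := W) d w -> w != 0 -> simple_bimod (zbimod (gb_u0sub W d) hK).
Proof.
move=> hw w0; split.
  exists (zbmk (gb_u0sub W d) hK hw); apply: contraNneq w0 => h.
  by rewrite -(zbmkK (gb_u0sub W d) hK hw) h.
move=> B hB; case: (simple_zbimod hS hB) => [h|]; [left|by right].
rewrite eqEsubset; split=> [x /h //|_ ->]; exact: (subg0 (sbm_sub hB)).
Qed.

Lemma rfin_bottom d0 w : gb (g := W) d0 w -> w != 0 ->
  (forall e, e < d0 -> gb (g := W) e = [set 0]) -> rfin (gb (g := W) d0).
Proof.
move=> hw w0 hd0.
have hK : u0killed 0 (gb (g := W) d0).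
  by move=> u v hu _; apply: (u0killed_gb hd0) hu; lia.
by apply: (@rfin_zbval 0 _ (gb_u0sub W d0) hK); apply: simple_rfin => //;
  exact: zbimod_simple hw w0.
Qed.

(** The identity of W_d is a finite sum of functions f, each in an atom of the bimodule of all
    functions from W_d to itself; it suffices that every such f has its values in a finitely
    generated right submodule. *)
Lemma rfin_piece d : rfin (gb (g := W) d).
Proof.
have [[w w0] _] := hS.
have [d0 [[b0 b0n hb0] hd0]] := bottom_degree w0.
have [h|/existsNP[v /not_implyP[vd /eqP v0]]] :=
  pselect (forall v, gb (g := W) d v -> v = 0).
  by exists [::] => v /h ->; exact: (subg0 (rspan_sub _)).
have fin0 := rfin_bottom hb0 b0n hd0.
have d0d : d0 <= d.
  by rewrite leNgt; apply/negP => /hd0 e; move: vd; rewrite e => /eqP; rewrite (negbTE v0).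
pose n := absz (d - d0).
have hK : u0killed n (gb (g := W) d).
  by move=> u x hu _; apply: (u0killed_gb hd0) hu; rewrite /n; lia.
pose M := zbimod (gb_u0sub W d) hK.
have sM : simple_bimod M by exact: zbimod_simple vd v0.
pose val_ (x : M) : W := zbval x.
have val_inj_ : injective val_ by exact: zbval_inj.
pose idf : fun_bimod M M := fbmk id.
have [m [p [hp e]]] := hss idf.
suff hj j : rfin [set val_ (fbval (p j idf) s) | s in [set: M]].
  have [g hg] := rfin_sum hj; exists g => x hx; apply: hg.
  exists (fun j => val_ (fbval (p j idf) (zbmk (gb_u0sub W d) hK hx))).
    by move=> j; exists (zbmk (gb_u0sub W d) hK hx).
  rewrite -(addm_sum (@zbvalB _ _ _ _ _ _ (gb_u0sub W d) hK)).
  by rewrite -(mor_sum _ _ _ (mor_ev M _)) -e.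
have [mj _ aj] := hp j; set B := range (p j) in aj; set f := p j idf.
have Bf : B f by exists idf.
have [h|/existsNP[s /eqP fs]] := pselect (forall s, fbval f s = 0).
  exists [::] => _ [s _ <-]; rewrite h; exact: (subg0 (rspan_sub _)).
have inj := atom_inj (mor_ev M s) aj Bf fs.
have atT : atom [set: M].
  split=> // C hC _; case: sM => _ /(_ _ hC)[->|->]; last by right.
  by left.
have surj z : exists2 g, B g & fbval g s = z.
  by apply: (atom_surj (mor_ev M s) _ atT _ Bf fs) => //; case: aj.
pose good (g : fun_bimod M M) := rfin [set val_ (fbval g s) | s in [set: M]].
have val_fbvalB (g1 g2 : fun_bimod M M) t :
    val_ (fbval (g1 - g2) t) = val_ (fbval g1 t) - val_ (fbval g2 t).
  rewrite (morB (mor_ev M t) g1 g2); exact: (@zbvalB _ _ _ _ _ _ (gb_u0sub W d) hK).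
have goodB g1 g2 : good g1 -> good g2 -> good (g1 - g2).
  move=> h1 h2; have [G hG] := rfinB h1 h2; exists G => _ [t _ <-]; apply: hG.
  exists (val_ (fbval g1 t)), (val_ (fbval g2 t)); split; [by exists t|by exists t|].
  exact: val_fbvalB.
have good0 : good 0 by exists [::] => _ [t _ <-]; exact: (subg0 (rspan_sub _)).
(* Evaluation at s identifies the atom B with W_d. [P] collects the x whose preimage g in B has its
   values in a finitely generated right submodule. *)
pose P : set W := [set x | gb (g := W) d x /\
  forall g, B g -> val_ (fbval g s) = x -> good g].
have hP : additive_subgroup P.
  split.
    split; first exact: (subg0 (gb_sub W d)).
    move=> g Bg /= gs; suff -> : g = 0 by [].
    have [sB _] := aj.
    by apply: inj => //; [exact: (subg0 (sbm_sub sB))|exact: val_inj_].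
  move=> x y [xd hx] [yd hy]; split; first exact: (subgB (gb_sub W d)).
  move=> g Bg gs.
  have [g1 B1 g1x] := surj (zbmk (gb_u0sub W d) hK xd).
  have [sB _] := aj.
  have -> : g = g1 - (g1 - g) by rewrite opprB addrC subrK.
  apply: goodB; first by apply: hx => //; rewrite g1x.
  apply: hy; first exact: (subgB (sbm_sub sB)).
  by rewrite val_fbvalB g1x gs /val_ zbmkK opprB addrC subrK.
(* Here g = (u c) g' where g' in B takes the value x at s, so the values of g lie in u W_{d0}. *)
have hgen u c x : gr U (d - d0) u -> gr U (d0 - d) c -> gb (g := W) d x ->
    P (u *: (c *: x)).
  move=> hu hc hx.
  have hcx : gb (g := W) d0 (c *: x).
    by rewrite -[d0](subrK d); exact: gb_scale.
  have huc : gr U 0 (u * c).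
    by have := gr_M hu hc; rewrite addrA subrK subrr.
  split; first by rewrite -[d](subrK d0); exact: gb_scale.
  move=> g Bg gs.
  have [g' B' g'x] := surj (zbmk (gb_u0sub W d) hK hx).
  have [sB _] := aj.
  have -> : g = zcl n (u * c) *: g'.
    apply: inj => //; first exact: sbm_l.
    rewrite (morZ _ _ (mor_ev M s)) g'x; apply: val_inj_.
    by rewrite gs /val_ zbval_zcl // zbmkK scalerA.
  have [G hG] := rfin_scale u fin0; exists G => _ [t _ <-]; apply: hG.
  exists (c *: val_ (fbval g' t)).
    by rewrite -[d0](subrK d); apply: gb_scale => //; exact: zbvalP.
  by rewrite scalerA -(zbval_zcl _ huc).
suff : P (val_ (fbval f s)) by case=> _; apply.
have fsd : gb (g := W) d (val_ (fbval f s)) by exact: zbvalP.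
(* By simplicity W_d = U_{d-d0} W_{d0} and W_{d0} = U_{d0-d} W_d, so the vectors u c x span W_d. *)
have gen1 : ugen (gb (g := W) d0) (val_ (fbval f s)).
  exact: (simple_ugen (d := d0) hS (gb_u0sub W d0) (fun x h => h) hb0 b0n).
have := @ugen_wcomp _ _ _ W (gb (g := W) d0) d0 _ (d - d0) (fun x h => h) gen1.
rewrite subrK (wcomp_id fsd); apply: (fsums_min hP) => _ [u [b [hu hb ->]]].
have gen2 : ugen (gb (g := W) d) b.
  exact: (simple_ugen (d := d) hS (gb_u0sub W d) (fun x h => h) vd v0).
have := @ugen_wcomp _ _ _ W (gb (g := W) d) d _ (d0 - d) (fun x h => h) gen2.
rewrite subrK (wcomp_id hb).
have hPu : additive_subgroup [set b | P (u *: b)].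
  split=> [|x y /= hx hy]; first by rewrite /= scaler0; exact: (subg0 hP).
  by rewrite scalerBr; exact: (subgB hP).
by apply: (fsums_min hPu) => _ [c [x [hc hx ->]]]; exact: hgen.
Qed.

Lemma simple_quasi_rigid0 : quasi_rigid W.
Proof.
move=> d; split; last by apply: all_projective; exact: (@hss 0).
have [g hg] := rfin_piece d.
(* The generators lie in W but perhaps outside W_d, so their components in degree d are taken. *)
exists (size g), (fun i => exist _ (wcomp d g`_i : rmod W) (asboolT (wcompP d g`_i))).
move=> x; have [c e] := hg _ (asboolW (valP x)).
exists (fun i => c i); apply: val_inj; rewrite raddf_sum /=.
rewrite -[LHS](wcomp_id (asboolW (valP x))) {1}e (addm_sum (@wcompB _ _ _ W d)).
by apply: eq_bigr => i _; rewrite wcomp_ract.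
Qed.

End RationalZhu0.

Lemma rational_zhu0_Gr (k : comPzRingType) (U : acs_ring k) :
  semisimple_Gr U (zhu U 0) -> rational U (zhu U 0).
Proof.
move=> h W; have [I [S [hS hW]]] := h W; exists I, S; split=> // i; split=> //.
exact: (simple_quasi_rigid0 (semisimple_Gr_zhu h)).
Qed.

(** * Sums of simple bimodules *)

Section Annihilated.
Variables (k : comPzRingType) (U : acs_ring k) (R : kalg k).

Definition annih (W : bimod U R) (x : W) :=
  forall p u, p < 0 -> gr U p u -> u *: x = 0.

(** Take the least n for which some nonzero u x is killed by NL^{n+1}. If n > 0, every v of degree
    at most -n kills u x, since otherwise the nonzero v u x would be killed by NL^1; then [killed]
    lets NL^n kill u x, against minimality. *)
Lemma annih_exists (W : bimod U R) (x : W) : exhaustive W -> x != 0 ->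
  exists2 u : U, u *: x != 0 & annih (u *: x).
Proof.
move=> hW x0.
pose Q (n : nat) := `[< exists2 u : U, u *: x != 0 &
  forall v, NL U n.+1%:Z v -> v *: (u *: x) = 0 >].
have exQ : exists n, Q n.
  have [n hn] := hW x; exists n; apply/asboolP; exists 1; rewrite scale1r //.
case: (ex_minnP exQ) => n /asboolP [u ux hu] nmin.
have n0 : n = 0%N.
  case: n hu nmin => // n hu nmin.
  have : ~ Q n by move/nmin; rewrite ltnn.
  case; apply/asboolP; exists u => //.
  apply: (@killed _ _ _ W n.+1%:Z _ hW) => p v hp hv; apply: contrapT => /eqP vx.
  have : Q 0%N.
    apply/asboolP; exists (v * u); first by rewrite -scalerA.
    move=> w hw; rewrite -scalerA scalerA; apply: hu.
    by apply: NL_decr (NL_r hw hv); lia.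
  by move/nmin.
exists u => // p v p0 hv; apply: hu; rewrite n0; apply: gr_NL hv; lia.
Qed.

Variable W : grbimod U R.

Lemma annih_u0sub d : u0sub [set x : W | gb d x /\ annih x].
Proof.
have [h0 hl hr] := gb_u0sub W d.
split; first split.
- by split; [exact: (subg0 h0)|move=> p u _ _; rewrite scaler0].
- move=> x y [xd hx] [yd hy]; split; first exact: (subgB h0).
  by move=> p u p0 hu; rewrite scalerBr (hx p) // (hy p) // subrr.
- move=> u x hu [xd hx]; split; first exact: hl.
  move=> p v p0 hv; rewrite scalerA; apply: (hx p) => //.
  by rewrite -[p]addr0; exact: gr_M.
- move=> x t [xd hx]; split; first exact: hr.
  by move=> p u p0 hu; rewrite -ract_scale (hx p) // ract0.
Qed.

Lemma annih_wcomp x d : annih x -> annih (wcomp (W := W) d x).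
Proof.
move=> hx p u p0 hu; rewrite -(wcomp_scale _ _ hu) (hx p) //.
exact: (addm0 (wcompB _)).
Qed.

(** A nonzero component of x in a degree d > d0 is again killed by U_{<0}. By simplicity such
    vectors of degree d would generate b0 through operators of degree d0 - d < 0, which kill
    them. *)
Lemma simple_annih d0 b0 x : simple_grbimod W -> gb (g := W) d0 b0 -> b0 != 0 ->
  (forall e, e < d0 -> gb (g := W) e = [set 0]) -> annih x -> gb (g := W) d0 x.
Proof.
move=> hS hb0 b0n hd0 hx.
apply/(dcomp_memP (@gb_sub _ _ _ W) (gb_direct W)) => d dd0.
rewrite -[dcomp _ _ _]/(wcomp d x); apply: contrapT => /eqP xd.
have [ld|ld] := ltrP d d0.
  by have := wcompP d x; rewrite hd0 // => e; rewrite /= in e; rewrite e eqxx in xd.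
have gen : ugen [set x : W | gb d x /\ annih x] b0.
  apply: (simple_ugen (d := d) (a := wcomp d x) hS (annih_u0sub d)) => //.
    by move=> y [].
  by split; [exact: wcompP|exact: annih_wcomp].
have := @ugen_wcomp _ _ _ W _ d b0 (d0 - d) (fun y h => proj1 h) gen.
rewrite subrK (wcomp_id hb0) => hb.
case/eqP: b0n.
have h0 : additive_subgroup [set 0 : W].
  by split=> // a b -> ->; rewrite /= subrr.
apply: (fsums_min h0) hb => _ [u [a [hu [_ ha] ->]]] /=.
by apply: (ha (d0 - d)) => //; rewrite subr_lt0 lt_neqAle eq_sym dd0.
Qed.

(** Any nonzero sub-bimodule contains a nonzero vector killed by U_{<0}. It has the lowest degree by
    [simple_annih], so what it generates is graded and hence everything. *)
Lemma simple_ungraded : simple_grbimod W -> simple_bimod W.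
Proof.
move=> hS; split; first by case: hS.
move=> A hA; have [h|/existsNP[x /not_implyP[Ax /eqP x0]]] :=
  pselect (forall x, A x -> x = 0).
  left; rewrite eqEsubset; split=> [x /h //|_ ->]; exact: (subg0 (sbm_sub hA)).
right; rewrite eqEsubset; split=> // y _.
have [d0 [[b0 b0n hb0] hd0]] := bottom_degree x0.
have [u ux au] := annih_exists (gb_exhaustive (g := W)) x0.
have ud := simple_annih hS hb0 b0n hd0 au.
have hB : u0sub (A `&` gb (g := W) d0).
  have [h0 hl hr] := gb_u0sub W d0.
  split; first split.
  - by split; [exact: (subg0 (sbm_sub hA))|exact: (subg0 h0)].
  - by move=> a b [? ?] [? ?]; split; [exact: (subgB (sbm_sub hA))|exact: (subgB h0)].
  - by move=> v a hv [? ?]; split; [exact: sbm_l|exact: hl].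
  - by move=> a t [? ?]; split; [exact: sbm_r|exact: hr].
apply: (@ugen_min _ _ _ _ (A `&` gb (g := W) d0)) => //.
apply: (simple_ugen (d := d0) (a := u *: x) hS hB) => //.
by split=> //; exact: sbm_l.
Qed.

End Annihilated.

(** * From sums to direct sums *)

Section SumDirect.
Variable (V : zmodType).

Definition sumset (J : set (set V)) : set V := finite_sums (\bigcup_(A in J) A).

Variable K : set (set V).
Hypothesis Ksub : forall A, K A -> additive_subgroup A.

Lemma sumset_sub J : J `<=` K -> additive_subgroup (sumset J).
Proof.
move=> JK; apply: fsums_subgroup => x [A JA Ax]; exists A => //.
by apply: subgN => //; apply: Ksub; exact: JK.
Qed.

Lemma sumset_in (J : set (set V)) A : J A -> A `<=` sumset J.
Proof. by move=> JA x Ax; apply: fsums_sub; exists A. Qed.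

Hypothesis Kmeet : forall A J, K A -> J `<=` K ->
  (forall x, A x -> sumset J x -> x = 0) \/ A `<=` sumset J.
Hypothesis Ktotal : forall v, sumset K v.

Definition independent (J : set (set V)) := forall (s : seq (set V)) f, uniq s ->
  (forall A, A \in s -> J A /\ A (f A)) -> \sum_(A <- s) f A = 0 ->
  forall A, A \in s -> f A = 0.

(** A finite list is absorbed by one member of the chain, except that the empty list may come with
    an empty chain. *)
Lemma chain_seq (F : set (set (set V))) (s : seq (set V)) : total_on F subset ->
  (forall A, A \in s -> (\bigcup_(J in F) J) A) ->
  s = [::] \/ exists2 J, F J & forall A, A \in s -> J A.
Proof.
move=> tot; elim: s => [|A s IH] h; first by left.
right; have [J FJ JA] := h A (mem_head _ _).
have [|->|[J' FJ' hJ']] := IH.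
- by move=> B Bs; apply: h; rewrite inE Bs orbT.
- by exists J => // B; rewrite inE => /eqP ->.
- have [JJ|JJ] := tot _ _ FJ FJ'.
    exists J' => // B; rewrite inE => /orP[/eqP ->|/hJ' //]; exact: JJ.
  by exists J => // B; rewrite inE => /orP[/eqP -> //|/hJ']; exact: JJ.
Qed.

(** For a maximal independent J, every A in K lies in the sum of J: otherwise [Kmeet] makes A meet
    that sum trivially, and A could be added to J. *)
Lemma sum_to_direct : exists J : set (set V), J `<=` K /\
  internal_direct_sum (fun i : {A : set V | `[< J A >]} => val i).
Proof.
pose P (J : set (set V)) := J `<=` K /\ independent J.
have [F FP tot|J [[JK indJ] Jmax]] := @Zorn_bigcup _ P.
  split; first by move=> A [J FJ JA]; case: (FP _ FJ) => + _; apply.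
  move=> s f us hs f0 A As.
  have [s0|[J FJ hJ]] := chain_seq tot (fun A h => proj1 (hs A h)).
    by rewrite s0 in As.
  have [_ ind] := FP _ FJ; apply: (ind s f us _ f0 A As) => B Bs.
  by split; [exact: hJ|case: (hs B Bs)].
have hsJ := sumset_sub JK.
have KJ A : K A -> A `<=` sumset J.
  move=> KA; have [h|//] := Kmeet KA JK.
  have [//|nA] := pselect (A `<=` sumset J); exfalso.
  have nJA : ~ J A by move=> JA; apply: nA; exact: sumset_in.
  apply: (Jmax (J `|` [set A])).
    by split; [move=> B JB; left|move/(_ A (or_intror erefl))].
  split; first by move=> B [/JK //|->].
  move=> s f us hs f0 B Bs.
  have hJ C : C \in s -> C != A -> J C.
    by move=> Cs CA; have [[//|/= e] _] := hs C Cs; rewrite e eqxx in CA.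
  have [As|As] := boolP (A \in s); last first.
    apply: (indJ s f us _ f0 B Bs) => C Cs; split; last by case: (hs C Cs).
    by apply: hJ => //; apply: contraNneq As => <-.
  have := f0; rewrite (bigD1_seq A) //= => e0.
  have fA : f A = 0.
    apply: h; first by case: (hs A As).
    have -> : f A = - \sum_(i <- s | i != A) f i by apply/eqP; rewrite -addr_eq0 e0.
    apply: subgN => //; rewrite big_seq_cond; apply: subg_sum => // C /andP[Cs CA].
    by apply: (sumset_in (hJ _ Cs CA)); case: (hs C Cs).
  have [->//|BA] := eqVneq B A.
  apply: (indJ [seq C <- s | C != A] f _ _ _ B).
  - exact: filter_uniq.
  - move=> C; rewrite mem_filter => /andP[CA Cs]; split; first exact: hJ.
    by case: (hs C Cs).
  - by rewrite big_filter; move: e0; rewrite fA add0r.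
  - by rewrite mem_filter BA.
exists J; split=> //.
pose pc (i : {A : set V | `[< J A >]}) : set V := val i.
have hpc i : additive_subgroup (pc i).
  by apply: Ksub; apply: JK; exact: asboolW (valP i).
split=> [v|s f us hf f0 i si].
  apply: (fsums_min (splits_in_subgroup hpc)) (Ktotal v) => x [A KA Ax].
  apply: (fsums_min (splits_in_subgroup hpc)) (KJ A KA x Ax) => y [B JB By].
  exact: (@splits_in_piece _ _ pc hpc (exist _ B (asboolT JB)) y By).
(* Independence is about sets while the direct sum is indexed by a subtype; f is extended by 0
   outside J. *)
pose f' (A : set V) : V :=
  if insub A is Some i then f (i : {A : set V | `[< J A >]}) else 0.
have f'E j : f' (val j) = f j by rewrite /f' valK.
rewrite -f'E; apply: (indJ (map val s)).
- by rewrite map_inj_uniq //; exact: val_inj.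
- move=> _ /mapP[j js ->]; rewrite f'E; split; first exact: asboolW (valP j).
  exact: hf.
- by rewrite big_map (eq_bigr f) // => j _; exact: f'E.
- exact: map_f.
Qed.

End SumDirect.

Section SumOfSimple.
Variables (k : comPzRingType) (U : acs_ring k) (R : kalg k).

Lemma sumset_subbimod (W : bimod U R) (J : set (set W)) :
  (forall A, J A -> subbimod A) -> subbimod (sumset J).
Proof.
move=> hJ.
have hs : additive_subgroup (sumset J).
  by apply: (@sumset_sub _ J) => // A /hJ /sbm_sub.
split=> //.
- move=> s.
  have hP : additive_subgroup [set x : W | sumset J (s *: x)].
    split=> [|x y /= hx hy]; first by rewrite /= scaler0; exact: (subg0 hs).
    by rewrite scalerBr; exact: (subgB hs).
  apply: (fsums_min hP) => x [A JA Ax] /=; apply: (sumset_in JA).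
  by apply: sbm_l => //; exact: hJ.
- move=> w t; move: w.
  have hP : additive_subgroup [set x : W | sumset J (ract x t)].
    split=> [|x y /= hx hy]; first by rewrite /= ract0; exact: (subg0 hs).
    by rewrite ractB; exact: (subgB hs).
  apply: (fsums_min hP) => x [A JA Ax] /=; apply: (sumset_in JA).
  by apply: sbm_r => //; exact: hJ.
Qed.

Lemma sbval_emb (W : bimod U R) (A : set W) (hA : subbimod A) :
  exists f : bimod_embedding (sub_bimod hA) W, forall x, f x = sbval x.
Proof.
have l : linear (@sbval _ _ _ _ _ hA) by [].
have [g hg] := linear_pack l.
have gr v t : g (ract v t) = ract (g v) t by rewrite !hg.
have gi : injective g by move=> x y; rewrite !hg; exact: sbval_inj.
by exists (BimodEmbedding gr gi).
Qed.

Definition simple_sub (W : bimod U R) (A : set W) :=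
  atom A /\ exists2 a, A a & a != 0.

Lemma range_emb (W : bimod U R) (A : set W) (hA : subbimod A)
  (f : sub_bimod hA -> W) : (forall x, f x = sbval x) -> range f = A.
Proof.
move=> hf; rewrite eqEsubset; split=> [_ [x _ <-]|x Ax].
  by rewrite hf; exact: (sbvalP x).
by exists (sbmk hA Ax) => //; rewrite hf.
Qed.

Lemma simple_sub_bimod (W : bimod U R) (A : set W) (hA : subbimod A) :
  simple_sub A -> simple_bimod (sub_bimod hA).
Proof.
move=> [[_ hat] [a Aa a0]]; split.
  by exists (sbmk hA Aa); apply: contraNneq a0 => h; rewrite -(sbmkK hA Aa) h.
move=> B hB.
have hC : subbimod (@sbval _ _ _ _ _ hA @` B).
  by apply: subbimod_image => //; exact: mor_sbval.
have CA : @sbval _ _ _ _ _ hA @` B `<=` A by move=> _ [x _ <-]; exact: (sbvalP x).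
case: (hat _ hC CA) => h; [left|right]; rewrite eqEsubset; split=> //.
- by move=> x Bx; apply: sbval_inj; apply: h; exists x.
- by move=> _ ->; exact: (subg0 (sbm_sub hB)).
- by move=> x _; have [y By /sbval_inj <-] := h _ (sbvalP x).
Qed.

Lemma sum_simple_Ex (W : bimod U R) : exhaustive W ->
  (forall w, sumset [set A : set W | simple_sub A] w) ->
  exists (I : eqType) (S : I -> bimod U R),
    (forall i, exhaustive (S i) /\ simple_bimod (S i)) /\ bimod_direct_sum W S.
Proof.
move=> hW htot.
have hK A : [set A : set W | simple_sub A] A -> subbimod A by case=> -[].
have [||J [JK hD]] := @sum_to_direct W [set A : set W | simple_sub A] _ _ htot.
- by move=> A /hK /sbm_sub.
- move=> A J [[hA hat] _] JK.
  have hJ : subbimod (sumset J) by apply: sumset_subbimod => B /JK /hK.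
  have [//| |h|h] := hat (A `&` sumset J); first exact: subbimod_setI.
  + by move=> x [].
  + by left=> x Ax Jx; apply: h.
  + by right=> x /h[].
pose I : eqType := {A : set W | `[< J A >]}.
have hI (i : I) : simple_sub (val i) by apply: JK; exact: asboolW (valP i).
have hI' (i : I) : subbimod (val i) := hK _ (hI i).
exists I, (fun i => sub_bimod (hI' i)); split.
  move=> i; split; last exact: simple_sub_bimod.
  by move=> w; have [n hn] := hW (sbval w); exists n => u hu; apply: sbval_inj; exact: hn.
exists (fun i => projT1 (cid (sbval_emb (hI' i)))).
rewrite (_ : (fun i => _) = (fun i : I => val i)) //; apply/funext => i.
by case: (cid _) => f hf /=; exact: range_emb.
Qed.

Section SubGraded.
Variables (W : grbimod U R) (A : set W) (hA : subbimod A).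
Hypothesis gA : graded_subset (gb (g := W)) A.

Lemma sub_gb_direct :
  internal_direct_sum (fun n => @sbval _ _ _ _ _ hA @^-1` gb (g := W) n).
Proof.
have hg := (graded_subsetP (sbm_sub hA)).1 gA.
split=> [v|s f us hf f0 i si].
  exists (dsupp (gb_direct W) (sbval v)),
    (fun n => sbmk hA (hg _ n (sbvalP v))); split.
  - exact: dsupp_uniq.
  - by move=> n; exact: wcompP.
  - apply: sbval_inj; rewrite (addm_sum (@sbvalB _ _ _ _ _ hA)).
    exact: wcomp_sum.
apply: sbval_inj; apply: ((gb_direct W).2 s (fun i => sbval (f i)) us hf _ i si).
by rewrite -(addm_sum (@sbvalB _ _ _ _ _ hA)) f0.
Qed.

Definition sub_grbimod : grbimod U R.
Proof.
refine (@GrBimod k U R (sub_bimod hA)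
  (fun n => @sbval _ _ _ _ _ hA @^-1` gb (g := W) n) _ _ sub_gb_direct _ _ _).
- move=> n; split; first exact: (subg0 (gb_sub W n)).
  move=> x y; exact: (subgB (gb_sub W n)).
- by move=> n w r; exact: gb_ract.
- by move=> p n u w hu; exact: gb_scale.
- have [m hm] := gb_bounded W; exists m => n /hm h.
  rewrite eqEsubset; split=> [x /=|_ ->]; last exact: (subg0 (gb_sub W n)).
  by rewrite h => /= x0; exact: sbval_inj.
- move=> w; have [n hn] := gb_exhaustive (sbval w).
  by exists n => u hu; apply: sbval_inj; exact: hn.
Defined.

End SubGraded.

Definition simple_gsub (W : grbimod U R) (A : set W) :=
  [/\ subbimod A, graded_subset (gb (g := W)) A, exists2 a, A a & a != 0 &
    forall B : set W, subbimod B -> graded_subset (gb (g := W)) B -> B `<=` A ->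
      (forall x, B x -> x = 0) \/ A `<=` B].

Lemma simple_sub_grbimod (W : grbimod U R) (A : set W) (hA : subbimod A)
  (gA : graded_subset (gb (g := W)) A) :
  simple_gsub A -> simple_grbimod (sub_grbimod hA gA).
Proof.
move=> [_ _ [a Aa a0] hat]; split.
  by exists (sbmk hA Aa); apply: contraNneq a0 => h; rewrite -(sbmkK hA Aa) h.
move=> B hB gB.
have hC : subbimod (@sbval _ _ _ _ _ hA @` B).
  by apply: subbimod_image => //; exact: mor_sbval.
have CA : @sbval _ _ _ _ _ hA @` B `<=` A by move=> _ [x _ <-]; exact: (sbvalP x).
have gC : graded_subset (gb (g := W)) (@sbval _ _ _ _ _ hA @` B).
  move=> _ [x /gB[s [f [us hf ->]]] <-].
  exists s, (fun n => sbval (f n)); split => //.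
    by move=> p; have [h1 h2] := hf p; split=> //; exists (f p).
  exact: (addm_sum (@sbvalB _ _ _ _ _ hA)).
case: (hat _ hC gC CA) => h; [left|right]; rewrite eqEsubset; split=> //.
- by move=> x Bx; apply: sbval_inj; apply: h; exists x.
- by move=> _ ->; exact: (subg0 (sbm_sub hB)).
- by move=> x _; have [y By /sbval_inj <-] := h _ (sbvalP x).
Qed.

Lemma sum_simple_Gr (W : grbimod U R) :
  (forall w, sumset [set A : set W | simple_gsub A] w) ->
  exists (I : eqType) (S : I -> grbimod U R),
    (forall i, simple_grbimod (S i)) /\ gr_direct_sum W S.
Proof.
move=> htot.
have hK A : [set A : set W | simple_gsub A] A -> subbimod A by case.
have gK A : [set A : set W | simple_gsub A] A -> graded_subset (gb (g := W)) A.
  by case.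
have [||J [JK hD]] := @sum_to_direct W [set A : set W | simple_gsub A] _ _ htot.
- by move=> A /hK /sbm_sub.
- move=> A J [hA gA _ hat] JK.
  have hJ : subbimod (sumset J) by apply: sumset_subbimod => B /JK /hK.
  have hAJ := subbimod_setI hA hJ.
  have gJ w n : sumset J w -> sumset J (wcomp n w).
    have hP : additive_subgroup [set w : W | sumset J (wcomp n w)].
      split=> [|x y /= hx hy]; last by rewrite wcompB; exact: (subgB (sbm_sub hJ)).
      by rewrite /= (addm0 (wcompB _)); exact: (subg0 (sbm_sub hJ)).
    apply: (fsums_min hP) => x [B JB Bx] /=; apply: (sumset_in JB).
    exact: ((graded_subsetP (sbm_sub (hK _ (JK _ JB)))).1 (gK _ (JK _ JB))).
  have gAJ : graded_subset (gb (g := W)) (A `&` sumset J).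
    apply/(graded_subsetP (sbm_sub hAJ)) => w n [Aw Jw]; split; last exact: gJ.
    exact: ((graded_subsetP (sbm_sub hA)).1 gA).
  have [|h|h] := hat _ hAJ gAJ; first by move=> x [].
  + by left=> x Ax Jx; apply: h.
  + by right=> x /h[].
pose I : eqType := {A : set W | `[< J A >]}.
have hI (i : I) : simple_gsub (val i) by apply: JK; exact: asboolW (valP i).
have hI' (i : I) : subbimod (val i) := hK _ (hI i).
have gI (i : I) : graded_subset (gb (g := W)) (val i) := gK _ (hI i).
exists I, (fun i => sub_grbimod (hI' i) (gI i)); split.
  by move=> i; exact: simple_sub_grbimod.
exists (fun i => projT1 (cid (sbval_emb (hI' i)))); split.
  by move=> i n v; case: (cid _) => f hf /=; rewrite hf.
rewrite (_ : (fun i => _) = (fun i : I => val i)) //; apply/funext => i.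
by case: (cid _) => f hf /=; exact: range_emb.
Qed.

End SumOfSimple.

(** * Graded and exhaustive bimodules *)

Section Rees.
Variables (k : comPzRingType) (U : acs_ring k) (R : kalg k).
Variables (W : bimod U R) (hW : exhaustive W).

(* The element w t^d of W[t, 1/t], encoded by the function sending x in U to   *)
(* the coefficients of the powers of t in x w t^d, and to the value of the     *)
(* latter at t = 1.                                                            *)
Definition rtheta (d : int) (w : W) : U -> option int -> W := fun x o =>
  if o is Some e then comp (e - d) x *: w else x *: w.

Definition fil (d : int) (w : W) : Prop :=
  forall p u, p + d < 0 -> gr U p u -> u *: w = 0.

Definition rpiece (d : int) : set (U -> option int -> W) :=
  [set F | exists2 w, fil d w & F = rtheta d w].

Lemma rthetaB d : addm (rtheta d).
Proof.
move=> v w; apply/funext => x; apply/funext => o.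
by case: o => [e|]; rewrite -[RHS]/(rtheta d v x _ - rtheta d w x _) /= scalerBr.
Qed.

Lemma rpiece_sub d : additive_subgroup (rpiece d).
Proof.
split.
  by exists 0; [move=> p u _ _; rewrite scaler0|rewrite (addm0 (@rthetaB d))].
move=> _ _ [v hv ->] [w hw ->]; exists (v - w); last by rewrite rthetaB.
by move=> p u pd hu; rewrite scalerBr (hv p) // (hw p) // subrr.
Qed.

Definition rset : set (U -> option int -> W) := splits_in rpiece.

Lemma rset_sub : additive_subgroup rset.
Proof. exact: (splits_in_subgroup rpiece_sub). Qed.

Lemma rpiece_rset d : rpiece d `<=` rset.
Proof. by move=> F hF; apply: (splits_in_piece rpiece_sub hF). Qed.

Lemma rset_ind (P : set (U -> option int -> W)) : additive_subgroup P ->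
  (forall d w, fil d w -> P (rtheta d w)) -> rset `<=` P.
Proof.
move=> hP hg _ [s [f [us hf ->]]]; apply: subg_sum => // d _.
by have [w hw ->] := hf d; exact: hg.
Qed.

Lemma rtheta_l p d u w : gr U p u ->
  (fun x => rtheta d w (x * u)) = rtheta (p + d) (u *: w).
Proof.
move=> hu; apply/funext => x; apply/funext => -[e|]; rewrite /rtheta scalerA //.
by rewrite -(comp_mulr _ _ hu); congr (comp _ _ *: w); lia.
Qed.

Lemma fil_l p d u w : gr U p u -> fil d w -> fil (p + d) (u *: w).
Proof.
move=> hu hw q v hq hv; rewrite scalerA; apply: (hw (q + p)); first by lia.
exact: gr_M.
Qed.

Lemma rset_add F : rset F -> addm F.
Proof.
have hP : additive_subgroup [set F : U -> option int -> W | addm F].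
  split=> [x y|f1 f2 h1 h2 x y]; first by rewrite -[LHS]/(0 : option int -> W) subrr.
  rewrite -[LHS]/(f1 (x - y) - f2 (x - y)) h1 h2.
  by rewrite -[RHS]/((f1 x - f2 x) - (f1 y - f2 y)) !opprD !opprK addrACA.
apply: (rset_ind hP) => d w _ x y; apply/funext => o.
case: o => [e|]; rewrite -[RHS]/(rtheta d w x _ - rtheta d w y _) /=.
  by rewrite compB scalerBl.
by rewrite scalerBl.
Qed.

Lemma rset_l u F : rset F -> rset (fun x => F (x * u)).
Proof.
move=> hF; elim/gr_ind: u => [u v hu hv||p u hu].
- rewrite (_ : (fun x => _) = (fun x => F (x * u)) + (fun x => F (x * v))).
    exact: (subgD rset_sub).
  by apply/funext => x; rewrite mulrDr (addmD (rset_add hF)).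
- rewrite (_ : (fun x => _) = 0); first exact: (subg0 rset_sub).
  by apply/funext => x; rewrite mulr0 (addm0 (rset_add hF)).
have hP : additive_subgroup [set F | rset (fun x => F (x * u))].
  split=> [|F1 F2 h1 h2]; first exact: (subg0 rset_sub).
  exact: (subgB rset_sub h1 h2).
apply: (rset_ind hP) hF => d w hw /=; rewrite (rtheta_l _ _ hu).
by apply: (@rpiece_rset (p + d)); exists (u *: w) => //; exact: fil_l.
Qed.

Lemma rtheta_r d w t :
  (fun x o => ract (rtheta d w x o) t) = rtheta d (ract w t).
Proof.
by apply/funext => x; apply/funext => -[e|]; rewrite /rtheta ract_scale.
Qed.

Lemma fil_r d w t : fil d w -> fil d (ract w t).
Proof. by move=> hw p u pd hu; rewrite -ract_scale (hw p) // ract0. Qed.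

Lemma rset_r t F : rset F -> rset (fun x o => ract (F x o) t).
Proof.
have hP : additive_subgroup [set F : U -> option int -> W |
    rset (fun x o => ract (F x o) t)].
  split=> [|F1 F2 h1 h2] /=.
    rewrite (_ : (fun x => _) = 0); first exact: (subg0 rset_sub).
    by apply/funext => x; apply/funext => o; rewrite ract0.
  rewrite (_ : (fun x => _) =
    (fun x o => ract (F1 x o) t) - (fun x o => ract (F2 x o) t)).
    exact: (subgB rset_sub h1 h2).
  by apply/funext => x; apply/funext => o; rewrite -[LHS]/(ract (F1 x o - F2 x o) t) ractB.
apply: (rset_ind hP) => d w hw /=; rewrite rtheta_r.
by apply: (@rpiece_rset d); exists (ract w t) => //; exact: fil_r.
Qed.

Lemma rset_k (a : k) F : rset F ->
  (fun x => F (x * kstr U a)) = (fun x o => ract (F x o) (kstr R a)).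
Proof.
have hP : additive_subgroup [set F : U -> option int -> W |
    (fun x => F (x * kstr U a)) = (fun x o => ract (F x o) (kstr R a))].
  split=> [|F1 F2 h1 h2] /=.
    by apply/funext => x; apply/funext => o; rewrite ract0.
  apply/funext => x; apply/funext => o.
  rewrite -[RHS]/(ract (F1 x o - F2 x o) _) ractB.
  rewrite -[LHS]/(F1 (x * kstr U a) o - F2 (x * kstr U a) o).
  by congr (_ - _); [exact: (congr1 (fun g => g x o) h1)|
                     exact: (congr1 (fun g => g x o) h2)].
apply: (rset_ind hP) => d w _ /=.
by rewrite (rtheta_l _ _ (gr_kstr U a)) add0r rtheta_r ract_kstr.
Qed.

Definition rees_prebimod : prebimod U R.
Proof.
refine (@Prebimod k U R (U -> option int -> W) rset (fun u F x => F (x * u))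
  (fun F t x o => ract (F x o) t) rset_sub rset_l (fun F t => @rset_r t F)
  _ _ _ _ _ _ _ _ _ _).
- by [].
- by move=> s t F hF; apply/funext => x; rewrite mulrDr (addmD (rset_add hF)).
- by move=> s t F hF; apply/funext => x; rewrite mulrA.
- by move=> F hF; apply/funext => x; rewrite mulr1.
- move=> F G t hF hG; apply/funext => x; apply/funext => o.
  by rewrite -[LHS]/(ract (F x o + G x o) t) ractDl.
- by move=> F s t hF; apply/funext => x; apply/funext => o; rewrite ractDr.
- by move=> F s t hF; apply/funext => x; apply/funext => o; rewrite ractM.
- by move=> F hF; apply/funext => x; apply/funext => o; rewrite ract1.
- by [].
- by move=> a F hF; exact: rset_k.
Defined.

Definition rees_bimod := bimod_of rees_prebimod.
Definition reval (x : rees_bimod) : U -> option int -> W :=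
  @pbval _ _ _ rees_prebimod x.
Definition remk F (h : rset F) : rees_bimod := @pbmk _ _ _ rees_prebimod F h.
Lemma revalP x : rset (reval x). Proof. exact: (@pbvalP _ _ _ rees_prebimod). Qed.
Lemma reval_inj : injective reval. Proof. exact: pbval_inj. Qed.
Lemma revalB : addm reval. Proof. by []. Qed.

Lemma rees_direct : internal_direct_sum (fun d => reval @^-1` rpiece d).
Proof.
split=> [v|s f us hf f0 i si].
  have [s [f [us hf vE]]] := revalP v.
  exists s, (fun i => remk (rpiece_rset (hf i))); split=> //.
  by apply: reval_inj; rewrite (addm_sum revalB) vE.
apply: reval_inj; have [w _ e] := hf i.
suff w0 : w = 0 by rewrite e w0 (addm0 (@rthetaB i)).
(* At x = 1 the coefficient of t^i is the vector of the term in degree i. *)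
have /(congr1 (fun v => reval v 1 (Some i))) := f0.
rewrite (addm_sum revalB) !fct_sumE (bigD1_seq i) //= big1 ?addr0.
  by rewrite e /rtheta subrr (comp_id (gr_1 U)) scale1r.
move=> j ji; have [v _ ->] := hf j; rewrite /rtheta.
by rewrite (comp_in _ (gr_1 U)) subr_eq0 eq_sym (negbTE ji) scale0r.
Qed.

Lemma rees_exhaustive : exhaustive rees_bimod.
Proof.
move=> F.
suff : [set F : U -> option int -> W | exists j : nat, forall v, NL U j.+1%:Z v ->
    (fun x => F (x * v)) = 0] (reval F).
  by case=> j hj; exists j => v hv; apply: reval_inj; exact: hj.
apply: rset_ind (revalP F).
  split; first by exists 0.
  move=> F1 F2 [i hi] [j hj]; exists (maxn i j) => v hv.
  have vi : NL U i.+1%:Z v by apply: NL_decr hv; rewrite lez_nat ltnS leq_maxl.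
  have vj : NL U j.+1%:Z v by apply: NL_decr hv; rewrite lez_nat ltnS leq_maxr.
  apply/funext => x; rewrite -[LHS]/(F1 (x * v) - F2 (x * v)).
  rewrite -[F1 (x * v)]/((fun x => F1 (x * v)) x) hi //.
  by rewrite -[F2 (x * v)]/((fun x => F2 (x * v)) x) hj //; exact: subrr.
move=> d w _; have [j hj] := hW w; exists j => v hv.
apply/funext => x; apply/funext => -[e|]; rewrite /rtheta hj //.
  by apply: NL_comp; exact: NL_l.
exact: NL_l.
Qed.

Definition rees : grbimod U R.
Proof.
refine (@GrBimod k U R rees_bimod (fun d => reval @^-1` rpiece d)
  _ _ rees_direct _ _ rees_exhaustive).
- move=> d; split; first exact: (subg0 (rpiece_sub d)).
  by move=> x y; exact: (subgB (rpiece_sub d)).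
- move=> d F t [w hw e]; exists (ract w t); first exact: fil_r.
  by rewrite -rtheta_r -e.
- move=> p d u F hu [w hw e]; exists (u *: w); first exact: fil_l.
  by rewrite -(rtheta_l _ _ hu) -e.
- exists 0 => d d0; rewrite eqEsubset; split=> [F [w hw e]|_ ->]; last first.
    exact: (subg0 (rpiece_sub d)).
  apply: reval_inj; rewrite e.
  (* For d < 0 the condition [fil] applies to 1 in U_0. *)
  have -> : w = 0 by rewrite -(scale1r w) (hw 0) ?add0r //; exact: gr_1.
  exact: (addm0 (@rthetaB d)).
Defined.

Definition rees_ev (F : rees_bimod) : W := reval F 1 None.

Lemma rees_ev_mor : mor rees_ev.
Proof.
split=> // u F; rewrite /rees_ev -[LHS]/(reval F (1 * u) None) mul1r.
have hP : additive_subgroup [set F : U -> option int -> W |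
    F u None = u *: F 1 None].
  split=> [|F1 F2 h1 h2] /=; first by rewrite -[RHS]/(u *: (0 : W)) scaler0.
  by rewrite -[LHS]/(F1 u None - F2 u None) h1 h2 -scalerBr.
by apply: (rset_ind hP) (revalP F) => d w _ /=; rewrite scale1r.
Qed.

Lemma rees_ev_surj w : exists F, rees_ev F = w.
Proof.
have [n hn] := hW w.
(* p + n < 0 means p <= -(n + 1), so that U_p lies in NL^{n+1}. *)
have h : fil n%:Z w.
  by move=> p u hp hu; apply: hn; apply: gr_NL hu; lia.
have hr : rpiece n%:Z (rtheta n%:Z w) by exists w.
exists (remk (rpiece_rset hr)).
by rewrite -[LHS]/(rtheta n%:Z w 1 None) /rtheta scale1r.
Qed.

End Rees.

(** * Semisimplicity passes between graded and exhaustive bimodules *)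

Section GrEx.
Variables (k : comPzRingType) (U : acs_ring k) (R : kalg k).

Lemma range_atom (V W : bimod U R) (f : V -> W) :
  mor f -> simple_bimod V -> atom (range f).
Proof.
move=> hf [_ hV]; split; first exact: subbimod_range.
move=> B hB Bf; case: (hV _ (subbimod_preim hf hB)) => h.
  left=> x Bx; have [v _ vx] := Bf _ Bx.
  have : (f @^-1` B) v by rewrite /= vx.
  by rewrite h /= => v0; rewrite -vx v0 (mor0 hf).
right=> _ [v _ <-]; have : (f @^-1` B) v by rewrite h.
by [].
Qed.

(** The simple graded summands of the Rees bimodule are simple, so their images in W are zero or
    simple, and these images add up to W. *)
Lemma semisimple_Gr_Ex : semisimple_Gr U R -> semisimple_Ex U R.
Proof.
move=> hgr W hW; apply: sum_simple_Ex => // w.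
have [I [S [hS [iota [ig hD]]]]] := hgr (rees hW).
have hA i := sbm_sub (subbimod_range (iota_mor (iota i))).
have [F <-] := rees_ev_surj hW w.
have mev : mor (@rees_ev _ _ _ W) by exact: rees_ev_mor.
have hK : additive_subgroup (sumset [set A : set W | simple_sub A]).
  by apply: (@sumset_sub _ [set A | simple_sub A]) => // A [[]] /sbm_sub.
rewrite [F](dcomp_sum hD) (mor_sum _ _ _ mev); apply: subg_sum => // i _.
have [v _ <-] := dcompP hA hD i F.
have mf : mor (@rees_ev _ _ _ W \o iota i).
  by apply: mor_comp => //; exact: (iota_mor (iota i)).
have [->|n0] := eqVneq (rees_ev (iota i v)) 0; first exact: (subg0 hK).
apply: (@sumset_in _ _ (range (@rees_ev _ _ _ W \o iota i))); last by exists v.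
split; last by exists (rees_ev (iota i v)) => //; exists v.
by apply: range_atom => //; exact: simple_ungraded.
Qed.

Hypothesis hEx : semisimple_Ex U R.

Lemma exhaustive_ss (W : bimod U R) : exhaustive W -> ss W.
Proof.
move=> hW; have [I [S [hS [iota hD]]]] := hEx hW.
apply: ss_direct hD => i; apply: range_atom; first exact: iota_mor.
by case: (hS i).
Qed.

Lemma sub_exhaustive (W : bimod U R) (A : set W) (hA : subbimod A) :
  exhaustive W -> exhaustive (sub_bimod hA).
Proof.
move=> hW w; have [n hn] := hW (sbval w).
by exists n => u hu; apply: sbval_inj; exact: hn.
Qed.

Variable W : grbimod U R.

Lemma lowest_degree (w : W) : w != 0 -> exists m,
  wcomp m w != 0 /\ forall q, q < m -> wcomp q w = 0.
Proof.
move=> w0; have [d1 hd1] := gb_bounded W.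
have hlow q : q < d1 -> wcomp q w = 0.
  by move=> /hd1 h; have := wcompP q w; rewrite h.
have [n hn] := wcomp_neq0 w0.
have dn : d1 <= n by rewrite leNgt; apply/negP => /hlow e; rewrite e eqxx in hn.
have exP : exists i : nat, wcomp (d1 + i%:Z) w != 0.
  by exists (absz (n - d1)); have -> : d1 + (absz (n - d1))%:Z = n by lia.
case: (ex_minnP exP) => i hi imin; exists (d1 + i%:Z); split=> // q hq.
have [/hlow //|qd] := ltrP q d1.
apply: contrapT => /eqP h; have := imin (absz (q - d1)).
have -> : d1 + (absz (q - d1))%:Z = q by lia.
by move=> /(_ h); lia.
Qed.

(* If ugen T had a proper nonzero graded part C, a retraction phi onto a       *)
(* simple sub-bimodule of C would map T, hence ugen T, to strictly higher      *)
(* degrees, and so would have no nonzero fixed vector.                         *)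
Lemma ugen_simple_gsub (d : int) (T : set W) t0 : u0sub T -> T `<=` gb d ->
  (forall x, T x -> annih x) ->
  (forall B : set W, u0sub B -> B `<=` T -> (forall x, B x -> x = 0) \/ T `<=` B) ->
  T t0 -> t0 != 0 -> simple_gsub (ugen T).
Proof.
move=> hT Td Ta Tat Tt0 t00.
have [hT0 hTl hTr] := hT.
have hU : subbimod (ugen T) by apply: ugen_subbimod => b t; exact: hTr.
have gU := ugen_graded Td.
split=> //; first by exists t0 => //; exact: ugen_in.
move=> C hC gC CU.
have [[c [Cc Tc] c0]|hCT] := pselect (exists2 c, C c /\ T c & c != 0).
  right; apply: ugen_min => // x Tx.
  have hCT : u0sub (C `&` T).
    split; first split.
    - by split; [exact: (subg0 (sbm_sub hC))|exact: (subg0 hT0)].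
    - by move=> a b [? ?] [? ?]; split; [exact: (subgB (sbm_sub hC))|exact: (subgB hT0)].
    - by move=> v a hv [? ?]; split; [exact: sbm_l|exact: hTl].
    - by move=> a t [? ?]; split; [exact: sbm_r|exact: hTr].
  case: (Tat _ hCT) => [y []//|h|h]; last by case: (h _ Tx).
  by move: c0; rewrite (h c) ?eqxx.
left=> c Cc; apply: contrapT => /eqP c0.
pose X := sub_bimod hU.
have hC' : subbimod (@sbval _ _ _ _ _ hU @^-1` C).
  by apply: subbimod_preim => //; exact: mor_sbval.
have eX : exhaustive X by apply: sub_exhaustive; exact: gb_exhaustive.
have C'c : (@sbval _ _ _ _ _ hU @^-1` C) (sbmk hU (CU _ Cc)) by [].
have [|ph [mph phC [s [Cs s0] phs]]] := ss_retract (exhaustive_ss eX)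
    (exhaustive_ss (sub_exhaustive (hA := hC') eX)) C'c.
  by apply: contraNneq c0 => h; rewrite -(sbmkK hU (CU _ Cc)) h.
(* The image lies in C, inside U T. Its components below degree d vanish because U_{<0} kills T, and
   the one in degree d because it lies in both C and T. *)
have phT t e : T (sbval t) -> e <= d -> wcomp e (sbval (ph t)) = 0.
  move=> _ ed; have Cp : C (sbval (ph t)) by exact: phC.
  have h := @ugen_wcomp _ _ _ W T d _ (e - d) Td (CU _ Cp); rewrite subrK in h.
  move: ed; rewrite le_eqVlt => /orP[/eqP ed|ed].
    apply: contrapT => /eqP n0; apply: hCT; exists (wcomp e (sbval (ph t))) => //.
    split; first exact: ((graded_subsetP (sbm_sub hC)).1 gC).
    by apply: ugenp0 => //; rewrite ed subrr in h; rewrite ed.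
  have h0 : additive_subgroup [set 0 : W].
    by split=> // a b -> ->; rewrite /= subrr.
  apply: (fsums_min h0) h => _ [u [a [hu /Ta ha ->]]] /=.
  by apply: (ha (e - d)) => //; rewrite subr_lt0.
(* A vector of degree p is a sum of vectors u t with u in U_{p-d}, so [phT] is shifted by p - d. *)
have raise p (x : X) : gb (g := W) p (sbval x) ->
    forall q, q <= p -> wcomp q (sbval (ph x)) = 0.
  move=> xp.
  pose P : set W := [set w | exists2 y : X, sbval y = w &
    forall q, q <= p -> wcomp q (sbval (ph y)) = 0].
  suff [y /sbval_inj -> //] : P (sbval x).
  have hP : additive_subgroup P.
    split.
      exists 0 => // q _; rewrite (mor0 mph); exact: (addm0 (wcompB q)).
    move=> _ _ [y <- hy] [z <- hz]; exists (y - z) => // q qp.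
    by rewrite (morB mph) sbvalB wcompB hy // hz // subrr.
  have := @ugen_wcomp _ _ _ W T d _ (p - d) Td (sbvalP x).
  rewrite subrK (wcomp_id xp); apply: (fsums_min hP) => _ [u [t [hu Tt ->]]].
  exists (u *: sbmk hU (ugen_in Tt)) => // q qp.
  rewrite (morZ _ _ mph) sbvalZ.
  have -> : q = (p - d) + (q - p + d) by lia.
  rewrite (wcomp_scale _ _ hu) phT ?scaler0 ?sbmkK //; lia.
have s0' : sbval s != 0.
  by apply: contraNneq s0 => h; apply/eqP/(@sbval_inj _ _ _ _ _ hU).
have [m [hm hlow]] := lowest_degree s0'.
case/eqP: hm.
have hg := (graded_subsetP (sbm_sub hU)).1 gU.
have sE : s = \sum_(n <- dsupp (gb_direct W) (sbval s)) sbmk hU (hg _ n (sbvalP s)).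
  apply: sbval_inj; rewrite (addm_sum (@sbvalB _ _ _ _ _ hU)); exact: wcomp_sum.
(* As s = ph s, its component in the lowest degree m could only come from components of s below m,
   and those are zero. *)
rewrite -phs {1}sE (mor_sum _ _ _ mph) (addm_sum (@sbvalB _ _ _ _ _ hU)).
rewrite (addm_sum (wcompB m)) big1 // => n _.
have [mn|nm] := leP m n; first by apply: (raise n) => //; exact: wcompP.
suff -> : sbmk hU (hg _ n (sbvalP s)) = 0.
  by rewrite (mor0 mph); exact: (addm0 (wcompB m)).
by apply: sbval_inj; exact: hlow.
Qed.

Lemma annih_killed d : u0killed 0 [set x : W | gb d x /\ annih x].
Proof.
move=> u x hu _ [_ hx].
apply: (@killed _ _ _ W 1 x (gb_exhaustive (g := W)) _ u hu) => p v hp hv.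
by apply: (hx p) => //; lia.
Qed.

(** Vectors of degree d killed by U_{<0} form a bimodule over the zeroth Zhu algebra, which is
    semisimple; its nonzero atoms generate simple graded sub-bimodules by [ugen_simple_gsub]. *)
Lemma sumset_annih d x : gb (g := W) d x -> annih x ->
  sumset [set A : set W | simple_gsub A] x.
Proof.
move=> xd xa.
have hx : [set x : W | gb d x /\ annih x] x by [].
pose Z := zbimod (annih_u0sub W d) (@annih_killed d).
have zB := @zbvalB _ _ _ _ _ _ (annih_u0sub W d) (@annih_killed d).
have [m [p [hp e]]] := semisimple_Ex_zhu hEx (zbmk _ (@annih_killed d) hx : Z).
have hK : additive_subgroup (sumset [set A : set W | simple_gsub A]).
  by apply: (@sumset_sub _ [set A | simple_gsub A]) => // A [] /sbm_sub.
rewrite -(zbmkK (annih_u0sub W d) (@annih_killed d) hx) e (addm_sum zB).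
apply: subg_sum => // j _; have [mj _ [sj aj]] := hp j.
set y := p j _.
have [->|y0] := eqVneq (zbval y) 0; first exact: (subg0 hK).
have Ty : (@zbval _ _ _ _ _ _ (annih_u0sub W d) (@annih_killed d) @` range (p j)) (zbval y).
  by exists y => //; exists (zbmk _ (@annih_killed d) hx).
apply: (@sumset_in _ _ (ugen (@zbval _ _ _ _ _ _ (annih_u0sub W d) (@annih_killed d)
  @` range (p j)))); last exact: ugen_in.
apply: (@ugen_simple_gsub d _ (zbval y)) => //.
- exact: u0sub_zbval.
- by move=> _ [z _ <-]; case: (zbvalP z).
- by move=> _ [z _ <-]; case: (zbvalP z).
- move=> B hB BT.
  have hB' := @subbimod_zbval _ _ _ _ _ _ (annih_u0sub W d) (@annih_killed d) B hB.
  case: (aj _ hB') => [z Bz|h|h].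
  + by have [z' rz' /zbval_inj <-] := BT _ Bz.
  + left=> b Bb; have [z rz zb] := BT _ Bb.
    rewrite -zb (h z) ?(addm0 zB) //; by rewrite /= zb.
  + by right=> _ [z /h Bz <-].
Qed.

(** W is semisimple without its grading. Every nonzero atom contains a nonzero vector killed by
    U_{<0}, whose homogeneous components fall under [sumset_annih]; the atom thus meets the sum
    nontrivially and lies in it. *)
Lemma sumset_simple_gsub w : sumset [set A : set W | simple_gsub A] w.
Proof.
set G := [set A : set W | simple_gsub A].
have hG : subbimod (sumset G) by apply: sumset_subbimod => A [].
have [m [p [hp ->]]] := exhaustive_ss (gb_exhaustive (g := W)) w.
apply: subg_sum => [|j _]; first exact: sbm_sub.
have [mj _ [sj aj]] := hp j; set y := p j w.
have [->|y0] := eqVneq y 0; first exact: (subg0 (sbm_sub hG)).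
have ry : range (p j) y by exists w.
have [u uy ua] := annih_exists (gb_exhaustive (g := W)) y0.
have Gu : sumset G (u *: y).
  rewrite [u *: y]wcomp_sum; apply: subg_sum => [|n _]; first exact: sbm_sub.
  by apply: (@sumset_annih n); [exact: wcompP|exact: annih_wcomp].
case: (aj _ (subbimod_setI sj hG)) => [x []//|h|h]; last by case: (h _ ry).
by move: uy; rewrite (h (u *: y)) ?eqxx //; split=> //; exact: sbm_l.
Qed.

End GrEx.

Lemma semisimple_Ex_Gr (k : comPzRingType) (U : acs_ring k) (R : kalg k) :
  semisimple_Ex U R -> semisimple_Gr U R.
Proof. by move=> h W; apply: sum_simple_Gr; exact: sumset_simple_gsub. Qed.

Theorem theorem9p11 (k : comPzRingType) (U : acs_ring k) :
  (forall R : kalg k,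
     rational U R <->
     semisimple_Gr U R /\
     (forall (n : nat) (M : bimod (zhu U n) R),
        simple_bimod M -> fg_projective (rmod M))) /\
  (rational U (zhu U 0) <-> semisimple_Gr U (zhu U 0)) /\
  (rational U (zhu U 0) <-> semisimple_Ex U (zhu U 0)).
Proof.
have h13 : rational U (zhu U 0) <-> semisimple_Gr U (zhu U 0).
  by split; [case/rational_iff|exact: rational_zhu0_Gr].
split; first by move=> R; exact: rational_iff.
split=> //; rewrite h13; split; [exact: semisimple_Gr_Ex|exact: semisimple_Ex_Gr].
Qed.
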